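(* Let $K\subset\mathbb{R}^2$ be the circle of radius $1$ centered at the origin $O$. Consider the following problem (P): among all paths (continuous rectifiable curves) in the plane that start at $O$ and intersect every tangent line of $K$, find one of minimal length. For $\theta\in\mathbb{R}$ put $e(\theta)=(\cos\theta,\sin\theta)$. Let $\mathfrak{C}_0$ be the path obtained by traversing consecutively: (i) the straight segment from $O$ to $B=\left(\tfrac{1}{\cos(\pi/6)},0\right)=\left(\tfrac{2}{\sqrt3},0\right)$; (ii) the straight segment from $B$ to $C=e(\pi/6)$ (this segment is tangent to $K$ at $C$ and has length $\tan(\pi/6)$); (iii) the arc $\{e(\theta): \pi/6\le\theta\le 4\pi/3\}$ of $K$, traversed once counterclockwise from $C$ to $E=e(4\pi/3)$ (an arc of length $\tfrac{3}{2}\pi-2\cdot\tfrac{\pi}{6}=\tfrac{7}{6}\pi$); (iv) the straight segment of length $1$ from $E$ to $F=e(4\pi/3)+e(4\pi/3+\pi/2)$ (tangent to $K$ at $E$, continuing in the direction of travel). Then $\mathfrak{C}_0$ is a solution of (P), and any other solution of (P) is, up to reparametrization, the image of $\mathfrak{C}_0$ under a rotation or reflection of the plane that maps $K$ to itself.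
   Context: A path is a continuous curve $f:[a,b]\to\mathbb{R}^2$ of finite length (rectifiable); its starting point is $f(a)$, and paths are considered up to orientation-preserving reparametrization (constant stretches being disregarded). A path intersects a line if at least one point $f(t)$ lies on the line. ''Solution of (P)'' means a path that starts at the center of $K$, intersects all tangent lines of $K$, and has the least length among all such paths. *)

(* Defs.v *)
(* Stdlib reals with Coquelicot. The Euclidean plane is Coquelicot's
   C := R * R, so that Cmod (p - q) is the Euclidean distance. *)
From Stdlib Require Import Reals.
From Coquelicot Require Import Coquelicot.

Local Open Scope R_scope.

Definition origin : C := (0, 0).

Definition e (theta : R) : C := (cos theta, sin theta).

Definition K (p : C) : Prop := Cmod p = 1.

Definition is_line (L : C -> Prop) : Prop :=
  exists p v : C, v <> origin /\
    forall q : C, L q <-> exists s : R, q = (p + RtoC s * v)%C.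

(* For a circle: a line is tangent iff it meets the circle in exactly one
   point. *)
Definition is_tangent_line (L : C -> Prop) : Prop :=
  is_line L /\ exists! p : C, K p /\ L p.

(* Only the values of pt on [lo, hi] matter. *)
Record curve := Curve { lo : R; hi : R; pt :> R -> C }.

(* s is the length of a polygon inscribed in g along a subdivision
   lo = t 0 <= t 1 <= ... <= t (n + 1) = hi. *)
Definition inscribed_length (g : curve) (s : R) : Prop :=
  exists (n : nat) (t : nat -> R),
    t 0%nat = lo g /\ t (S n) = hi g /\
    (forall i : nat, (i <= n)%nat -> t i <= t (S i)) /\
    s = sum_f_R0 (fun i => Cmod (g (t (S i)) - g (t i))%C) n.

Definition rectifiable (g : curve) : Prop := bound (inscribed_length g).

(* The supremum is finite as soon as g is rectifiable and lo g <= hi g. *)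
Definition path_length (g : curve) : R := real (Lub_Rbar (inscribed_length g)).

Definition is_path (g : curve) : Prop :=
  lo g <= hi g /\
  continuous_on (fun t : R => lo g <= t <= hi g) (pt g) /\
  rectifiable g.

Definition intersects (g : curve) (L : C -> Prop) : Prop :=
  exists t : R, lo g <= t <= hi g /\ L (g t).

Definition admissible (g : curve) : Prop :=
  is_path g /\ g (lo g) = origin /\
  forall L : C -> Prop, is_tangent_line L -> intersects g L.

Definition is_solution (g : curve) : Prop :=
  admissible g /\ forall h : curve, admissible h -> path_length g <= path_length h.

Definition is_reparam (phi : R -> R) (a b : R) : Prop :=
  continuous_on (fun s : R => 0 <= s <= 1) phi /\
  (forall s s' : R, 0 <= s -> s <= s' -> s' <= 1 -> phi s <= phi s') /\
  phi 0 = a /\ phi 1 = b.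

(* Equality up to orientation-preserving reparametrization: the changes of
   parameter are only nondecreasing, so that constant stretches of either curve
   are disregarded. *)
Definition same_path (g h : curve) : Prop :=
  exists phi psi : R -> R,
    is_reparam phi (lo g) (hi g) /\ is_reparam psi (lo h) (hi h) /\
    forall s : R, 0 <= s <= 1 -> g (phi s) = h (psi s).

(* Multiplication by e alpha is the rotation of angle alpha about the origin. *)
Definition is_rotation (f : C -> C) : Prop :=
  exists (c : C) (alpha : R), forall p : C, f p = (c + e alpha * (p - c))%C.

(* Reflection across the line through c of direction e beta. *)
Definition is_reflection (f : C -> C) : Prop :=
  exists (c : C) (beta : R),
    forall p : C, f p = (c + e (2 * beta) * Cconj (p - c))%C.

Definition maps_K_to_itself (f : C -> C) : Prop :=
  forall q : C, K q <-> exists p : C, K p /\ f p = q.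

Definition image (f : C -> C) (g : curve) : curve :=
  Curve (lo g) (hi g) (fun t => f (g t)).

Definition segment (P Q : C) (t : R) : C :=
  (RtoC (1 - t) * P + RtoC t * Q)%C.

Definition pointB : C := (1 / cos (PI / 6), 0).
Definition pointC : C := e (PI / 6).
Definition pointE : C := e (4 * PI / 3).
Definition pointF : C := (e (4 * PI / 3) + e (4 * PI / 3 + PI / 2))%C.

Definition C0 : curve :=
  Curve 0 4 (fun t =>
    if Rle_dec t 1 then segment origin pointB t
    else if Rle_dec t 2 then segment pointB pointC (t - 1)
    else if Rle_dec t 3 then e (PI / 6 + (t - 2) * (4 * PI / 3 - PI / 6))
    else segment pointE pointF (t - 3)).

(* Main.v *)
Require Import Defs.
From Stdlib Require Import Reals Lra Lia List ClassicalEpsilon ZArith Permutation.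
From Coquelicot Require Import Coquelicot.
Import ListNotations.
Local Open Scope R_scope.

(** A path from the origin meets the tangent line of direction [a] iff it has a point [p]
    with [<p, e a> >= 1], where [<., .>] is the scalar product ([hit]). So the minimal
    length can be computed on finite lists of points that hit every direction in this
    sense ([hits_all]), and curves are treated by sampling them finely and dilating
    the sample ([sample], [length_lower_bound]).

    Lower bound. Among the lists not longer than a given one, take those with as few
    points as possible, and among them a shortest one. Each point then owns a
    direction that no other point hits ([private_exists]), and a 2-opt exchange shows
    that no two edges cross in the cyclic order of these directions
    ([uncrossed_edges]). Consequently the directions hit by longer and longer prefixes
    form an interval from [k] to [s] that grows at its two ends ([covered_interval]).
    As long as it grows at one end, the length is bounded below by a linear functional
    that turns with the covered direction and loses the turning angle at every vertex
    ([Phi], [turn_gain]): [sqrt 3] for reaching the first tangent in the best way, one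
    unit per radian, and [1] for returning to the tangent at [k] after three quarters
    of a turn. This adds up to [L0 = 1 + sqrt 3 + 7 PI/6]. When the growth changes
    ends, there are two cases. Before a half turn is covered, reflecting the prefix in
    the bisector of the interval shortens the path and restores growth at one end
    ([Up_flip]). After a half turn, the step is a jump over the remaining gap, and
    since the path must still come back to the other end, the same functionals give at
    least [L0] ([Up_jump], [Post]). The optimal path is admissible of length at most
    [L0], so it is a solution ([C0_solution]).

    Uniqueness, first step. Every estimate is carried along with its near-equality
    case: a list of length close to [L0] contains points that sweep the directions
    monotonically from [k] to almost [k + 3 PI/2] and return to [k]
    ([short_list_sweeps]). Near equality in the calibration places these points close
    to a rotated copy of B, to the points of the arc and to F ([near_targets]). A
    cluster point of the rotations, together with compactness of the image, shows that
    a solution passes exactly through an isometric copy of B, of all points of the arc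
    and of F ([solution_targets]).

    Uniqueness, second step. After this isometry, take a fine grid on the arc. A path
    that visits the grid points in any order pays almost [7 PI/6] for them, so
    comparing with [L0] leaves no room for other orders than O, B, arc, F
    ([B_before_F], [arc_between_B_and_F]) nor for leaving the optimal path
    ([image_in_C0]). As the optimal path is a simple arc, this defines a continuous
    parameter along it, and going backwards would again cost too much
    ([param_monotone]). The parameter is the required change of parameter. *)

(** * Distances and directions in the plane *)

Definition dot (p q : C) : R := fst p * fst q + snd p * snd q.
Definition edist (p q : C) : R := Cmod (q - p)%C.

Lemma Cmod_sqr (p : C) : Cmod p * Cmod p = dot p p.
Proof.
  unfold Cmod, dot. rewrite sqrt_sqrt; [ring | nra].
Qed.

Lemma edist_sqr (p q : C) :
  edist p q * edist p q = (fst q - fst p) * (fst q - fst p) + (snd q - snd p) * (snd q - snd p).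
Proof.
  unfold edist. rewrite Cmod_sqr. destruct p, q; unfold dot; simpl; ring.
Qed.

Lemma edist_pos (p q : C) : 0 <= edist p q.
Proof. apply Cmod_ge_0. Qed.

Lemma edist_sym (p q : C) : edist p q = edist q p.
Proof.
  unfold edist. rewrite <- (Cmod_opp (p - q)%C). f_equal. ring.
Qed.

Lemma edist_tri (p q s : C) : edist p s <= edist p q + edist q s.
Proof.
  unfold edist. replace (s - p)%C with ((q - p) + (s - q))%C by ring. apply Cmod_triangle.
Qed.

Lemma edist_refl (p : C) : edist p p = 0.
Proof. unfold edist. replace (p - p)%C with (RtoC 0) by ring. apply Cmod_0. Qed.

Lemma edist_origin (p : C) : edist origin p = Cmod p.
Proof. unfold edist. f_equal. destruct p; unfold origin, Cminus, Cplus, Copp; simpl; f_equal; ring. Qed.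

Lemma edist_eq0 (p q : C) : edist p q <= 0 -> p = q.
Proof.
  intros H. assert (H0 : edist p q = 0) by (generalize (edist_pos p q); lra).
  unfold edist in H0. apply Cmod_eq_0 in H0.
  replace q with ((q - p) + p)%C by ring. rewrite H0. ring.
Qed.

Lemma dot_le_Cmod (u p : C) : dot u u <= 1 -> dot p u <= Cmod p.
Proof.
  intros Hu. generalize (Cmod_ge_0 p) (Cmod_sqr p). intros H1 H2.
  destruct (Rle_dec (dot p u) 0) as [|H]; [lra|].
  apply Rsqr_incr_0_var; [|lra]. unfold Rsqr.
  assert (dot p u * dot p u <= dot p p * dot u u).
  { unfold dot. generalize (Rle_0_sqr (fst p * snd u - snd p * fst u)). unfold Rsqr. nra. }
  assert (0 <= dot p p) by (unfold dot; nra). nra.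
Qed.

Lemma dot_le_edist (u p q : C) : dot u u <= 1 -> dot q u - dot p u <= edist p q.
Proof.
  intros Hu. replace (dot q u - dot p u) with (dot (q - p)%C u).
  - now apply dot_le_Cmod.
  - destruct p, q; unfold dot; simpl; ring.
Qed.

Lemma dot_e_e (a b : R) : dot (e a) (e b) = cos (a - b).
Proof. unfold dot, e; simpl. rewrite cos_minus. ring. Qed.

Lemma dot_e_unit (a : R) : dot (e a) (e a) <= 1.
Proof. rewrite dot_e_e. replace (a - a) with 0 by ring. rewrite cos_0. lra. Qed.

Lemma Cmod_e (a : R) : Cmod (e a) = 1.
Proof.
  unfold Cmod, e; simpl. replace (cos a * (cos a * 1) + sin a * (sin a * 1)) with 1.
  - apply sqrt_1.
  - generalize (sin2_cos2 a). unfold Rsqr. lra.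
Qed.

(** The derivative of [sin x - x cos x] is [x sin x], which is nonnegative from [0] to
    [PI]. *)
Lemma cos_x_le_sin (x : R) : 0 <= x <= PI -> x * cos x <= sin x.
Proof.
  intros [H0 H1]. destruct (Req_dec x 0) as [->|Hx].
  { rewrite sin_0. lra. }
  destruct (MVT_gen (fun x => sin x - x * cos x) 0 x (fun x => x * sin x)) as [c [Hc1 Hc2]].
  - intros t _. auto_derive; [easy|ring].
  - intros t _. apply continuity_pt_minus. apply continuity_sin.
    apply continuity_pt_mult. apply derivable_continuous_pt, derivable_pt_id. apply continuity_cos.
  - rewrite Rmin_left, Rmax_right in Hc1 by lra.
    rewrite sin_0 in Hc2.
    assert (0 <= c * sin c). { apply Rmult_le_pos; [lra|]. apply sin_ge_0; lra. }
    nra.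
Qed.

Lemma cos_lower (x : R) : 1 - x * x / 2 <= cos x.
Proof.
  replace x with (2 * (x / 2)) at 3 by field. rewrite cos_2a_sin.
  assert (sin (x/2) * sin (x/2) <= x/2 * (x/2)); [|lra].
  assert (H : forall y, 0 <= y -> sin y * sin y <= y * y).
  { intros y Hy. destruct (Req_dec y 0) as [->|]. rewrite sin_0; lra.
    generalize (sin_lt_x y) (SIN_bound y). intros.
    destruct (Rle_dec 0 (sin y)). nra.
    destruct (Rle_dec y PI). assert (0 <= sin y) by (apply sin_ge_0; lra). lra.
    generalize PI2_3_2. intros. nra. }
  destruct (Rle_dec 0 (x/2)). now apply H.
  generalize (H (- (x/2))). rewrite sin_neg. intros. nra.
Qed.

Lemma e_half (a : R) : e (a + PI / 2) = (- sin a, cos a).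
Proof. unfold e. rewrite cos_plus, sin_plus, cos_PI2, sin_PI2. f_equal; ring. Qed.

Lemma e_2PI (a : R) : e (a + 2 * PI) = e a.
Proof. unfold e. now rewrite cos_plus, sin_plus, cos_2PI, sin_2PI, !Rmult_1_r, !Rmult_0_r, Rminus_0_r, Rplus_0_r. Qed.

(** * Points beyond a tangent line *)

(** For [r = 1], the point lies on or beyond the tangent line of direction [a]. A
    connected path from the origin meets that line iff some point of it is hit in this
    sense, so finite lists of points can stand for paths; values [r < 1] give the
    tolerance needed in near-equality arguments. *)
Definition hit (r : R) (p : C) (a : R) : Prop := r <= dot p (e a).

Lemma dot_add (p : C) (a b : R) :
  dot p (e (a + b)) = cos b * dot p (e a) + sin b * dot p (e (a + PI/2)).
Proof. rewrite e_half. unfold dot, e; simpl. rewrite cos_plus, sin_plus. ring. Qed.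

(** The vectors [e a], [e b], [e c] of the plane are linearly dependent, with
    coefficients given by the sines of the three differences. *)
Lemma dot_interp (p : C) (a b c : R) :
  sin (c - a) * dot p (e b) = sin (c - b) * dot p (e a) + sin (b - a) * dot p (e c).
Proof.
  unfold dot, e; simpl. rewrite !sin_minus.
  generalize (sin2_cos2 a) (sin2_cos2 b) (sin2_cos2 c); unfold Rsqr; intros.
  ring.
Qed.

Lemma sin_pos_sum (x y : R) : 0 <= x -> 0 <= y -> x + y < PI -> sin (x + y) <= sin x + sin y.
Proof.
  intros. rewrite sin_plus.
  generalize (COS_bound x) (COS_bound y). intros.
  assert (0 <= sin x) by (apply sin_ge_0; lra).
  assert (0 <= sin y) by (apply sin_ge_0; lra). nra.
Qed.

(** The half planes beyond the tangents at [a] and at [c] intersect inside the one at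
    any intermediate direction, by [dot_interp] and subadditivity of the sine. *)
Lemma hit_between (r : R) (p : C) (a b c : R) :
  0 <= r -> a <= b <= c -> c - a < PI -> hit r p a -> hit r p c -> hit r p b.
Proof.
  intros Hr [Hab Hbc] Hca Ha Hc. unfold hit in *.
  destruct (Req_dec a c) as [E|E].
  { replace b with a by lra. exact Ha. }
  generalize (dot_interp p a b c). intros I.
  assert (0 < sin (c - a)) by (apply sin_gt_0; lra).
  assert (0 <= sin (c - b)) by (apply sin_ge_0; lra).
  assert (0 <= sin (b - a)) by (apply sin_ge_0; lra).
  assert (sin (c - a) <= sin (c - b) + sin (b - a)).
  { replace (c - a) with ((c - b) + (b - a)) by ring. apply sin_pos_sum; lra. }
  apply Rmult_le_reg_l with (sin (c - a)); [easy|]. rewrite I. nra.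
Qed.

(** The derivative of [<p, e (m + PI/2)>] in [m] is [- <p, e m>], which is at most [- r]
    as long as [p] hits [m]. This drop, summed over the vertices of a path, is the
    source of the arc length in every lower bound. *)
Lemma turn_gain (r : R) (p : C) (a b : R) :
  0 <= r -> a <= b -> b - a < PI -> hit r p a -> hit r p b ->
  r * (b - a) <= dot p (e (a + PI/2)) - dot p (e (b + PI/2)).
Proof.
  intros Hr Hab Hba Ha Hb. unfold hit in *.
  (* In the frame of the bisector both sides reduce to [h cos h <= sin h]. *)
  set (h := (b - a) / 2). set (m := (a + b) / 2).
  assert (Ea : a = m - h) by (unfold m, h; field).
  assert (Eb : b = m + h) by (unfold m, h; field).
  assert (Hh : 0 <= h < PI / 2) by (unfold h; lra).
  replace (b - a) with (2 * h) by (unfold h; field).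
  assert (E1 : dot p (e a) + dot p (e b) = 2 * cos h * dot p (e m)).
  { rewrite Ea, Eb. unfold dot, e; simpl. rewrite cos_plus, cos_minus, sin_plus, sin_minus. ring. }
  assert (E2 : dot p (e (a + PI/2)) - dot p (e (b + PI/2)) = 2 * sin h * dot p (e m)).
  { rewrite !e_half, Ea, Eb. unfold dot, e; simpl. rewrite cos_plus, cos_minus, sin_plus, sin_minus. ring. }
  rewrite E2.
  assert (Hc : 0 < cos h) by (apply cos_gt_0; lra).
  assert (Hs : 0 <= sin h) by (apply sin_ge_0; lra).
  generalize (cos_x_le_sin h). intros Hx.
  apply Rmult_le_reg_l with (cos h); [easy|].
  assert (r <= cos h * dot p (e m)) by lra.
  assert (h * cos h <= sin h) by (apply Hx; lra).
  replace (cos h * (2 * sin h * dot p (e m))) with (2 * sin h * (cos h * dot p (e m))) by ring.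
  nra.
Qed.

(** * Lengths of polygons *)

Fixpoint plen (p : C) (l : list C) : R :=
  match l with
  | [] => 0
  | q :: l' => edist p q + plen q l'
  end.

Lemma last_cons {A} (l : list A) (x d : A) : last (x :: l) d = last l x.
Proof.
  revert x d. induction l as [|y l IH]; intros x d; [easy|].
  change (last (y :: l) d = last (y :: l) x). now rewrite !IH.
Qed.

Lemma last_app_cons {A} (l1 l2 : list A) (x d : A) : last (l1 ++ x :: l2) d = last l2 x.
Proof.
  revert d. induction l1 as [|y l1 IH]; intros d; simpl app; rewrite last_cons; auto.
Qed.

Lemma plen_app (p : C) (l1 l2 : list C) :
  plen p (l1 ++ l2) = plen p l1 + plen (last l1 p) l2.
Proof.
  revert p. induction l1 as [|q l1 IH]; intros p; simpl plen at 1 2.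
  - simpl. ring.
  - simpl app. simpl plen at 1. rewrite IH.
    rewrite last_cons.
    ring.
Qed.

Lemma last_snoc {A} (l : list A) (x d : A) : last (l ++ [x]) d = x.
Proof. now rewrite last_app_cons. Qed.

Lemma plen_snoc (p q : C) (l : list C) : plen p (l ++ [q]) = plen p l + edist (last l p) q.
Proof. rewrite plen_app. simpl. ring. Qed.

Lemma plen_pos (p : C) (l : list C) : 0 <= plen p l.
Proof.
  revert p; induction l as [|q l IH]; intros p; simpl; [lra|].
  generalize (edist_pos p q) (IH q). lra.
Qed.

Lemma plen_drop (p q : C) (l : list C) : plen p l <= edist p q + plen q l.
Proof.
  destruct l as [|x l]; simpl. generalize (edist_pos p q); lra.
  generalize (edist_tri p q x). lra.
Qed.

Lemma plen_remove (p q : C) (l1 l2 : list C) : plen p (l1 ++ l2) <= plen p (l1 ++ q :: l2).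
Proof.
  rewrite !plen_app. simpl. generalize (plen_drop (last l1 p) q l2). lra.
Qed.

Lemma edist_last_plen (p : C) (l : list C) : edist p (last l p) <= plen p l.
Proof.
  revert p. induction l as [|q l IH]; intros p.
  - simpl. rewrite edist_refl. lra.
  - rewrite last_cons. simpl. generalize (IH q) (edist_tri p q (last l q)). lra.
Qed.

Lemma plen_rev (x y : C) (s : list C) : plen x (s ++ [y]) = plen y (rev s ++ [x]).
Proof.
  revert x. induction s as [|z s IH]; intros x; simpl.
  - rewrite edist_sym. ring.
  - rewrite IH, (plen_snoc y x), last_snoc, (edist_sym z x). ring.
Qed.

(** * Monotone chains around the disc *)

(** The points turn monotonically around the disc: the directions from [a] to [b] are
    cut into successive intervals, and each point hits a whole interval. *)
Inductive chain (r : R) : R -> list C -> R -> Prop :=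
| chain_nil a : chain r a [] a
| chain_cons a b c p l :
    a <= b -> b - a < PI -> hit r p a -> hit r p b -> chain r b l c -> chain r a (p :: l) c.

(** Restricts the directions used in a telescoping sum to a window from [x] to [y]. *)
Definition clamp (x y t : R) := Rmin (Rmax t x) y.

(** Each edge of the chain is at least its projection on the direction [e (t + PI/2)],
    with [t] the direction shared by its two ends, and [turn_gain] accounts for the
    change of [t] at each vertex. The window from [n] to [m] allows the functional to
    start and to end at chosen directions. *)
Lemma chain_bound r a l b : 0 <= r -> chain r a l b -> forall n m p, n <= m ->
  dot (last l p) (e (clamp n m b + PI/2)) - dot p (e (clamp n m a + PI/2))
  + r * (clamp n m b - clamp n m a) <= plen p l.
Proof.
  intros Hr H. induction H as [a|a b c q l Hab Hpi Ha Hb Hc IH]; intros n m p Hnm.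
  - simpl. lra.
  - rewrite last_cons. simpl plen.
    specialize (IH n m q Hnm).
    assert (D := dot_le_edist (e (clamp n m a + PI/2)) p q (dot_e_unit _)).
    assert (G : r * (clamp n m b - clamp n m a) <=
       dot q (e (clamp n m a + PI/2)) - dot q (e (clamp n m b + PI/2))).
    { set (a' := clamp n m a). set (b' := clamp n m b).
      assert (Hab' : a' <= b').
      { unfold a', b', clamp, Rmin, Rmax. repeat destruct Rle_dec; lra. }
      destruct (Req_dec a' b') as [E|E]. rewrite E. lra.
      assert (a <= a' /\ b' <= b).
      { revert E. unfold a', b', clamp, Rmin, Rmax. repeat destruct Rle_dec; lra. }
      apply turn_gain; try lra.
      apply hit_between with a b; try easy; lra.
      apply hit_between with a b; try easy; lra. }
    lra.
Qed.

Lemma chain_app r a l1 b l2 c : chain r a l1 b -> chain r b l2 c -> chain r a (l1 ++ l2) c.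
Proof. induction 1; simpl; [easy|]. intros. econstructor; eauto. Qed.

Lemma chain_snoc r a l b c p : chain r a l b -> b <= c -> c - b < PI -> hit r p b -> hit r p c ->
  chain r a (l ++ [p]) c.
Proof.
  intros. eapply chain_app; [eassumption|]. econstructor; eauto. constructor.
Qed.

Lemma chain_split r a l b t : 0 <= r -> chain r a l b -> l <> [] -> a <= t <= b ->
  exists l1 p l2, l = l1 ++ p :: l2 /\ chain r a (l1 ++ [p]) t /\ chain r t (p :: l2) b /\ hit r p t.
Proof.
  intros Hr H. induction H as [a|a b c q l Hab Hpi Ha Hb Hc IH]; intros Hl Ht; [easy|].
  destruct (Rle_dec t b) as [Htb|Htb].
  - exists [], q, l. assert (hit r q t) by (apply hit_between with a b; try easy; lra).
    repeat split; try easy.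
    + simpl. econstructor; [| | | |constructor]; try easy; lra.
    + econstructor; [| | | |eassumption]; try easy; lra.
  - assert (l <> []). { intros ->. inversion Hc; subst. lra. }
    destruct IH as (l1 & p & l2 & E & H1 & H2 & H3); [easy|lra|].
    exists (q :: l1), p, l2. subst l. repeat split; try easy.
    simpl. econstructor; [| | | |eassumption]; try easy; lra.
Qed.

(** * The calibration of a covered interval of directions *)

(** The length of the optimal path, since [2 / sqrt 3 + 1 / sqrt 3 = sqrt 3]. *)
Definition L0 : R := 1 + sqrt 3 + 7 * PI / 6.

Lemma dot_conj (p : C) (a : R) : dot (Cconj p) (e a) = dot p (e (- a)).
Proof. unfold dot, e, Cconj; simpl. rewrite cos_neg, sin_neg. ring. Qed.

Lemma edist_conj (p q : C) : edist (Cconj p) (Cconj q) = edist p q.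
Proof.
  unfold edist. replace (Cconj q - Cconj p)%C with (Cconj (q - p)).
  - apply Cmod_conj.
  - destruct p, q; unfold Cconj, Cminus, Cplus, Copp; simpl; f_equal; ring.
Qed.

Lemma conj_conj (p : C) : Cconj (Cconj p) = p.
Proof. destruct p; unfold Cconj; simpl; f_equal; ring. Qed.

Lemma conj_origin : Cconj origin = origin.
Proof. unfold Cconj, origin; simpl; f_equal; ring. Qed.

Lemma map_conj_conj (l : list C) : map Cconj (map Cconj l) = l.
Proof. induction l; simpl; [easy|]. now rewrite conj_conj, IHl. Qed.

Lemma plen_map (f : C -> C) (p : C) (l : list C) :
  (forall x y, edist (f x) (f y) = edist x y) -> plen (f p) (map f l) = plen p l.
Proof.
  intros Hf. revert p; induction l; intros p; simpl; [easy|]. now rewrite Hf, IHl.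
Qed.

Lemma plen_conj (l : list C) : plen origin (map Cconj l) = plen origin l.
Proof. rewrite <- conj_origin at 1. apply plen_map, edist_conj. Qed.

Lemma last_map (f : C -> C) (p : C) (l : list C) : last (map f l) (f p) = f (last l p).
Proof. revert p; induction l; intros p; [easy|]. simpl map. now rewrite !last_cons. Qed.

Lemma last_conj (l : list C) : last (map Cconj l) origin = Cconj (last l origin).
Proof. rewrite <- conj_origin at 1. apply last_map. Qed.

Lemma hit_conj r p a : hit r (Cconj p) a <-> hit r p (- a).
Proof. unfold hit. now rewrite dot_conj. Qed.

Lemma hit_2PI r p a : hit r p (a + 2 * PI) <-> hit r p a.
Proof. unfold hit. now rewrite e_2PI. Qed.

(** The calibration. A path of length [S] from the origin that has covered the
    directions from [k] to [s] and now stands at [q] satisfies this linear bound for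
    every [m] in the covered range. At [m = k + PI/3] it says that a point [b] beyond
    the tangent at [k] has [|b| >= <b, e (k + PI/6)> >= <b, e (k + 5 PI/6)> + sqrt 3],
    because [e (k + PI/6) - e (k + 5 PI/6) = sqrt 3 e k]; equality forces [b] to be a
    rotated copy of the corner B of the optimal path. The term [m - k - PI/3] comes from
    [turn_gain]. At [m = k + 3 PI/2] the functional is [<., e k>], so a last point
    beyond the tangent at [k] yields [S >= 1 + sqrt 3 + 7 PI/6 = L0]. *)
Definition Phi (k s : R) (q : C) (S : R) : Prop :=
  forall m, k + PI/3 <= m <= Rmax s (k + PI/3) ->
    dot q (e (m + PI/2)) + sqrt 3 + (m - k - PI/3) <= S.

Lemma Phi_move k s q q' S : Phi k s q S -> Phi k s q' (S + edist q q').
Proof.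
  intros H m Hm. specialize (H m Hm).
  generalize (dot_le_edist (e (m + PI/2)) q q' (dot_e_unit _)). lra.
Qed.

(** At the point [q] itself the calibration extends from [s] to [s'] by [turn_gain]. *)
Lemma Phi_turn k s s' q S :
  Phi k s q S -> s <= s' -> s' - s < PI -> hit 1 q s -> hit 1 q s' -> Phi k s' q S.
Proof.
  intros H Hs Hpi H1 H2 m Hm.
  destruct (Rle_dec m (Rmax s (k + PI/3))) as [Hl|Hl].
  { apply H; lra. }
  set (m0 := Rmax s (k + PI/3)) in *.
  assert (s <= m0 /\ k + PI/3 <= m0) as [Hm1 Hm2].
  { unfold m0; split; [apply Rmax_l|apply Rmax_r]. }
  assert (m <= s').
  { destruct Hm as [_ Hm]. unfold Rmax in Hm. destruct Rle_dec in Hm; lra. }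
  assert (B0 := H m0 ltac:(fold m0; lra)).
  assert (hit 1 q m0) by (apply hit_between with s s'; try easy; lra).
  assert (hit 1 q m) by (apply hit_between with s s'; try easy; lra).
  assert (G := turn_gain 1 q m0 m ltac:(lra) ltac:(lra) ltac:(lra) ltac:(easy) ltac:(easy)).
  lra.
Qed.

(** The initial bound: a single point that hits [k] and [s] obeys the calibration with
    its distance from the origin. *)
Lemma Phi_single k s q :
  k <= s -> s - k < PI -> hit 1 q k -> hit 1 q s -> Phi k s q (Cmod q).
Proof.
  intros H1 H2 H3 H4. apply Phi_turn with k; try easy.
  intros m Hm. rewrite Rmax_right in Hm by (generalize PI_RGT_0; lra).
  replace m with (k + PI/3) by lra.
  assert (B0 := dot_le_Cmod (e (k + PI/6)) q (dot_e_unit _)).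
  unfold hit in H3.
  (* The direction [k + PI/6] is the one of the corner B seen from O. *)
  replace (k + PI/3 + PI/2) with (k + (PI - PI/6)) by field.
  rewrite dot_add in B0 |- *.
  rewrite cos_minus, sin_minus, cos_PI, sin_PI.
  rewrite cos_PI6, sin_PI6 in *.
  assert (0 < sqrt 3) by (apply sqrt_lt_R0; lra). nra.
Qed.

(** Numerical relations between three margins: a length surplus [d], a tolerance [r < 1]
    for hitting, and an angle [y0] by which a covered interval may fall short of [3
    PI/2]. Whenever an estimate loses less than [d], the path in question hits within
    tolerance [r], up to [y0], in the same order as the optimal path. *)
Definition tuned (d r y0 : R) : Prop :=
  0 < d /\ d <= 1/10 /\ 20 * d <= (1 - r) * (1 - r) /\ 0 <= r <= 1 /\
  0 < y0 <= PI/4 /\ d + 1 <= 1 / cos y0.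

(** The near-equality witness for prefixes: up to the tolerance [r] the path behaves
    like the beginning of the optimal path. *)
Definition Clean (r k s : R) (l : list C) : Prop :=
  exists c, c <> [] /\ chain r k c s /\ incl c l /\
    last c origin = last l origin /\ plen origin c <= plen origin l.

(** The prefix [l] has covered the directions from [k] to [s] and ends beyond the
    tangent at the upper end [s]. The calibration holds for a length [S] which is at
    least [d] below the real length, unless the prefix is clean. The mirrored list
    describes prefixes that end at the lower end. *)
Definition Up (d r k s : R) (l : list C) : Prop :=
  l <> [] /\ hit 1 (last l origin) s /\
  exists S, Phi k s (last l origin) S /\ S <= plen origin l /\
    (S + d <= plen origin l \/ Clean r k s l).

(** The list contains points that meet tangents in the order of the optimal path: a
    monotone chain over almost [3 PI/2], then a point back at the direction [k]. *)
Definition Sweep (r y0 : R) (l : list C) : Prop :=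
  exists k c F s, c <> [] /\ chain r k c s /\ k + 3 * PI / 2 - y0 <= s /\ hit r F k /\
    incl (c ++ [F]) l /\ plen origin (c ++ [F]) <= plen origin l.

(** The mirrored list sweeps in the opposite sense. *)
Definition SweepEither r y0 l := Sweep r y0 l \/ Sweep r y0 (map Cconj l).

Definition Fin (d r y0 : R) (l : list C) : Prop :=
  L0 <= plen origin l /\ (L0 + d <= plen origin l \/ SweepEither r y0 l).

(** The path covered at least a half turn, then jumped over the gap to the other end of
    the covered interval, and still has to come back to a point hitting [s]. As [kk <=
    1], the bound is stable under further travel, and it gives [L0] once [s] is hit. *)
Definition Post (d r y0 s : R) (l : list C) : Prop :=
  exists S kk, 0 <= kk <= 1 /\ L0 - kk + kk * dot (last l origin) (e s) <= S /\
    S <= plen origin l /\ (S + d <= plen origin l \/ SweepEither r y0 l).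

Lemma plen_snoc_le l q : plen origin l <= plen origin (l ++ [q]).
Proof. rewrite plen_snoc. generalize (edist_pos (last l origin) q). lra. Qed.

Lemma Sweep_snoc r y0 l q : Sweep r y0 l -> Sweep r y0 (l ++ [q]).
Proof.
  intros (k & c & F & s & H1 & H2 & H3 & H4 & H5 & H6).
  exists k, c, F, s. repeat split; try easy.
  - apply incl_appl. easy.
  - generalize (plen_snoc_le l q). lra.
Qed.

Lemma SweepEither_snoc r y0 l q : SweepEither r y0 l -> SweepEither r y0 (l ++ [q]).
Proof.
  intros [H|H]; [left|right]. now apply Sweep_snoc.
  rewrite map_app. now apply Sweep_snoc.
Qed.

Lemma Fin_snoc d r y0 l q : Fin d r y0 l -> Fin d r y0 (l ++ [q]).
Proof.
  intros [H1 H2]. generalize (plen_snoc_le l q). intros H3. split; [lra|].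
  destruct H2; [left; lra|right; now apply SweepEither_snoc].
Qed.

Lemma SweepEither_conj r y0 l : SweepEither r y0 (map Cconj l) -> SweepEither r y0 l.
Proof. intros [H|H]; [now right|left]. now rewrite map_conj_conj in H. Qed.

Lemma Fin_conj d r y0 l : Fin d r y0 (map Cconj l) -> Fin d r y0 l.
Proof.
  unfold Fin. rewrite plen_conj. intros [H1 [H2|H2]]; split; try easy; [now left|right].
  now apply SweepEither_conj.
Qed.

Lemma Post_snoc d r y0 s l q : Post d r y0 s l -> Post d r y0 s (l ++ [q]).
Proof.
  intros (S & kk & H1 & H2 & H3 & H4).
  exists (S + edist (last l origin) q), kk. rewrite last_snoc, plen_snoc.
  generalize (dot_le_edist (e s) (last l origin) q (dot_e_unit _)) (edist_pos (last l origin) q). intros.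
  repeat split; try easy; try lra.
  - nra.
  - destruct H4; [left; lra|right; now apply SweepEither_snoc].
Qed.

Lemma Post_Fin d r y0 s l : Post d r y0 s l -> hit 1 (last l origin) s -> Fin d r y0 l.
Proof.
  intros (S & kk & H1 & H2 & H3 & H4) H. unfold hit in H.
  assert (L0 <= S) by nra. split; [lra|]. destruct H4; [left; lra|now right].
Qed.

Lemma last_incl (l : list C) : l <> [] -> In (last l origin) l.
Proof.
  destruct l as [|p l]; [easy|]. intros _. rewrite last_cons.
  revert p. induction l as [|q l IH]; intros p; [now left|]. rewrite last_cons. right. apply IH.
Qed.

(** * Extending the interval at one end *)

Lemma Up_single d r k s l : r <= 1 -> l <> [] -> k <= s -> s - k < PI ->
  hit 1 (last l origin) k -> hit 1 (last l origin) s -> Up d r k s l.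
Proof.
  intros Hr Hl H1 H2 H3 H4. split; [easy|split; [easy|]].
  exists (Cmod (last l origin)).
  assert (Cmod (last l origin) <= plen origin l).
  { rewrite <- edist_origin. apply edist_last_plen. }
  split; [now apply Phi_single|]. split; [easy|]. right.
  exists [last l origin]. split; [easy|]. split.
  - econstructor; [| | | |constructor]; try easy; unfold hit in *; lra.
  - split; [|split].
    + intros x [<-|[]]. now apply last_incl.
    + easy.
    + simpl. rewrite edist_origin. lra.
Qed.

Lemma Clean_turn r k s s' l : 0 <= r <= 1 -> Clean r k s l -> l <> [] -> s <= s' -> s' - s < PI ->
  hit r (last l origin) s -> hit r (last l origin) s' -> Clean r k s' l.
Proof.
  intros Hr (c & H1 & H2 & H3 & H4 & H5) Hl Hs Hpi Ha Hb.
  exists (c ++ [last l origin]). split; [now destruct c|]. split; [|split; [|split]].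
  - now apply chain_snoc with s.
  - apply incl_app; [easy|]. intros x [<-|[]]. now apply last_incl.
  - apply last_snoc.
  - rewrite plen_snoc, H4, edist_refl. lra.
Qed.

Lemma Up_turn d r k s s' l : 0 <= r <= 1 -> Up d r k s l -> s <= s' -> s' - s < PI ->
  hit 1 (last l origin) s' -> Up d r k s' l.
Proof.
  intros Hr (Hl & H1 & S & H2 & H3 & H4) Hs Hpi H5.
  split; [easy|split; [easy|]]. exists S. split; [now apply Phi_turn with s|]. split; [easy|].
  destruct H4 as [H4|H4]; [now left|right].
  apply Clean_turn with s; try easy; unfold hit in *; lra.
Qed.

Lemma Clean_snoc r k s l q : 0 <= r <= 1 -> Clean r k s l -> hit r q s -> Clean r k s (l ++ [q]).
Proof.
  intros Hr (c & H1 & H2 & H3 & H4 & H5) Hq.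
  exists (c ++ [q]). split; [now destruct c|]. split; [|split; [|split]].
  - apply chain_snoc with s; try easy; generalize PI_RGT_0; lra.
  - apply incl_app; [now apply incl_appl|]. now apply incl_appr.
  - now rewrite !last_snoc.
  - rewrite !plen_snoc, H4. lra.
Qed.

Lemma snoc_not_nil (l : list C) q : l ++ [q] <> [].
Proof. now destruct l. Qed.

Lemma Up_step d r k s s' l q : 0 <= r <= 1 -> Up d r k s l -> s <= s' -> s' - s < PI ->
  hit 1 q s -> hit 1 q s' -> Up d r k s' (l ++ [q]).
Proof.
  intros Hr (Hl & H1 & S & H2 & H3 & H4) Hs Hpi H5 H6.
  apply Up_turn with s; try easy; [|now rewrite last_snoc].
  split; [apply snoc_not_nil|]. rewrite last_snoc. split; [easy|].
  exists (S + edist (last l origin) q). rewrite plen_snoc.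
  split; [now apply Phi_move|]. split; [lra|].
  destruct H4; [left; lra|right; apply Clean_snoc; try easy; unfold hit in *; lra].
Qed.

(** * Folding the beginning of a path *)

(** Reflection in the line of direction [e (c / 2)]. With [c = k + s] it exchanges the
    directions [k] and [s]. *)
Definition refl (c : R) (q : C) : C :=
  (cos c * fst q + sin c * snd q, sin c * fst q - cos c * snd q).

Lemma dot_refl c q a : dot (refl c q) (e a) = dot q (e (c - a)).
Proof. unfold dot, refl, e; simpl. rewrite cos_minus, sin_minus. ring. Qed.

Lemma Phi_flip k s q S :
  Phi (-s) (-k) (Cconj q) S -> Phi k s (refl (k + s) q) S.
Proof.
  intros H m Hm.
  assert (H' := H (m - k - s)). clear H. rewrite dot_conj in H'. rewrite dot_refl.
  replace (k + s - (m + PI/2)) with (-(m - k - s + PI/2)) by ring.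
  assert (G : - s + PI/3 <= m - k - s <= Rmax (-k) (-s + PI/3)).
  { split; [lra|]. destruct Hm as [_ Hm]. revert Hm. unfold Rmax; repeat destruct Rle_dec; lra. }
  specialize (H' G). lra.
Qed.

(** How much a step from [q] to [q'] is shortened when [q] is reflected in the bisector
    of the directions [k] and [s]: the right-hand side is nonnegative as soon as [q]
    lies on the side of [k] and [q'] on the side of [s]. *)
Lemma fold_identity k s q q' :
  (1 - cos (s - k)) * (edist q q' * edist q q' - edist (refl (k + s) q) q' * edist (refl (k + s) q) q')
  = 2 * (dot q (e k) - dot q (e s)) * (dot q' (e s) - dot q' (e k)).
Proof.
  rewrite !edist_sqr. set (h := (s - k)/2). set (m := (s + k)/2).
  assert (Es : s = m + h) by (unfold m, h; field).
  assert (Ek : k = m - h) by (unfold m, h; field).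
  replace (s - k) with (2 * h) by (unfold h; field).
  replace (k + s) with (2 * m) by (unfold m; field).
  clearbody h m. rewrite Es, Ek. clear Es Ek. unfold refl, dot, e. simpl fst; simpl snd.
  rewrite cos_plus, sin_plus, cos_minus, sin_minus.
  rewrite (cos_2a_sin h), (sin_2a m), (cos_2a m).
  generalize (sin2_cos2 m). unfold Rsqr. intros E.
  revert E. generalize (sin m) (cos m) (sin h) (cos h). intros sm cm sh ch E.
  destruct q as [a b], q' as [c d]; simpl.
  assert (E' : sm * sm = 1 - cm * cm) by lra.
  ring_simplify.
  replace (sm ^ 4) with ((sm*sm) * (sm*sm)) by ring.
  replace (sm ^ 3) with ((sm*sm) * sm) by ring.
  replace (sm ^ 2) with (sm*sm) by ring. rewrite !E'. ring.
Qed.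

(** The prefix ends at a point [p] hitting the lower end [k], the next point [q] hits
    the upper end [s], and less than a half turn is covered. If [p] or [q] lies on the
    wrong side of the bisector of [k] and [s], it hits both ends and covers the interval
    by itself. Otherwise reflecting the prefix in the bisector keeps its length and the
    calibration, brings its end to [s], and does not lengthen the step to [q]. If the
    saving is below [d], then by [fold_identity] one of the two factors is at most [1 -
    r], so that [p] or [q] alone hits all directions from [k] to [s] within tolerance,
    and a clean chain can start there. *)
Lemma Up_flip d r k s s' l q :
  0 < d -> 20 * d <= (1 - r) * (1 - r) -> 0 <= r <= 1 ->
  Up d r (- s) (- k) (map Cconj l) -> k <= s -> s - k < PI -> s <= s' -> s' - s < PI ->
  hit 1 q s -> hit 1 q s' -> plen origin (l ++ [q]) <= 10 -> Up d r k s' (l ++ [q]).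
Proof.
  intros Hd1 Hd2 Hr (Hl & H1 & S & H2 & H3 & H4) Hks Hpi Hs Hpi' Hq Hq' Hlen.
  rewrite last_conj in *. rewrite plen_conj in *.
  rewrite hit_conj, Ropp_involutive in H1.
  assert (Hl' : l <> []) by (intros ->; now apply Hl).
  set (p := last l origin) in *.
  apply Up_turn with s; try easy; [|now rewrite last_snoc].
  destruct (Rlt_dec (dot p (e k)) (dot p (e s))) as [D1|D1].
  { apply Up_step with s; try easy; try lra.
    apply Up_single; try easy; try lra. fold p. unfold hit in *; lra. }
  destruct (Rlt_dec (dot q (e s)) (dot q (e k))) as [D2|D2].
  { apply Up_single; rewrite ?last_snoc; try easy; try lra.
    apply snoc_not_nil. unfold hit in *; lra. }
  assert (HP := Phi_flip _ _ _ _ H2).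
  assert (HI := fold_identity k s p q). fold p in HP.
  set (D := edist p q) in *. set (D' := edist (refl (k + s) p) q) in *.
  assert (HD := edist_pos p q). fold D in HD.
  assert (HD' := edist_pos (refl (k+s) p) q). fold D' in HD'.
  assert (HX : 0 <= (dot p (e k) - dot p (e s)) * (dot q (e s) - dot q (e k))).
  { apply Rmult_le_pos; lra. }
  assert (Hlen' := Hlen). rewrite plen_snoc in Hlen'. fold p D in Hlen'.
  assert (Hpp := plen_pos origin l).
  destruct (Req_dec k s) as [Eks|Eks].
  { (* the interval is a single direction, hit by p *)
    apply Up_step with s; try easy; try lra.
    apply Up_single; try easy; try lra. fold p. now rewrite <- Eks. }
  assert (Hc : cos (s - k) < 1).
  { rewrite <- cos_0. apply cos_decreasing_1; lra. }
  generalize (COS_bound (s - k)). intros [Hc' _].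
  assert (HDD : D' <= D).
  { apply Rsqr_incr_0_var; [|easy]. unfold Rsqr.
    apply Rmult_le_reg_l with (1 - cos (s - k)); nra. }
  split; [apply snoc_not_nil|]. rewrite last_snoc. split; [easy|].
  exists (S + D'). split; [|split].
  - now apply Phi_move.
  - rewrite plen_snoc. fold p D. lra.
  - destruct H4 as [H4|H4].
    { left. rewrite plen_snoc. fold p D. lra. }
    destruct (Rle_dec (dot p (e k) - dot p (e s)) (1 - r)) as [G1|G1].
    { right. apply Clean_snoc; try easy; [|unfold hit in *; lra].
      exists [p]. split; [easy|]. split; [|split; [|split]].
      - econstructor; [| | | |constructor]; try easy; unfold hit in *; lra.
      - intros x [<-|[]]. now apply last_incl.
      - easy.
      - simpl. rewrite Rplus_0_r. apply edist_last_plen. }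
    destruct (Rle_dec (dot q (e s) - dot q (e k)) (1 - r)) as [G2|G2].
    { right. exists [q]. split; [easy|]. split; [|split; [|split]].
      - econstructor; [| | | |constructor]; try easy; unfold hit in *; lra.
      - intros x [<-|[]]. apply in_or_app. right. now left.
      - now rewrite last_snoc.
      - simpl. rewrite Rplus_0_r. rewrite <- (last_snoc l q origin) at 1. apply edist_last_plen. }
    left. rewrite plen_snoc. fold p D.
    assert (G : (1 - r) * (1 - r) <= (dot p (e k) - dot p (e s)) * (dot q (e s) - dot q (e k))).
    { apply Rmult_le_compat; lra. }
    assert ((1 - r) * (1 - r) <= D * D - D' * D').
    { assert (0 <= D * D - D' * D') by nra. nra. }
    (* All lengths are at most [10], whence the factor [20] in the relation between [d]
       and [r]. *)
    assert (D * D - D' * D' = (D - D') * (D + D')) by ring.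
    assert (20 * (D - D') >= (D - D') * (D + D')) by nra. lra.
Qed.

(** * Jumps over the gap *)

Lemma PI_lt_315 : PI < 3.15.
Proof.
  destruct (PI_2_3_7_ineq 1) as [_ H].
  unfold PI_2_3_7_tg, Ratan_seq, tg_alt in H. simpl in H. lra.
Qed.

(** The surplus of a jump over a gap that leaves at least [PI/4] to be covered before [3
    PI/2]; see [Up_jump]. *)
Lemma late_jump_gain (y : R) : PI/4 <= y <= PI/2 ->
  1/10 <= 2 * sin y - 2 * cos (2 * y) + PI/2 - 3 * y.
Proof.
  intros Hy. set (z := PI/2 - y).
  replace y with (PI/2 - z) by (unfold z; ring).
  replace (2 * (PI/2 - z)) with (PI - 2 * z) by field.
  rewrite sin_shift, cos_minus, cos_PI, sin_PI.
  generalize (cos_lower z) (cos_lower (2 * z)) PI_lt_315. intros H1 H2 H3.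
  assert (0 <= z <= PI/4) by (unfold z; lra).
  (* Here [0.7875 = 3.15 / 4] bounds [z <= PI/4]; the quadratic bounds of the cosines
     reduce the claim to this product. *)
  assert (0 <= (0.7875 - z) * (z + 0.18)) by (apply Rmult_le_pos; lra).
  nra.
Qed.

(** The prefix ends at the upper end [s] after at least a half turn, and the next point
    [q] is at the lower end [k]. Put [y = k + 3 PI/2 - s]. If [y <= 0], the calibration
    at [k + 3 PI/2] already gives [L0] at [q]. If [0 < y <= PI/4], the calibration at
    [s] is used: at [q] its functional is [tan y <q, e s> + <q, e k> / cos y], which
    leaves a debt of [tan y], to be paid when [s] is hit again, and a surplus of [1 /
    cos y - 1]; for [y < y0] this surplus may be small, but then a clean prefix gives a
    sweep. If [y > PI/4], the functional at [k + 2 PI - 3 y] is reflected in the tangent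
    at [s], where the prefix ends; the debt is then [1] and [late_jump_gain] gives the
    surplus. *)
Lemma Up_jump d r y0 k s l q : tuned d r y0 -> Up d r k s l -> k + PI <= s -> hit 1 q k ->
  Fin d r y0 (l ++ [q]) \/ Post d r y0 s (l ++ [q]).
Proof.
  intros (Hd1 & Hd2 & Hd3 & Hr & Hy0 & Hd4) (Hl & H1 & S & H2 & H3 & H4) Hks Hq.
  set (p := last l origin) in *.
  assert (Hpi := PI_RGT_0).
  assert (CEq : k + 3 * PI / 2 - y0 <= s -> Clean r k s l -> SweepEither r y0 (l ++ [q])).
  { intros Hs (c & C1 & C2 & C3 & C4 & C5). left. exists k, c, q, s.
    repeat split; try easy.
    - unfold hit in *; lra.
    - apply incl_app; [now apply incl_appl|now apply incl_appr].
    - rewrite !plen_snoc, C4. lra. }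
  assert (HD := edist_pos p q).
  assert (HS : S + edist p q <= plen origin (l ++ [q])) by (rewrite plen_snoc; fold p; lra).
  assert (HE : S + edist p q + d <= plen origin (l ++ [q]) \/ Clean r k s l).
  { destruct H4; [left; rewrite plen_snoc; fold p; lra|now right]. }
  destruct (Rle_dec (k + 3 * PI/2) s) as [Hs|Hs].
  - left.
    assert (H2' := H2 (k + 3 * PI/2)). rewrite Rmax_left in H2' by lra.
    specialize (H2' ltac:(lra)).
    assert (B := dot_le_edist (e (k + 3 * PI/2 + PI/2)) p q (dot_e_unit _)).
    replace (k + 3 * PI/2 + PI/2) with (k + 2 * PI) in * by field. rewrite e_2PI in *.
    unfold hit in Hq. unfold Fin, L0.
    split; [lra|]. destruct HE as [HE|HE]; [left; lra|right]. apply CEq; try easy; lra.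
  - right. set (y := k + 3 * PI/2 - s) in *.
    assert (Es : s = k + (3 * (PI/2) - y)) by (unfold y; field).
    assert (F1 : forall v, dot v (e s) = - sin y * dot v (e k) - cos y * dot v (e (k + PI/2))).
    { intros v. rewrite Es, dot_add. rewrite cos_minus, sin_minus.
      rewrite cos_3PI2, sin_3PI2. ring. }
    assert (Hy : 0 < y <= PI/2) by (unfold y; lra).
    unfold Post. rewrite last_snoc.
    destruct (Rle_dec y (PI/4)) as [Hy4|Hy4].
    + assert (Hc : 0 < cos y) by (apply cos_gt_0; lra).
      assert (Hsn : 0 <= sin y) by (apply sin_ge_0; lra).
      assert (Htan := cos_x_le_sin y ltac:(lra)).
      assert (Hsc : sin y <= cos y).
      { rewrite <- cos_shift. apply cos_decr_1; lra. }
      assert (H2' := H2 s). rewrite Rmax_left in H2' by lra.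
      specialize (H2' ltac:(lra)).
      assert (B := dot_le_edist (e (s + PI/2)) p q (dot_e_unit _)).
      assert (F2 : dot q (e (s + PI/2)) = cos y * dot q (e k) - sin y * dot q (e (k + PI/2))).
      { replace (s + PI/2) with (k + (- y) + 2 * PI) by (rewrite Es; field).
        rewrite e_2PI, dot_add, cos_neg, sin_neg. ring. }
      set (kk := sin y / cos y). set (ic := / cos y).
      assert (Hic : cos y * ic = 1) by (unfold ic; field; lra).
      assert (Hic1 : 1 <= ic).
      { unfold ic. rewrite <- Rinv_1. apply Rinv_le_contravar; [lra|apply COS_bound]. }
      assert (Hkk : kk = sin y * ic) by (unfold kk, ic; field; lra).
      assert (F3 : dot q (e (s + PI/2)) = kk * dot q (e s) + ic * dot q (e k)).
      { rewrite F2, F1, Hkk.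
        generalize (sin2_cos2 y). unfold Rsqr. intros.
        replace (sin y * ic * (- sin y * dot q (e k) - cos y * dot q (e (k + PI / 2))) + ic * dot q (e k))
          with (ic * dot q (e k) * (1 - sin y * sin y) - (cos y * ic) * sin y * dot q (e (k + PI/2))) by ring.
        replace (1 - sin y * sin y) with (cos y * cos y) by lra.
        replace (ic * dot q (e k) * (cos y * cos y)) with ((cos y * ic) * cos y * dot q (e k)) by ring.
        rewrite Hic. ring. }
      unfold hit in Hq.
      assert (ic <= ic * dot q (e k)) by nra.
      assert (Hykk : y <= kk).
      { rewrite Hkk. apply Rle_trans with (y * cos y * ic).
        - rewrite Rmult_assoc, Hic. lra.
        - apply Rmult_le_compat_r; lra. }
      assert (0 <= kk <= 1).
      { split; [lra|]. rewrite Hkk, <- Hic. apply Rmult_le_compat_r; lra. }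
      assert (M : L0 - kk + kk * dot q (e s) + (ic - 1) <= S + edist p q).
      { rewrite F3 in B. unfold L0. unfold y in *. nra. }
      destruct (Rle_dec y0 y) as [Hyy|Hyy].
      (* The surplus [1 / cos y - 1] is at least [d]. *)
      * exists (S + edist p q - d), kk. repeat split; try easy; try lra.
        assert (d + 1 <= ic); [|lra].
        apply Rle_trans with (1 / cos y0); [easy|]. unfold ic.
        replace (1 / cos y0) with (/ cos y0) by (unfold Rdiv; ring).
        apply Rinv_le_contravar; [easy|]. apply cos_decr_1; lra.
      * exists (S + edist p q), kk. repeat split; try easy; try lra.
        destruct HE; [now left|right]. apply CEq; try easy. unfold y in Hyy. lra.
    + assert (G := late_jump_gain y ltac:(lra)).
      (* The functional at this direction is the mirror image of [<., e (k + y -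
         PI/2)>] in the tangent at [s]. *)
      assert (H2' := H2 (k + 2 * PI - 3 * y)). rewrite Rmax_left in H2' by lra.
      assert (k + PI/3 <= k + 2 * PI - 3 * y <= s) by (unfold y in *; lra).
      specialize (H2' ltac:(easy)).
      assert (F2 : forall v, dot v (e (k + 2 * PI - 3 * y + PI/2)) =
         dot v (e (k + (y - PI/2))) - 2 * cos (2 * y) * dot v (e s)).
      { intros v. replace (k + 2 * PI - 3 * y + PI/2) with (k + (PI/2 - 3 * y) + 2 * PI) by field.
        rewrite e_2PI, F1, (dot_add v k (PI/2 - 3 * y)), (dot_add v k (y - PI/2)).
        replace (PI/2 - 3 * y) with (PI/2 - (2 * y + y)) by ring.
        rewrite sin_shift, cos_shift. rewrite cos_minus, sin_minus, cos_PI2, sin_PI2.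
        rewrite cos_plus, sin_plus. rewrite cos_2a_cos, sin_2a.
        generalize (sin2_cos2 y). unfold Rsqr. intros E.
        assert (E' : sin y * sin y = 1 - cos y * cos y) by lra.
        ring_simplify.
        replace (sin y ^ 2) with (sin y * sin y) by ring. rewrite E'. ring. }
      assert (B := dot_le_edist (e (k + (y - PI/2))) p q (dot_e_unit _)).
      rewrite F2 in H2'.
      assert (F4 : dot q (e (k + (y - PI/2))) = dot q (e s) + 2 * sin y * dot q (e k)).
      { rewrite F1, dot_add, cos_minus, sin_minus, cos_PI2, sin_PI2. ring. }
      assert (Hc2 : cos (2 * y) <= 0) by (apply cos_le_0; lra).
      assert (Hsn : 0 <= sin y) by (apply sin_ge_0; lra).
      unfold hit in *.
      exists (S + edist p q - d), 1. repeat split; try lra.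
      assert (- 2 * cos (2 * y) <= - 2 * cos (2 * y) * dot p (e s)) by nra.
      assert (2 * sin y <= 2 * sin y * dot q (e k)) by nra.
      unfold L0. rewrite F4 in B. lra.
Qed.

(** All directions are covered, so the last point also hits [k] and closes the
    calibration. *)
Lemma Up_complete d r y0 k s l : tuned d r y0 -> Up d r k s l -> k + 2 * PI <= s ->
  hit 1 (last l origin) k -> Fin d r y0 l.
Proof.
  intros (Hd1 & Hd2 & Hd3 & Hr & Hy0 & Hd4) (Hl & H1 & S & H2 & H3 & H4) Hks Hq.
  assert (Hpi := PI_RGT_0).
  assert (H2' := H2 (k + 3 * PI/2)). rewrite Rmax_left in H2' by lra.
  specialize (H2' ltac:(lra)).
  replace (k + 3 * PI/2 + PI/2) with (k + 2 * PI) in * by field. rewrite e_2PI in *.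
  unfold hit in Hq. unfold Fin, L0. split; [lra|].
  destruct H4 as [H4|(c & C1 & C2 & C3 & C4 & C5)]; [left; lra|right]. left.
  exists k, c, (last l origin), s. repeat split; try easy.
  - lra.
  - unfold hit; lra.
  - apply incl_app; [easy|]. intros x [<-|[]]. now apply last_incl.
  - rewrite plen_snoc, C4, edist_refl. lra.
Qed.

Lemma map_snoc_conj (l : list C) q : map Cconj (l ++ [q]) = map Cconj l ++ [Cconj q].
Proof. now rewrite map_app. Qed.

(** * Extending the interval at either end *)

(** The possible histories of a prefix that covers the directions from [k] to [s]: it
    ends at the upper or at the lower end, or it has jumped over the gap after a half
    turn. *)
Definition State (d r y0 k s : R) (l : list C) : Prop :=
  Up d r k s l \/ Up d r (-s) (-k) (map Cconj l) \/
  Post d r y0 s l \/ Post d r y0 (-k) (map Cconj l).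

Lemma State_conj d r y0 k s l : State d r y0 k s l -> State d r y0 (-s) (-k) (map Cconj l).
Proof.
  unfold State. rewrite !Ropp_involutive, map_conj_conj. tauto.
Qed.

(** Extending the interval beyond [s]. From the upper end the calibration goes on; from
    the lower end the prefix is folded if less than a half turn is covered, and
    otherwise the step is a jump; after a jump, hitting the awaited end already makes
    the length at least [L0]. *)
Lemma State_step_up d r y0 k s s' l q : tuned d r y0 ->
  State d r y0 k s l -> k <= s < k + 2 * PI -> s <= s' -> s' - s < PI ->
  hit 1 q s -> hit 1 q s' -> plen origin (l ++ [q]) <= 10 ->
  Fin d r y0 (l ++ [q]) \/ (State d r y0 k s' (l ++ [q]) /\ s' < k + 2 * PI).
Proof.
  intros Ht HS Hks Hs Hpi Hq Hq' Hlen.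
  assert (Ht' := Ht). destruct Ht' as (Hd1 & Hd2 & Hd3 & Hr & Hy0 & Hd4).
  assert (Hwrap : k + 2 * PI <= s' -> hit 1 q k).
  { intros Hw. apply hit_2PI. apply hit_between with s s'; try easy; lra. }
  assert (HUp : Up d r k s' (l ++ [q]) ->
    Fin d r y0 (l ++ [q]) \/ (State d r y0 k s' (l ++ [q]) /\ s' < k + 2 * PI)).
  { intros HU. destruct (Rlt_dec s' (k + 2 * PI)) as [Hw|Hw].
    - right. split; [now left|easy].
    - left. apply Up_complete with k s'; try easy; try lra.
      rewrite last_snoc. apply Hwrap; lra. }
  destruct HS as [HS|[HS|[HS|HS]]].
  - apply HUp. now apply Up_step with s.
  - destruct (Rlt_dec (s - k) PI) as [Hlt|Hge].
    + apply HUp. apply Up_flip with s; try easy; lra.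
    + (* the step from the lower to the upper end is a jump *)
      assert (HJ := Up_jump d r y0 (-s) (-k) (map Cconj l) (Cconj q) Ht HS ltac:(lra)).
      rewrite hit_conj, Ropp_involutive in HJ. specialize (HJ Hq).
      rewrite <- map_snoc_conj in HJ. destruct HJ as [HJ|HJ].
      * left. now apply Fin_conj.
      * destruct (Rlt_dec s' (k + 2 * PI)) as [Hw|Hw].
        -- right. split; [|easy]. right. right. now right.
        -- left. apply Fin_conj. apply Post_Fin with (-k); [easy|].
           rewrite last_conj, last_snoc, hit_conj, Ropp_involutive. apply Hwrap; lra.
  - left. apply Post_Fin with s; [now apply Post_snoc|]. now rewrite last_snoc.
  - assert (HJ := Post_snoc _ _ _ _ _ (Cconj q) HS).
    rewrite <- map_snoc_conj in HJ.
    destruct (Rlt_dec s' (k + 2 * PI)) as [Hw|Hw].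
    -- right. split; [|easy]. right. right. now right.
    -- left. apply Fin_conj. apply Post_Fin with (-k); [easy|].
       rewrite last_conj, last_snoc, hit_conj, Ropp_involutive. apply Hwrap; lra.
Qed.

Lemma State_step_down d r y0 k k' s l q : tuned d r y0 ->
  State d r y0 k s l -> k <= s < k + 2 * PI -> k' <= k -> k - k' < PI ->
  hit 1 q k -> hit 1 q k' -> plen origin (l ++ [q]) <= 10 ->
  Fin d r y0 (l ++ [q]) \/ (State d r y0 k' s (l ++ [q]) /\ s < k' + 2 * PI).
Proof.
  intros Ht HS Hks Hk Hpi Hq Hq' Hlen.
  assert (H := State_step_up d r y0 (-s) (-k) (-k') (map Cconj l) (Cconj q) Ht
    (State_conj _ _ _ _ _ _ HS) ltac:(lra) ltac:(lra) ltac:(lra)).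
  rewrite !hit_conj, !Ropp_involutive in H.
  rewrite <- map_snoc_conj, plen_conj in H.
  specialize (H Hq Hq' Hlen). destruct H as [H|[H Hlt]].
  - left. now apply Fin_conj.
  - right. split; [|lra]. apply State_conj in H.
    now rewrite !Ropp_involutive, map_conj_conj in H.
Qed.

(** * Convex quadrilaterals *)

Definition cross (p q : C) : R := fst p * snd q - snd p * fst q.
Definition area (x y z : C) : R := cross (y - x)%C (z - y)%C.

Lemma dot_minus (p q u : C) : dot (p - q)%C u = dot p u - dot q u.
Proof. destruct p, q; unfold dot; simpl; ring. Qed.

Lemma cross_dots (u w : C) (a b : R) :
  cross u w * sin (b - a) = dot u (e a) * dot w (e b) - dot u (e b) * dot w (e a).
Proof. unfold cross, dot, e; simpl. rewrite sin_minus. ring. Qed.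

Lemma area_pos_aux (x y z : C) (a b c : R) :
  a < b < c -> b - a < PI -> c - b < PI ->
  dot y (e a) < dot x (e a) -> dot z (e a) < dot x (e a) ->
  dot x (e b) < dot y (e b) -> dot z (e b) < dot y (e b) ->
  dot x (e c) < dot z (e c) -> dot y (e c) < dot z (e c) -> 0 < area x y z.
Proof.
  intros Habc H1 H2 A1 A2 B1 B2 C1 C2.
  assert (S1 : 0 < sin (b - a)) by (apply sin_gt_0; lra).
  assert (S2 : 0 < sin (c - b)) by (apply sin_gt_0; lra).
  assert (E1 : area x y z = cross (y - x)%C (z - x)%C).
  { unfold area, cross; destruct x, y, z; simpl; ring. }
  assert (E2 : area x y z = cross (z - x)%C (z - y)%C).
  { unfold area, cross; destruct x, y, z; simpl; ring. }
  destruct (Rle_dec (dot z (e b)) (dot x (e b))) as [H|H].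
  - rewrite E1. apply Rmult_lt_reg_r with (sin (b - a)); [easy|].
    rewrite cross_dots, Rmult_0_l, !dot_minus. nra.
  - rewrite E2. apply Rmult_lt_reg_r with (sin (c - b)); [easy|].
    rewrite cross_dots, Rmult_0_l, !dot_minus. nra.
Qed.

Lemma area_cyc (x y z : C) : area y z x = area x y z.
Proof. unfold area, cross; destruct x, y, z; simpl; ring. Qed.

(** Three points, each extremal in its own direction among the three, are ordered around
    their triangle as these directions are on the circle. *)
Lemma area_pos (x y z : C) (a b c : R) :
  a < b < c -> c < a + 2 * PI ->
  dot y (e a) < dot x (e a) -> dot z (e a) < dot x (e a) ->
  dot x (e b) < dot y (e b) -> dot z (e b) < dot y (e b) ->
  dot x (e c) < dot z (e c) -> dot y (e c) < dot z (e c) -> 0 < area x y z.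
Proof.
  intros Habc Hc A1 A2 B1 B2 C1 C2.
  destruct (Rlt_dec (b - a) PI) as [H1|H1]; [destruct (Rlt_dec (c - b) PI) as [H2|H2]|].
  - now apply area_pos_aux with a b c.
  - rewrite <- area_cyc, <- area_cyc.
    apply area_pos_aux with c (a + 2 * PI) (b + 2 * PI); rewrite ?e_2PI; lra.
  - rewrite <- area_cyc.
    apply area_pos_aux with b c (a + 2 * PI); rewrite ?e_2PI; lra.
Qed.

Lemma strict_tri (x p y : C) : cross (p - x)%C (y - x)%C <> 0 -> edist x y < edist x p + edist p y.
Proof.
  intros H.
  assert (H1 := edist_sqr x y). assert (H2 := edist_sqr x p). assert (H3 := edist_sqr p y).
  generalize (edist_pos x y) (edist_pos x p) (edist_pos p y). intros P1 P2 P3.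
  apply Rsqr_incrst_0; try lra. unfold Rsqr.
  set (k := (fst p - fst x) * (fst y - fst p) + (snd p - snd x) * (snd y - snd p)).
  assert (Hk : k < edist x p * edist p y).
  { destruct (Rlt_dec k 0). nra.
    apply Rsqr_incrst_0; try nra. unfold Rsqr.
    replace (edist x p * edist p y * (edist x p * edist p y)) with
      ((edist x p * edist x p) * (edist p y * edist p y)) by ring.
    rewrite H2, H3.
    assert (Hc : 0 < Rsqr (cross (p - x)%C (y - x)%C)) by (apply Rlt_0_sqr; easy).
    unfold Rsqr, cross in Hc. destruct x, p, y; unfold k; simpl in *. nra. }
  unfold k in Hk. nra.
Qed.

Lemma edist_affine (x z : C) (s : R) : 0 <= s -> edist x (x + RtoC s * (z - x))%C = s * edist x z.
Proof.
  intros Hs. unfold edist. replace (x + s * (z - x) - x)%C with (RtoC s * (z - x))%C by ring.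
  rewrite Cmod_mult, Cmod_R, Rabs_pos_eq by easy. easy.
Qed.

(** The diagonals meet, because the ratios of the four triangle areas give a common
    point; the triangle inequality at that point compares the lengths, strictly for one
    of the two sides. *)
Lemma quad_diag (x y z w : C) :
  0 < area x y z -> 0 < area y z w -> 0 < area z w x -> 0 < area w x y ->
  edist x y + edist z w < edist x z + edist y w.
Proof.
  intros A1 A2 A3 A4.
  set (A := area w x y) in *. set (B := area y z w) in *.
  set (C' := area z w x) in *. set (D := area x y z) in *.
  assert (E : A + B = C' + D).
  { unfold A, B, C', D, area, cross; destruct x, y, z, w; simpl; ring. }
  (* Position of the intersection point on the two diagonals. *)
  set (s := A / (A + B)). set (t := D / (A + B)).
  assert (Hs : 0 < s). { unfold s. apply Rdiv_lt_0_compat; lra. }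
  assert (Ht : 0 < t). { unfold t. apply Rdiv_lt_0_compat; lra. }
  assert (Hs1 : 1 - s = B / (A + B)) by (unfold s; field; lra).
  assert (Ht1 : 1 - t = C' / (A + B)) by (replace C' with (A + B - D) by lra; unfold t; field; lra).
  assert (0 < 1 - s) by (rewrite Hs1; apply Rdiv_lt_0_compat; lra).
  assert (0 < 1 - t) by (rewrite Ht1; apply Rdiv_lt_0_compat; lra).
  set (P := (x + RtoC s * (z - x))%C).
  assert (EP : P = (y + RtoC t * (w - y))%C).
  { assert (N : A + B <> 0) by lra.
    assert (F : forall u v : R, (A + B) * u = (A + B) * v -> u = v).
    { intros u v Huv. now apply Rmult_eq_reg_l with (A + B). }
    assert (Fs : (A + B) * s = A) by (unfold s; field; easy).
    assert (Ft : (A + B) * t = D) by (unfold t; field; easy).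
    clear Hs1 Ht1. clearbody s t.
    unfold P; destruct x as [x1 x2], y as [y1 y2], z as [z1 z2], w as [w1 w2].
    unfold Cplus, Cmult, Cminus, Copp, RtoC; simpl. f_equal; apply F.
    - replace ((A + B) * (x1 + (s * (z1 + - x1) - 0 * (z2 + - x2)))) with
        ((A + B) * x1 + ((A + B) * s) * (z1 - x1)) by ring.
      replace ((A + B) * (y1 + (t * (w1 + - y1) - 0 * (w2 + - y2)))) with
        ((A + B) * y1 + ((A + B) * t) * (w1 - y1)) by ring.
      rewrite Fs, Ft. unfold A, B, D, area, cross; simpl. ring.
    - replace ((A + B) * (x2 + (s * (z2 + - x2) + 0 * (z1 + - x1)))) with
        ((A + B) * x2 + ((A + B) * s) * (z2 - x2)) by ring.
      replace ((A + B) * (y2 + (t * (w2 + - y2) + 0 * (w1 + - y1)))) with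
        ((A + B) * y2 + ((A + B) * t) * (w2 - y2)) by ring.
      rewrite Fs, Ft. unfold A, B, D, area, cross; simpl. ring. }
  assert (L1 : edist x P = s * edist x z) by (apply edist_affine; lra).
  assert (L2 : edist z P = (1 - s) * edist x z).
  { replace P with (z + RtoC (1 - s) * (x - z))%C.
    - rewrite edist_affine by lra. now rewrite (edist_sym z x).
    - unfold P. rewrite RtoC_minus. ring. }
  assert (L3 : edist y P = t * edist y w) by (rewrite EP; apply edist_affine; lra).
  assert (L4 : edist w P = (1 - t) * edist y w).
  { replace P with (w + RtoC (1 - t) * (y - w))%C.
    - rewrite edist_affine by lra. now rewrite (edist_sym w y).
    - rewrite EP, RtoC_minus. ring. }
  assert (T1 : edist x y < edist x P + edist P y).
  { apply strict_tri. replace (cross (P - x)%C (y - x)%C) with (- s * D). nra.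
    unfold P, D, area, cross. destruct x, y, z; simpl; ring. }
  assert (T2 := edist_tri z P w).
  rewrite (edist_sym P y) in T1. rewrite (edist_sym P w) in T2. lra.
Qed.

Definition owns (x y : C) (a : R) : Prop := hit 1 x a /\ ~ hit 1 y a.

Lemma owns_lt x y a : owns x y a -> dot y (e a) < dot x (e a).
Proof. unfold owns, hit. intros [? ?]. lra. Qed.

(** Points with private directions in cyclic order are the vertices of a convex
    quadrilateral in that order, so that both pairs of opposite sides are shorter than
    the diagonals. *)
Lemma quad_owns (x y z w : C) (a b c d : R) :
  a < b -> b < c -> c < d -> d < a + 2 * PI ->
  owns x y a -> owns x z a -> owns x w a ->
  owns y x b -> owns y z b -> owns y w b ->
  owns z x c -> owns z y c -> owns z w c ->
  owns w x d -> owns w y d -> owns w z d ->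
  edist x y + edist z w < edist x z + edist y w /\
  edist x w + edist y z < edist x z + edist y w.
Proof.
  intros H1 H2 H3 H4; intros.
  repeat match goal with H : owns _ _ _ |- _ => apply owns_lt in H end.
  assert (0 < area x y z) by (apply area_pos with a b c; lra).
  assert (0 < area y z w) by (apply area_pos with b c d; lra).
  assert (0 < area x y w) by (apply area_pos with a b d; lra).
  assert (0 < area x z w) by (apply area_pos with a c d; lra).
  assert (0 < area z w x) by now rewrite area_cyc.
  assert (0 < area w x y) by now rewrite area_cyc, area_cyc.
  split.
  - now apply quad_diag.
  - assert (Q := quad_diag y z w x). rewrite (edist_sym w x), (edist_sym z x) in Q.
    specialize (Q ltac:(easy) ltac:(easy) ltac:(easy) ltac:(easy)). lra.
Qed.

(** * Shortest lists of points hitting all directions *)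

(** The convex hull of the list contains the unit disc. *)
Definition hits_all (l : list C) : Prop := forall a, exists p, In p l /\ hit 1 p a.

Lemma fun_choice {A B : Type} (Q : A -> B -> Prop) :
  (forall x, exists y, Q x y) -> exists f, forall x, Q x (f x).
Proof.
  intros H. exists (fun x => proj1_sig (constructive_indefinite_description _ (H x))).
  intros x. now destruct constructive_indefinite_description.
Qed.

(** Points may be repeated: only finiteness of the set of candidates matters for the
    minimum. *)
Fixpoint words (n : nat) (S : list C) : list (list C) :=
  match n with
  | O => [[]]
  | Datatypes.S n' => flat_map (fun w => map (fun x => x :: w) S) (words n' S)
  end.

Lemma words_spec n S w : In w (words n S) <-> length w = n /\ incl w S.
Proof.
  revert w. induction n as [|n IH]; intros w; simpl.
  - split.
    + intros [<-|[]]. split; [easy|intros x []].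
    + intros [H _]. destruct w; [now left|discriminate].
  - rewrite in_flat_map. split.
    + intros (v & Hv & Hw). apply in_map_iff in Hw. destruct Hw as (x & <- & Hx).
      apply IH in Hv. destruct Hv as [<- Hv]. split; [easy|]. now apply incl_cons.
    + intros [Hl Hi]. destruct w as [|x w]; [discriminate|]. exists w. split.
      * apply IH. split; [now injection Hl|]. now apply incl_cons_inv in Hi.
      * apply in_map_iff. exists x. split; [easy|]. apply Hi. now left.
Qed.

Lemma finite_argmin {A} (f : A -> R) (P : A -> Prop) (L : list A) :
  (exists x, In x L /\ P x) -> exists x, In x L /\ P x /\ forall y, In y L -> P y -> f x <= f y.
Proof.
  induction L as [|a L IH]; intros (x & Hx & HP); [easy|].
  destruct (classic (exists x, In x L /\ P x)) as [H|H].
  - destruct (IH H) as (y & H1 & H2 & H3).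
    destruct (classic (P a /\ f a < f y)) as [[Ha Hf]|Ha].
    + exists a. split; [now left|split; [easy|]]. intros z [<-|Hz] Hpz; [lra|].
      specialize (H3 z Hz Hpz). lra.
    + exists y. split; [now right|split; [easy|]]. intros z [<-|Hz] Hpz; [|now apply H3].
      apply Rnot_lt_le. intros Hlt. now apply Ha.
  - assert (x = a) as ->. { destruct Hx as [<-|Hx]; [easy|]. exfalso. apply H. now exists x. }
    exists a. split; [now left|split; [easy|]]. intros z [<-|Hz] Hpz; [lra|].
    exfalso. apply H. now exists z.
Qed.

Lemma nat_least (P : nat -> Prop) : (exists n, P n) -> exists n, P n /\ forall m, (m < n)%nat -> ~ P m.
Proof.
  intros [n Hn]. revert Hn. induction n as [n IH] using (well_founded_induction lt_wf). intros Hn.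
  destruct (classic (exists m, (m < n)%nat /\ P m)) as [(m & H1 & H2)|H].
  - now apply (IH m).
  - exists n. split; [easy|]. intros m Hm HP. apply H. now exists m.
Qed.

(** First the number of points is minimised, among lists not longer than [S], then the
    length for this number of points. The first choice gives private directions, the
    second one uncrossed edges. *)
Lemma minimal_list (S : list C) : hits_all S ->
  exists l, incl l S /\ plen origin l <= plen origin S /\ hits_all l /\
    (forall l', incl l' S -> (length l' < length l)%nat -> hits_all l' ->
       plen origin l' <= plen origin S -> False) /\
    (forall l', incl l' S -> length l' = length l -> hits_all l' -> plen origin l <= plen origin l').
Proof.
  intros HS.
  destruct (nat_least (fun n => exists l, length l = n /\ incl l S /\ hits_all l /\
     plen origin l <= plen origin S)) as (n & (l0 & H1 & H2 & H3 & H4) & Hmin).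
  { exists (length S), S. repeat split; try easy. }
  destruct (finite_argmin (plen origin) hits_all (words n S)) as (l & L1 & L2 & L3).
  { exists l0. split; [|easy]. now apply words_spec. }
  apply words_spec in L1. destruct L1 as [L1 L4].
  exists l. split; [easy|]. split; [|split; [easy|split]].
  - apply Rle_trans with (plen origin l0); [|easy]. apply L3; [|easy]. now apply words_spec.
  - intros l' I1 I2 I3 I4. apply (Hmin (length l')). { now rewrite <- L1. } exists l'. easy.
  - intros l' I1 I2 I3. apply L3; [|easy]. apply words_spec. now rewrite I2.
Qed.

(** * Arcs of directions hit by a point *)

Lemma e_shift_nat a n : e (a + 2 * PI * INR n) = e a.
Proof.
  induction n as [|n IH].
  - simpl. f_equal. ring.
  - rewrite S_INR. replace (a + 2 * PI * (INR n + 1)) with (a + 2 * PI * INR n + 2 * PI) by ring.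
    now rewrite e_2PI.
Qed.

Lemma e_shift_Z a z : e (a + 2 * PI * IZR z) = e a.
Proof.
  destruct (Z_le_dec 0 z) as [H|H].
  - rewrite <- (Z2Nat.id z) by easy. rewrite <- INR_IZR_INZ. apply e_shift_nat.
  - rewrite <- (e_shift_nat (a + 2 * PI * IZR z) (Z.to_nat (- z))).
    rewrite INR_IZR_INZ, Z2Nat.id by lia. rewrite opp_IZR. f_equal. ring.
Qed.

Lemma angle_lift a0 a : exists b, a0 <= b < a0 + 2 * PI /\ e b = e a.
Proof.
  set (z := (up ((a0 - a) / (2 * PI)))%Z).
  assert (Hpi := PI_RGT_0).
  destruct (archimed ((a0 - a) / (2 * PI))) as [H1 H2]. fold z in H1, H2.
  assert (E : a0 - a = 2 * PI * ((a0 - a) / (2 * PI))) by (field; lra).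
  destruct (Req_dec (IZR z - (a0 - a) / (2 * PI)) 1) as [H|H].
  - exists (a + 2 * PI * IZR (z - 1)). rewrite e_shift_Z, minus_IZR. split; [|easy]. nra.
  - exists (a + 2 * PI * IZR z). rewrite e_shift_Z. split; [|easy]. nra.
Qed.

(** The directions hit by a point at distance [rho] from the origin form the arc of half
    width [acos (1 / rho)] around its own direction. *)
Lemma hit_arc (p : C) (t : R) : hit 1 p t ->
  exists k s, k <= t <= s /\ s - k < PI /\ hit 1 p k /\ hit 1 p s /\
    forall a, s < a < k + 2 * PI -> ~ hit 1 p a.
Proof.
  intros H. unfold hit in *.
  set (n := dot p (e t)) in *. set (w := dot p (e (t + PI/2))).
  set (ps := atan (w / n)). set (rho := n * sqrt (1 + (w / n)²)).
  assert (Hsq : 1 <= sqrt (1 + (w / n)²)).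
  { rewrite <- sqrt_1 at 1. apply sqrt_le_1; generalize (Rle_0_sqr (w/n)); lra. }
  assert (Hrho : 1 <= rho) by (unfold rho; nra).
  assert (D : forall a, dot p (e a) = rho * cos (a - (t + ps))).
  { intros a. replace a with (t + (a - t)) at 1 by ring. rewrite dot_add. fold n w.
    replace (a - (t + ps)) with ((a - t) - ps) by ring. generalize (a - t). intros x.
    rewrite cos_minus.
    unfold ps, rho. rewrite cos_atan, sin_atan. field. split; lra. }
  assert (Hinv : 0 < / rho <= 1).
  { split; [apply Rinv_0_lt_compat; lra|]. rewrite <- Rinv_1. apply Rinv_le_contravar; lra. }
  set (al := acos (/ rho)).
  assert (Hcal : cos al = / rho) by (apply cos_acos; lra).
  assert (Hal : 0 <= al <= PI) by apply acos_bound.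
  assert (Hal2 : al < PI / 2).
  { apply Rnot_le_lt. intros Hge. assert (cos al <= 0); [|lra].
    rewrite <- cos_PI2. apply cos_decr_1; lra. }
  assert (Hps : - (PI/2) < ps < PI/2) by (generalize (atan_bound (w / n)); fold ps; lra).
  assert (Hin : forall x, -PI <= x <= PI -> (1 <= rho * cos x <-> - al <= x <= al)).
  { intros x Hx.
    assert (Hc : cos x = cos (Rabs x)).
    { unfold Rabs. destruct Rcase_abs; [now rewrite cos_neg|easy]. }
    assert (Habs : 0 <= Rabs x <= PI).
    { split; [apply Rabs_pos|]. apply Rabs_le; lra. }
    assert (E : 1 <= rho * cos x <-> cos al <= cos (Rabs x)).
    { rewrite Hcal, <- Hc. split; intros Hy.
      - apply Rmult_le_reg_l with rho; [lra|]. rewrite Rinv_r by lra. easy.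
      - rewrite <- (Rinv_r rho) by lra. apply Rmult_le_compat_l; lra. }
    rewrite E. split; intros Hy.
    - assert (Rabs x <= al). { apply cos_decr_0; try easy; lra. }
      revert H0. unfold Rabs. destruct Rcase_abs; lra.
    - apply cos_decr_1; try easy; try lra. apply Rabs_le. lra. }
  exists (t + ps - al), (t + ps + al).
  assert (Ht : - al <= t - (t + ps) <= al).
  { apply Hin; [lra|]. rewrite <- D. exact H. }
  split; [lra|]. split; [lra|]. rewrite !D.
  split; [apply Hin; lra|]. split; [apply Hin; lra|].
  intros a Ha. rewrite D.
  destruct (Rle_dec (a - (t + ps)) PI) as [Hle|Hgt].
  - rewrite Hin; lra.
  - replace (a - (t + ps)) with ((a - (t + ps) - 2 * PI) + 2 * PI) by ring.
    rewrite cos_plus, cos_2PI, sin_2PI, Rmult_0_r, Rmult_1_r, Rminus_0_r.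
    rewrite Hin; lra.
Qed.

(** * Private directions and uncrossed edges *)

Definition nth_pt (l : list C) (k : nat) : C := nth k l origin.

(** The point of index [k] is the only one to hit the direction [a k]. The directions
    are lifted to one turn starting at [a 0]. *)
Definition private (l : list C) (a : nat -> R) : Prop :=
  forall k, (k < length l)%nat -> hit 1 (nth_pt l k) (a k) /\
    (forall j, (j < length l)%nat -> j <> k -> ~ hit 1 (nth_pt l j) (a k)) /\
    a 0%nat <= a k < a 0%nat + 2 * PI.

(** If every direction of a point were hit by other points too, deleting that point
    would give a shorter list that hits all directions. *)
Lemma private_exists (S l : list C) : incl l S -> plen origin l <= plen origin S -> hits_all l ->
    (forall l', incl l' S -> (length l' < length l)%nat -> hits_all l' ->
       plen origin l' <= plen origin S -> False) ->
  exists a, private l a.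
Proof.
  intros Hi Hp Hh Hmin.
  assert (E : forall k, exists t, (k < length l)%nat -> hit 1 (nth_pt l k) t /\
    (forall j, (j < length l)%nat -> j <> k -> ~ hit 1 (nth_pt l j) t)).
  { intros k. destruct (classic (k < length l)%nat) as [Hk|Hk]; [|exists 0; tauto].
    destruct (nth_split l origin Hk) as (A & B & E & EA).
    destruct (classic (exists t, forall p, In p (A ++ B) -> ~ hit 1 p t)) as [[t Ht]|HN].
    - exists t. intros _. assert (Hj : forall j, (j < length l)%nat -> j <> k -> ~ hit 1 (nth_pt l j) t).
      { intros j Hj Hjk. apply Ht. unfold nth_pt.
        destruct (Nat.lt_ge_cases j k) as [Hlt|Hge].
        - rewrite E, app_nth1 by lia. apply in_or_app. left. apply nth_In. lia.
        - rewrite E, app_nth2 by lia. rewrite E in Hj. rewrite length_app in Hj. simpl in Hj.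
          destruct (j - length A)%nat eqn:EJ; [lia|]. simpl. apply in_or_app. right. apply nth_In. lia. }
      split; [|easy]. destruct (Hh t) as (p & Hp1 & Hp2).
      destruct (In_nth l p origin Hp1) as (j & Hj1 & Hj2).
      destruct (Nat.eq_dec j k) as [->|Hne].
      + unfold nth_pt. now rewrite Hj2.
      + exfalso. apply (Hj j Hj1 Hne). unfold nth_pt. now rewrite Hj2.
    - exfalso. apply (Hmin (A ++ B)).
      + intros x Hx. apply Hi. rewrite E. apply in_app_or in Hx. apply in_or_app.
        destruct Hx; [now left|right; now right].
      + rewrite E, !length_app. simpl. lia.
      + intros t. apply NNPP. intros Hx. apply HN. exists t. intros p H1 H2. apply Hx. now exists p.
      + apply Rle_trans with (plen origin l); [|easy]. rewrite E. apply plen_remove. }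
  apply fun_choice in E. destruct E as [a0 Ha0].
  assert (E : forall k, exists t, a0 0%nat <= t < a0 0%nat + 2 * PI /\ e t = e (a0 k) /\ (k = 0%nat -> t = a0 0%nat)).
  { intros [|k].
    - exists (a0 0%nat). generalize PI_RGT_0. repeat split; lra.
    - destruct (angle_lift (a0 0%nat) (a0 (Datatypes.S k))) as (b & H1 & H2).
      exists b. repeat split; try easy; lra. }
  apply fun_choice in E. destruct E as [a Ha].
  exists a. intros k Hk. destruct (Ha k) as (H1 & H2 & _). destruct (Ha 0%nat) as (_ & _ & H3).
  rewrite (H3 eq_refl). unfold hit. rewrite H2. split; [|split]; try easy; now apply Ha0.
Qed.

(** Reversing the part of the list between two edges keeps the points and exchanges only
    these two edges. *)
Lemma two_opt (S l : list C) A x u s v y D :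
  (forall l', incl l' S -> length l' = length l -> hits_all l' -> plen origin l <= plen origin l') ->
  incl l S -> hits_all l -> l = A ++ x :: u :: s ++ v :: y :: D ->
  edist x u + edist v y <= edist x v + edist u y.
Proof.
  intros Hmin Hi Hh E.
  set (l' := A ++ x :: v :: rev s ++ u :: y :: D).
  assert (HI : forall p, In p l' <-> In p l).
  { intros p. rewrite E. unfold l'. rewrite !in_app_iff. simpl. rewrite !in_app_iff. simpl.
    rewrite <- in_rev. tauto. }
  assert (Hle : plen origin l <= plen origin l').
  { apply Hmin.
    - intros p Hp. apply Hi. now apply HI.
    - rewrite E. unfold l'. rewrite !length_app. simpl. rewrite !length_app. simpl.
      rewrite length_rev. lia.
    - intros t. destruct (Hh t) as (p & H1 & H2). exists p. split; [now apply HI|easy]. }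
  rewrite E in Hle. unfold l' in Hle. rewrite !plen_app in Hle. simpl in Hle.
  replace (s ++ v :: y :: D) with ((s ++ [v]) ++ y :: D) in Hle by now rewrite <- app_assoc.
  replace (rev s ++ u :: y :: D) with ((rev s ++ [u]) ++ y :: D) in Hle by now rewrite <- app_assoc.
  rewrite !(plen_app _ (_ ++ [_])), !last_snoc in Hle. simpl in Hle.
  rewrite (plen_rev u v s) in Hle. lra.
Qed.

(** Negative iff [{x, z}] and [{y, w}] separate each other on the circle, the four
    numbers being directions lifted to one turn. *)
Definition alt (x z y w : R) : R := (y - x) * (y - z) * ((w - x) * (w - z)).

Lemma private_owns l a j k : private l a -> (j < length l)%nat -> (k < length l)%nat -> j <> k ->
  owns (nth_pt l k) (nth_pt l j) (a k).
Proof. intros H Hj Hk Hjk. destruct (H k Hk) as (H1 & H2 & _). split; [easy|]. now apply H2. Qed.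

Lemma private_inj l a j k : private l a -> (j < length l)%nat -> (k < length l)%nat -> j <> k ->
  a j <> a k.
Proof.
  intros H Hj Hk Hjk E. destruct (private_owns l a j k H Hj Hk Hjk) as [_ H1].
  apply H1. rewrite <- E. now apply H.
Qed.

(** Otherwise the two edges are the diagonals of a convex quadrilateral by [quad_owns],
    and the exchange in [two_opt] would shorten the list. *)
Lemma uncrossed_edges (S l : list C) a i j :
  (forall l', incl l' S -> length l' = length l -> hits_all l' -> plen origin l <= plen origin l') ->
  incl l S -> hits_all l -> private l a -> (i + 1 < j)%nat -> (j + 1 < length l)%nat ->
  0 < alt (a i) (a (i + 1)%nat) (a j) (a (j + 1)%nat).
Proof.
  intros Hmin Hi Hh Hp Hij Hj.
  assert (T : edist (nth_pt l i) (nth_pt l (i+1)) + edist (nth_pt l j) (nth_pt l (j+1)) <=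
     edist (nth_pt l i) (nth_pt l j) + edist (nth_pt l (i+1)) (nth_pt l (j+1))).
  { destruct (nth_split l origin (n := i)) as (A & B & E & EA); [lia|].
    assert (LB : length l = (i + 1 + length B)%nat) by (rewrite E, length_app; simpl; lia).
    destruct (nth_split B origin (n := (j - i - 1)%nat)) as (B1 & B2 & E2 & EB); [lia|].
    assert (LB2 : length B = (j - i + length B2)%nat) by (rewrite E2, length_app; simpl; lia).
    destruct B1 as [|u s]; [simpl in EB; lia|].
    destruct B2 as [|y D]; [simpl in LB2; lia|].
    set (v := nth (j - i - 1) B origin) in *. set (x := nth i l origin) in *.
    simpl in EB.
    assert (E3 : l = A ++ x :: u :: s ++ v :: y :: D) by (rewrite E, E2; easy).
    assert (F1 : nth_pt l i = x) by easy.
    assert (F2 : nth_pt l (i+1) = u).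
    { unfold nth_pt. rewrite E3, app_nth2 by lia. replace (i + 1 - length A)%nat with 1%nat by lia. easy. }
    assert (F3 : nth_pt l j = v).
    { unfold nth_pt. rewrite E3, app_nth2 by lia.
      replace (j - length A)%nat with (2 + (length s + 0))%nat by lia. simpl.
      rewrite app_nth2_plus. easy. }
    assert (F4 : nth_pt l (j+1) = y).
    { unfold nth_pt. rewrite E3, app_nth2 by lia.
      replace (j + 1 - length A)%nat with (2 + (length s + 1))%nat by lia. simpl.
      rewrite app_nth2_plus. easy. }
    rewrite F1, F2, F3, F4. now apply (two_opt S l A x u s v y D). }
  assert (N : forall m n, (m < length l)%nat -> (n < length l)%nat -> m <> n -> a m - a n <> 0).
  { intros m n Hm Hn Hmn. assert (X := private_inj l a m n Hp Hm Hn Hmn). lra. }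
  assert (W : forall m, (m < length l)%nat -> a 0%nat <= a m < a 0%nat + 2 * PI) by (intros m Hm; now apply Hp).
  assert (O : forall m n, (m < length l)%nat -> (n < length l)%nat -> m <> n -> owns (nth_pt l m) (nth_pt l n) (a m)).
  { intros m n Hm Hn Hmn. now apply private_owns. }
  set (i' := (i + 1)%nat) in *. set (j' := (j + 1)%nat) in *.
  assert (Li : (i < length l)%nat) by lia. assert (Li' : (i' < length l)%nat) by lia.
  assert (Lj : (j < length l)%nat) by lia.
  assert (n1 : i <> i') by lia. assert (n2 : i <> j) by lia. assert (n3 : i <> j') by lia.
  assert (n4 : i' <> j) by lia. assert (n5 : i' <> j') by lia. assert (n6 : j <> j') by lia.
  apply Rnot_le_lt. intros Hneg.
  assert (Hneg' : alt (a i) (a i') (a j) (a j') < 0).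
  { destruct Hneg as [Hneg|Hneg]; [easy|]. unfold alt in Hneg.
    apply Rmult_integral in Hneg. destruct Hneg as [Hneg|Hneg]; apply Rmult_integral in Hneg;
    destruct Hneg as [Hneg|Hneg]; exfalso; revert Hneg; apply N; auto. }
  (* If the directions of [x], [y], [z], [w] are in this cyclic order, [xz] and [yw]
     are diagonals. *)
  assert (Q : forall x z y w, (x < length l)%nat -> (z < length l)%nat -> (y < length l)%nat -> (w < length l)%nat ->
     x <> z -> x <> y -> x <> w -> z <> y -> z <> w -> y <> w ->
     a x < a y -> a y < a z -> a z < a w ->
     edist (nth_pt l x) (nth_pt l y) + edist (nth_pt l z) (nth_pt l w) < edist (nth_pt l x) (nth_pt l z) + edist (nth_pt l y) (nth_pt l w) /\
     edist (nth_pt l x) (nth_pt l w) + edist (nth_pt l y) (nth_pt l z) < edist (nth_pt l x) (nth_pt l z) + edist (nth_pt l y) (nth_pt l w)).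
  { intros x z y w. intros. apply quad_owns with (a x) (a y) (a z) (a w); auto.
    generalize (W x) (W w). intros W1 W2. specialize (W1 ltac:(easy)). specialize (W2 ltac:(easy)). lra. }
  unfold alt in Hneg'.
  generalize (edist_sym (nth_pt l i) (nth_pt l j)) (edist_sym (nth_pt l i) (nth_pt l i')) (edist_sym (nth_pt l i) (nth_pt l j'))
    (edist_sym (nth_pt l i') (nth_pt l j)) (edist_sym (nth_pt l i') (nth_pt l j')) (edist_sym (nth_pt l j) (nth_pt l j')).
  intros Sy1 Sy2 Sy3 Sy4 Sy5 Sy6.
  assert (Neg : forall u v, u * v < 0 -> u < 0 /\ 0 < v \/ v < 0 /\ 0 < u).
  { intros u v Huv. destruct (Rtotal_order u 0) as [Hu|[->|Hu]]; [left|lra|right]; split; nra. }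
  assert (X := Neg _ _ Hneg').
  assert (Inner : forall m M y, (a y - a m) * (a y - a M) < 0 -> (a m < a y /\ a y < a M) \/ (a M < a y /\ a y < a m)).
  { intros m M y Hy. apply Neg in Hy. lra. }
  assert (Outer : forall m M y, 0 < (a y - a m) * (a y - a M) -> (a m < a y /\ a M < a y) \/ (a y < a M /\ a y < a m)).
  { intros m M y Hy. assert (Hy' : (a m - a y) * (a y - a M) < 0) by lra. apply Neg in Hy'. lra. }
  destruct X as [[X Y]|[X Y]]; apply Inner in X; apply Outer in Y;
    destruct X as [[X1 X2]|[X1 X2]]; destruct Y as [[Y1 Y2]|[Y1 Y2]].
  - destruct (Q i i' j j'); auto; lra.
  - destruct (Q j' j i i'); auto; lra.
  - destruct (Q i' i j j'); auto; lra.
  - destruct (Q j' j i' i); auto; lra.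
  - destruct (Q i i' j' j); auto; lra.
  - destruct (Q j j' i i'); auto; lra.
  - destruct (Q i' i j' j); auto; lra.
  - destruct (Q j j' i' i); auto; lra.
Qed.

(** * The interval of directions hit by a prefix *)

(** The ends of an earlier edge are not separated by a later edge; chaining the earlier
    edges, neither are any two earlier points. Chaining the later edges in turn, two
    earlier points do not separate any two later ones. *)
Lemma no_alternation (a : nat -> R) (n : nat) :
  (forall j k, (j < n)%nat -> (k < n)%nat -> j <> k -> a j <> a k) ->
  (forall i j, (i + 1 < j)%nat -> (j + 1 < n)%nat -> 0 < alt (a i) (a (i+1)%nat) (a j) (a (j+1)%nat)) ->
  forall k x z y w, (x < k)%nat -> (z < k)%nat -> (k <= y < n)%nat -> (k <= w < n)%nat ->
    0 < alt (a x) (a z) (a y) (a w).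
Proof.
  intros Hinj Hed k x z y w Hx Hz Hy Hw.
  assert (prod_pos : forall p q r s, 0 < p * q -> 0 < q * r -> s = p * r -> 0 < s).
  { intros p q r s Hp Hq ->. assert (q <> 0) by (intros ->; lra).
    assert (0 < q * q) by nra. assert (0 < (p * q) * (q * r)) by nra. nra. }
  (* all earlier points lie on the same side of a later edge *)
  set (g := fun j j' i => (a i - a j) * (a i - a j')).
  assert (G : forall j i i', (k <= j)%nat -> (j + 1 < n)%nat -> (i < k)%nat -> (i' < k)%nat ->
     0 < g j (j+1)%nat i * g j (j+1)%nat i').
  { intros j i i' Hj Hj'.
    assert (Nz : forall i, (i < k)%nat -> g j (j+1)%nat i <> 0).
    { intros i0 Hi0. unfold g. intros E. apply Rmult_integral in E.
      destruct E as [E|E].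
      - apply (Hinj i0 j); try lia. lra.
      - apply (Hinj i0 (j+1)%nat); try lia. lra. }
    assert (St : forall i, (i + 1 < k)%nat -> 0 < g j (j+1)%nat i * g j (j+1)%nat (i+1)%nat).
    { intros i0 Hi0. generalize (Hed i0 j ltac:(lia) Hj'). unfold alt, g. nra. }
    assert (Z0 : forall i, (i < k)%nat -> 0 < g j (j+1)%nat 0%nat * g j (j+1)%nat i).
    { induction i0 as [|i0 IH]; intros Hi0.
      - assert (X := Nz 0%nat Hi0). nra.
      - apply (prod_pos (g j (j+1)%nat 0%nat) (g j (j+1)%nat i0) (g j (j+1)%nat (S i0))).
        + apply IH. lia.
        + replace (S i0) with (i0 + 1)%nat by lia. apply St. lia.
        + easy. }
    intros Hi Hi'.
    apply (prod_pos (g j (j+1)%nat i) (g j (j+1)%nat 0%nat) (g j (j+1)%nat i')).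
    - rewrite Rmult_comm. now apply Z0.
    - now apply Z0.
    - easy. }
  set (h := fun j => (a j - a x) * (a j - a z)).
  assert (Nh : forall j, (k <= j < n)%nat -> h j <> 0).
  { intros j Hj. unfold h. intros E. apply Rmult_integral in E.
    destruct E as [E|E].
    - apply (Hinj j x); try lia. lra.
    - apply (Hinj j z); try lia. lra. }
  assert (Sh : forall j, (k <= j)%nat -> (j + 1 < n)%nat -> 0 < h j * h (j+1)%nat).
  { intros j H1 H2. generalize (G j x z H1 H2 Hx Hz). unfold g, h. nra. }
  assert (Zh : forall m, (k + m < n)%nat -> 0 < h k * h (k + m)%nat).
  { induction m as [|m IH]; intros Hm.
    - rewrite Nat.add_0_r. assert (X := Nh k ltac:(lia)). nra.
    - apply (prod_pos (h k) (h (k + m)%nat) (h (k + S m)%nat)).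
      + apply IH. lia.
      + replace (k + S m)%nat with (k + m + 1)%nat by lia. apply Sh; lia.
      + easy. }
  change (0 < h y * h w).
  replace y with (k + (y - k))%nat by lia. replace w with (k + (w - k))%nat by lia.
  apply (prod_pos (h (k + (y - k))%nat) (h k) (h (k + (w - k))%nat)).
  - rewrite Rmult_comm. apply Zh. lia.
  - apply Zh. lia.
  - easy.
Qed.

Lemma plen_app_le (l1 l2 : list C) : plen origin l1 <= plen origin (l1 ++ l2).
Proof. rewrite plen_app. generalize (plen_pos (last l1 origin) l2). lra. Qed.

Lemma hit_eq (p : C) (a b : R) : e a = e b -> hit 1 p a -> hit 1 p b.
Proof. unfold hit. now intros ->. Qed.

(** Until the length bound is reached, the directions hit by a prefix of a minimal list
    form one interval from [k] to [s] modulo [2 PI], and each further point hits an end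
    of it. A point that hits neither end would leave two gaps, one on each side; both
    would have to be filled by later points, whose private directions would alternate
    with those of the first point and of this one. *)
Lemma covered_interval (d r y0 : R) (S l : list C) (a : nat -> R) : tuned d r y0 ->
  incl l S -> hits_all l -> plen origin l <= 10 -> private l a ->
  (forall l', incl l' S -> length l' = length l -> hits_all l' -> plen origin l <= plen origin l') ->
  forall l1 l2, l = l1 ++ l2 -> l1 <> [] ->
  Fin d r y0 l1 \/ exists k s, k <= a 0%nat <= s /\ s < k + 2 * PI /\
    (forall t, k <= t <= s -> exists p, In p l1 /\ hit 1 p t) /\
    (forall t p, s < t < k + 2 * PI -> In p l1 -> ~ hit 1 p t) /\ State d r y0 k s l1.
Proof.
  intros Ht Hi Hh Hlen Hp Hmin.
  assert (Hpi := PI_RGT_0).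
  assert (Hr : r <= 1) by (unfold tuned in Ht; lra).
  assert (NA := no_alternation a (length l) (fun j k => private_inj l a j k Hp)
    (fun i j => uncrossed_edges S l a i j Hmin Hi Hh Hp)).
  intros l1. induction l1 as [|q l1 IH] using rev_ind; intros l2 E Hne; [easy|].
  assert (Hlen1 : plen origin (l1 ++ [q]) <= 10).
  { apply Rle_trans with (plen origin l); [|easy]. rewrite E. apply plen_app_le. }
  assert (Hll : length l = (length l1 + 1 + length l2)%nat).
  { rewrite E, !length_app. simpl. lia. }
  set (K := length l1) in *.
  assert (Hq : nth_pt l K = q).
  { unfold nth_pt. rewrite E, <- app_assoc, app_nth2 by (fold K; lia). fold K. now rewrite Nat.sub_diag. }
  assert (HK : (K < length l)%nat) by lia.
  destruct (Hp K HK) as (P1 & P2 & P3). rewrite Hq in P1.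
  destruct l1 as [|q0 l1'].
  { right. destruct (hit_arc q (a 0%nat) P1) as (k & s & C1 & C2 & C3 & C4 & C5).
    exists k, s. split; [easy|]. split; [lra|]. split; [|split].
    - intros t Htt. exists q. split; [now left|]. apply hit_between with k s; try easy; lra.
    - intros t p Htt [<-|[]]. now apply C5.
    - left. apply Up_single; simpl; try easy; lra. }
  set (l1 := q0 :: l1') in *.
  destruct (IH (q :: l2)) as [IHf|(k & s & I1 & I2 & Ic & I3 & I4)].
  { now rewrite E, <- app_assoc. } { easy. }
  { left. now apply Fin_snoc. }
  clear IH.
  assert (HK0 : (0 < K)%nat) by (unfold K, l1; simpl; lia).
  assert (Hnt1 : forall j, (j < K)%nat -> In (nth_pt l j) l1).
  { intros j Hj. unfold nth_pt. rewrite E, <- app_assoc, app_nth1 by (fold K; lia). apply nth_In. fold K. lia. }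
  assert (Hin1 : forall p, In p l1 -> exists j, (j < K)%nat /\ nth_pt l j = p).
  { intros p Hpp. destruct (In_nth l1 p origin Hpp) as (j & J1 & J2). exists j. split; [easy|].
    unfold nth_pt. rewrite E, <- app_assoc, app_nth1 by easy. easy. }
  assert (Hother : forall j m, (j < length l)%nat -> (m < length l)%nat -> j <> m -> ~ hit 1 (nth_pt l j) (a m)).
  { intros j m Hj Hm Hjm. now apply (Hp m Hm). }
  assert (Hq0 : ~ hit 1 q (a 0%nat)).
  { rewrite <- Hq. apply Hother; lia. }
  (* the direction owned by a later point lies in the gap *)
  assert (Hgap : forall m, (K <= m < length l)%nat -> s < a m < k + 2 * PI).
  { intros m Hm. destruct (Hp m ltac:(lia)) as (_ & _ & W).
    assert (N1 : forall p, In p l1 -> ~ hit 1 p (a m)).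
    { intros p Hpp. destruct (Hin1 p Hpp) as (j & J1 & <-). apply Hother; lia. }
    split; apply Rnot_le_lt; intros Hc.
    - destruct (Ic (a m)) as (p & Q1 & Q2); [lra|]. now apply (N1 p).
    - destruct (Ic (a m - 2 * PI)) as (p & Q1 & Q2); [lra|].
      apply (N1 p); [easy|]. revert Q2. apply hit_eq. rewrite <- e_2PI. f_equal. ring. }
  assert (Hz := Hgap K ltac:(lia)). set (z := a K) in *.
  destruct (classic (hit 1 q s)) as [Hs|Hs]; [|destruct (classic (hit 1 q k)) as [Hk|Hk]].
  - (* the interval grows upwards *)
    destruct (hit_arc q s Hs) as (kq & sq & C1 & C2 & C3 & C4 & C5).
    assert (Hkq : k <= kq).
    { apply Rnot_lt_le. intros Hc. apply Hq0. apply hit_between with kq sq; try easy; lra. }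
    destruct (State_step_up d r y0 k s sq l1 q) as [Hf|[Hf Hlt]]; try easy; try lra; [now left|].
    right. exists k, sq. split; [lra|]. split; [easy|]. split; [|split; [|easy]].
    + intros t Htt. destruct (Rle_dec t s) as [Hts|Hts].
      * destruct (Ic t) as (p & Q1 & Q2); [lra|]. exists p. split; [|easy]. apply in_or_app. now left.
      * exists q. split; [apply in_or_app; right; now left|]. apply hit_between with s sq; try easy; lra.
    + intros t p Htt Hpp. apply in_app_or in Hpp. destruct Hpp as [Hpp|[<-|[]]].
      * apply I3; [lra|easy].
      * apply C5. lra.
  - (* the interval grows downwards *)
    destruct (hit_arc q k Hk) as (kq & sq & C1 & C2 & C3 & C4 & C5).
    assert (Hsq : sq <= s).
    { apply Rnot_lt_le. intros Hc. apply Hq0. apply hit_between with kq sq; try easy; lra. }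
    destruct (State_step_down d r y0 k kq s l1 q) as [Hf|[Hf Hlt]]; try easy; try lra; [now left|].
    right. exists kq, s. split; [lra|]. split; [easy|]. split; [|split; [|easy]].
    + intros t Htt. destruct (Rle_dec k t) as [Hts|Hts].
      * destruct (Ic t) as (p & Q1 & Q2); [lra|]. exists p. split; [|easy]. apply in_or_app. now left.
      * exists q. split; [apply in_or_app; right; now left|]. apply hit_between with kq k; try easy; lra.
    + intros t p Htt Hpp. apply in_app_or in Hpp. destruct Hpp as [Hpp|[<-|[]]].
      * apply I3; [lra|easy].
      * apply C5. lra.
  - (* a jump into the middle of the gap is impossible *)
    exfalso.
    destruct (hit_arc q z P1) as (kq & sq & C1 & C2 & C3 & C4 & C5).
    assert (Hkq : s < kq).
    { apply Rnot_le_lt. intros Hc. apply Hs. apply hit_between with kq sq; try easy; lra. }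
    assert (Hsq : sq < k + 2 * PI).
    { apply Rnot_le_lt. intros Hc. apply Hk. apply hit_2PI. apply hit_between with kq sq; try easy; lra. }
    assert (Later : forall t, s < t < k + 2 * PI -> ~ hit 1 q t ->
       exists j, (K + 1 <= j < length l)%nat /\ hit 1 (nth_pt l j) t).
    { intros t Htt Hqt. destruct (Hh t) as (p & Q1 & Q2).
      destruct (In_nth l p origin Q1) as (j & J1 & J2).
      exists j. split; [|unfold nth_pt; now rewrite J2].
      assert (~ (j < K)%nat).
      { intros Hj. apply (I3 t p Htt); [|easy]. rewrite <- J2. now apply Hnt1. }
      assert (j <> K). { intros ->. apply Hqt. rewrite <- Hq. unfold nth_pt. now rewrite J2. }
      lia. }
    assert (Notq : forall t, (K + 1 <= t < length l)%nat -> ~ kq <= a t <= sq).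
    { intros t Htt Hc. apply (Hother K t); try lia. rewrite Hq. apply hit_between with kq sq; try easy; lra. }
    (* Only later points can hit the midpoints of the two gaps beside the new arc. *)
    destruct (Later ((s + kq) / 2)) as (j & J1 & J2); [lra| |].
    { intros Hc. apply hit_2PI in Hc. revert Hc. apply C5. lra. }
    destruct (Later ((sq + (k + 2 * PI)) / 2)) as (j' & J1' & J2'); [lra| |].
    { apply C5. lra. }
    assert (Hj := Hgap j ltac:(lia)). assert (Hj' := Hgap j' ltac:(lia)).
    assert (Hjk : a j < kq).
    { apply Rnot_le_lt. intros Hc. assert (sq < a j). { generalize (Notq j J1). lra. }
      destruct (Hp j ltac:(lia)) as (A1 & _ & _).
      destruct (hit_arc (nth_pt l j) (a j) A1) as (kj & sj & D1 & D2 & D3 & D4 & D5).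
      destruct (Rle_dec kj ((s + kq) / 2)) as [G|G].
      - apply (Hother j K); try lia. fold z. apply hit_between with kj sj; try easy; lra.
      - destruct (Rle_dec ((s + kq) / 2 + 2 * PI) sj) as [G'|G'].
        + apply (Hother j 0%nat); try lia. apply hit_2PI. apply hit_between with kj sj; try easy; lra.
        + apply (D5 ((s + kq) / 2 + 2 * PI)); [lra|]. now apply hit_2PI. }
    assert (Hjk' : sq < a j').
    { apply Rnot_le_lt. intros Hc. assert (a j' < kq). { generalize (Notq j' J1'). lra. }
      destruct (Hp j' ltac:(lia)) as (A1 & _ & _).
      destruct (hit_arc (nth_pt l j') (a j') A1) as (kj & sj & D1 & D2 & D3 & D4 & D5).
      destruct (Rle_dec ((sq + (k + 2 * PI)) / 2) sj) as [G|G].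
      - apply (Hother j' K); try lia. fold z. apply hit_between with kj sj; try easy; lra.
      - destruct (Rle_dec (kj + 2 * PI) ((sq + (k + 2 * PI)) / 2)) as [G'|G'].
        + apply (Hother j' 0%nat); try lia. apply hit_between with kj sj; try easy; lra.
        + apply (D5 ((sq + (k + 2 * PI)) / 2)); [lra|easy]. }
    assert (X := NA (K + 1)%nat 0%nat K j j' ltac:(lia) ltac:(lia) ltac:(lia) ltac:(lia)).
    fold z in X. unfold alt in X.
    assert ((a j - a 0%nat) * (a j - z) < 0) by nra.
    assert (0 < (a j' - a 0%nat) * (a j' - z)) by nra. nra.
Qed.

(** The lower bound for finite lists, with its near-equality case: an almost optimal
    list contains a sweep. *)
Lemma short_list_sweeps (d r y0 : R) (S : list C) : tuned d r y0 -> hits_all S -> plen origin S <= 10 ->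
  exists l, incl l S /\ plen origin l <= plen origin S /\ Fin d r y0 l.
Proof.
  intros Ht HS Hlen. destruct (minimal_list S HS) as (l & H1 & H2 & H3 & H4 & H5).
  destruct (private_exists S l H1 H2 H3 H4) as [a Ha].
  assert (Hl : l <> []). { intros ->. destruct (H3 0) as (p & [] & _). }
  exists l. split; [easy|]. split; [easy|].
  destruct (covered_interval d r y0 S l a Ht H1 H3 ltac:(lra) Ha H5 l []) as [Hf|(k & s & I1 & I2 & _ & I3 & _)];
    try easy; [now rewrite app_nil_r|].
  exfalso. destruct (H3 ((s + (k + 2 * PI)) / 2)) as (p & Q1 & Q2).
  apply (I3 ((s + (k + 2 * PI)) / 2) p); try easy. lra.
Qed.

(** * The lower bound for lists *)

Lemma tuned_exists (r y0 : R) : 0 <= r < 1 -> 0 < y0 <= PI/4 -> exists d, tuned d r y0.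
Proof.
  intros Hr Hy.
  assert (Hpi := PI_RGT_0).
  assert (Hc : 0 < cos y0) by (apply cos_gt_0; lra).
  assert (Hc1 : cos y0 < 1). { rewrite <- cos_0. apply cos_decreasing_1; lra. }
  assert (Hi : 1 < / cos y0). { apply Rmult_lt_reg_l with (cos y0); [easy|]. rewrite Rinv_r; lra. }
  set (d1 := (1 - r) * (1 - r) / 20). assert (0 < d1) by (unfold d1; assert (0 < (1 - r) * (1 - r)) by nra; lra).
  set (d2 := / cos y0 - 1). assert (0 < d2) by (unfold d2; lra).
  exists (Rmin d1 (Rmin d2 (1/10))). unfold tuned.
  generalize (Rmin_l d1 (Rmin d2 (1/10))) (Rmin_r d1 (Rmin d2 (1/10)))
    (Rmin_l d2 (1/10)) (Rmin_r d2 (1/10)). intros.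
  split; [|split; [lra|split; [|split; [lra|split; [lra|]]]]].
  - repeat apply Rmin_glb_lt; lra.
  - unfold d1 in *. lra.
  - replace (1 / cos y0) with (/ cos y0) by (field; lra). unfold d2 in *. lra.
Qed.

Lemma sqrt3_sqr : sqrt 3 * sqrt 3 = 3.
Proof. apply sqrt_sqrt; lra. Qed.

Lemma sqrt3_bound : 1.7 < sqrt 3 < 1.75.
Proof.
  generalize sqrt3_sqr (sqrt_pos 3). intros. split; nra.
Qed.

Lemma L0_lt_9 : L0 < 9.
Proof. unfold L0. generalize sqrt3_bound PI_lt_315. lra. Qed.

Lemma list_lower_bound (S : list C) : hits_all S -> L0 <= plen origin S.
Proof.
  intros HS. destruct (Rle_dec (plen origin S) 10) as [H|H]; [|generalize L0_lt_9; lra].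
  assert (Hpi := PI_RGT_0).
  destruct (tuned_exists 0 (PI/4)) as [d Hd]; try lra.
  destruct (short_list_sweeps d 0 (PI/4) S Hd HS H) as (l & _ & H2 & [H3 _]). lra.
Qed.

(** * Polygons inscribed in a curve *)

Fixpoint incr (a : R) (ts : list R) (b : R) : Prop :=
  match ts with
  | [] => a <= b
  | t :: ts' => a <= t /\ incr t ts' b
  end.

Lemma incr_le a ts b : incr a ts b -> a <= b.
Proof. revert a; induction ts; simpl; intros; [easy|]. destruct H. apply IHts in H0. lra. Qed.

Lemma incr_In a ts b t : incr a ts b -> In t ts -> a <= t <= b.
Proof.
  revert a. induction ts as [|u ts IH]; intros a H1 T1; [easy|].
  destruct H1 as [H1 H2]. destruct T1 as [->|T1].
  - split; [easy|]. now apply incr_le in H2.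
  - specialize (IH u H2 T1). lra.
Qed.

Lemma inscribed_polygon (g : curve) (ts : list R) : incr (lo g) ts (hi g) ->
  inscribed_length g (plen (g (lo g)) (map g (ts ++ [hi g]))).
Proof.
  assert (G : forall b ts a, incr a ts b -> exists t : nat -> R,
    t 0%nat = a /\ t (S (length ts)) = b /\
    (forall i : nat, (i <= length ts)%nat -> t i <= t (S i)) /\
    plen (g a) (map g (ts ++ [b])) = sum_f_R0 (fun i => Cmod (g (t (S i)) - g (t i))%C) (length ts)).
  { intros b. clear ts. induction ts as [|x ts IH]; intros a Ha.
    - exists (fun i => match i with O => a | _ => b end). repeat split; try easy.
      + intros i Hi. simpl in Hi. assert (i = 0)%nat as -> by lia. exact Ha.
      + simpl. unfold edist. ring.
    - destruct Ha as [Ha Hi]. destruct (IH x Hi) as (t & H1 & H2 & H3 & H4).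
      exists (fun i => match i with O => a | S j => t j end). repeat split; try easy.
      + intros [|i] Hle; [now rewrite H1|]. apply H3. simpl in Hle. lia.
      + simpl length. rewrite decomp_sum by lia. simpl pred. simpl app. simpl map. simpl plen.
        rewrite H4, H1. easy. }
  intros H. destruct (G (hi g) ts (lo g) H) as (t & H1 & H2 & H3 & H4).
  exists (length ts), t. easy.
Qed.

(** Boundedness makes the supremum in the definition of the length finite. *)
Lemma path_length_spec (g : curve) (L : R) : lo g <= hi g ->
  (forall s, inscribed_length g s -> s <= L) ->
  (forall s, inscribed_length g s -> s <= path_length g) /\ path_length g <= L.
Proof.
  intros Hlh HL. unfold path_length.
  destruct (Lub_Rbar_correct (inscribed_length g)) as [H1 H2].
  assert (H3 : Rbar_le (Lub_Rbar (inscribed_length g)) (Finite L)).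
  { apply H2. intros s Hs. now apply HL. }
  assert (H4 := inscribed_polygon g [] Hlh).
  assert (H5 := H1 _ H4).
  destruct (Lub_Rbar (inscribed_length g)) as [v| |]; simpl in *; try easy.
Qed.

Lemma polygon_le_length (g : curve) (ts : list R) : is_path g -> incr (lo g) ts (hi g) ->
  plen (g (lo g)) (map g ts) <= path_length g.
Proof.
  intros (Hlh & _ & [M HM]) Hi.
  destruct (path_length_spec g M Hlh HM) as [H _].
  apply Rle_trans with (plen (g (lo g)) (map g (ts ++ [hi g]))).
  - rewrite map_app, plen_app. simpl.
    generalize (edist_pos (last (map g ts) (g (lo g))) (g (hi g))). lra.
  - apply H. now apply inscribed_polygon.
Qed.

(** * Continuity and compactness *)

Lemma ball_edist (x y : C) (eps : posreal) : edist x y < eps -> ball x eps y.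
Proof.
  intros H.
  assert (H1 := edist_sqr x y). assert (H2 := edist_pos x y).
  split; unfold ball; simpl; unfold AbsRing_ball, abs, minus, plus, opp; simpl.
  - apply Rle_lt_trans with (edist x y); [|easy]. apply Rsqr_incr_0_var; [|easy].
    rewrite <- Rsqr_abs. unfold Rsqr. rewrite H1.
    generalize (Rle_0_sqr (fst y - fst x)) (Rle_0_sqr (snd y - snd x)); unfold Rsqr; lra.
  - apply Rle_lt_trans with (edist x y); [|easy]. apply Rsqr_incr_0_var; [|easy].
    rewrite <- Rsqr_abs. unfold Rsqr. rewrite H1.
    generalize (Rle_0_sqr (fst y - fst x)) (Rle_0_sqr (snd y - snd x)); unfold Rsqr; lra.
Qed.

Lemma edist_ball (x y : C) (eps : posreal) : ball x eps y -> edist x y < 2 * eps.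
Proof.
  intros [H1 H2]. unfold ball in H1, H2; simpl in H1, H2.
  unfold AbsRing_ball, abs, minus, plus, opp in H1, H2; simpl in H1, H2.
  assert (H3 := edist_sqr x y). assert (H4 := edist_pos x y).
  assert (He := cond_pos eps).
  apply Rsqr_incrst_0; try lra. unfold Rsqr. rewrite H3.
  apply Rabs_def2 in H1. apply Rabs_def2 in H2. nra.
Qed.

Lemma continuous_on_edist (D : R -> Prop) (f : R -> C) :
  continuous_on D f <->
  forall x, D x -> forall eps, 0 < eps -> exists del, 0 < del /\
    forall y, D y -> Rabs (y - x) < del -> edist (f x) (f y) < eps.
Proof.
  split.
  - intros H x Hx eps He. specialize (H x Hx).
    assert (He2 : 0 < eps / 2) by lra.
    rewrite filterlim_locally in H. specialize (H (mkposreal _ He2)).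
    destruct H as [del Hdel]. exists del. split; [apply cond_pos|].
    intros y Hy Hxy. assert (B : ball (f x) (mkposreal _ He2) (f y)).
    { apply Hdel; [exact Hxy|easy]. }
    apply edist_ball in B. simpl in B. lra.
  - intros H x Hx. rewrite filterlim_locally. intros eps.
    destruct (H x Hx eps (cond_pos eps)) as (del & H1 & H2).
    exists (mkposreal _ H1). intros y Hy HDy. apply ball_edist. apply H2; [easy|exact Hy].
Qed.

(** Finitely many of the intervals of radius [delta t] suffice, so their radii are
    bounded below. *)
Lemma compact_cover (a b : R) (delta : R -> R) : (forall t, 0 < delta t) ->
  exists d, 0 < d /\ forall x, a <= x <= b -> exists t, a <= t <= b /\ Rabs (x - t) < delta t /\ d <= delta t.
Proof.
  intros H. destruct (compactness_value_1d a b (fun t => mkposreal _ (H t))) as [d Hd].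
  exists d. split; [apply cond_pos|]. intros x Hx. apply NNPP. exact (Hd x Hx).
Qed.

Lemma unif_cont (a b : R) (f : R -> C) : continuous_on (fun t => a <= t <= b) f ->
  forall eps, 0 < eps -> exists del, 0 < del /\ forall x y, a <= x <= b -> a <= y <= b ->
    Rabs (y - x) < del -> edist (f x) (f y) < eps.
Proof.
  intros Hc eps He. rewrite continuous_on_edist in Hc.
  assert (E : forall t, exists del, 0 < del /\ (a <= t <= b ->
    forall y, a <= y <= b -> Rabs (y - t) < 2 * del -> edist (f t) (f y) < eps / 2)).
  { intros t. destruct (classic (a <= t <= b)) as [Ht|Ht].
    - destruct (Hc t Ht (eps/2) ltac:(lra)) as (del & H1 & H2). exists (del / 2). split; [lra|].
      intros _ y Hy Hyt. apply H2; [easy|]. lra.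
    - exists 1. split; [lra|easy]. }
  apply fun_choice in E. destruct E as [delta Hdelta].
  destruct (compact_cover a b delta) as (d & Hd & Hcov). { intros t. apply Hdelta. }
  exists d. split; [easy|]. intros x y Hx Hy Hxy.
  destruct (Hcov x Hx) as (t & Ht & H1 & H2). destruct (Hdelta t) as [Hp Hdt].
  assert (X1 := Hdt Ht x Hx ltac:(lra)).
  assert (X2 := Hdt Ht y Hy).
  assert (Rabs (y - t) < 2 * delta t).
  { replace (y - t) with ((y - x) + (x - t)) by ring. generalize (Rabs_triang (y - x) (x - t)). lra. }
  specialize (X2 H). generalize (edist_tri (f x) (f t) (f y)). rewrite (edist_sym (f x) (f t)). lra.
Qed.

(** The image of a compact interval is closed: a point outside has positive distance
    from it. *)
Lemma closed_image (a b : R) (f : R -> C) (X : C) : continuous_on (fun t => a <= t <= b) f ->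
  (forall t, a <= t <= b -> f t <> X) ->
  exists eta, 0 < eta /\ forall t, a <= t <= b -> eta <= edist (f t) X.
Proof.
  intros Hc HX. rewrite continuous_on_edist in Hc.
  assert (E : forall t, exists del, 0 < del /\ (a <= t <= b ->
    forall y, a <= y <= b -> Rabs (y - t) < del -> del <= edist (f y) X)).
  { intros t. destruct (classic (a <= t <= b)) as [Ht|Ht].
    - assert (Hpos : 0 < edist (f t) X).
      { apply Rnot_le_lt. intros Hle. apply (HX t Ht). now apply edist_eq0. }
      destruct (Hc t Ht (edist (f t) X / 2) ltac:(lra)) as (del & H1 & H2).
      exists (Rmin del (edist (f t) X / 2)). split; [apply Rmin_glb_lt; lra|].
      intros _ y Hy Hyt. specialize (H2 y Hy).
      generalize (Rmin_l del (edist (f t) X / 2)) (Rmin_r del (edist (f t) X / 2)). intros.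
      specialize (H2 ltac:(lra)). generalize (edist_tri (f t) (f y) X). lra.
    - exists 1. split; [lra|easy]. }
  apply fun_choice in E. destruct E as [delta Hdelta].
  destruct (compact_cover a b delta) as (d & Hd & Hcov). { intros t. apply Hdelta. }
  exists d. split; [easy|]. intros y Hy.
  destruct (Hcov y Hy) as (t & Ht & H1 & H2). destruct (Hdelta t) as [Hp Hdt].
  specialize (Hdt Ht y Hy H1). lra.
Qed.

(** * Tangent lines of the circle *)

Lemma unit_angle (x y : R) : x * x + y * y = 1 -> exists a, cos a = x /\ sin a = y.
Proof.
  intros H. assert (Hx : -1 <= x <= 1) by (split; nra).
  assert (Hs : sqrt (1 - x²) = Rabs y).
  { rewrite <- sqrt_Rsqr_abs. f_equal. unfold Rsqr. lra. }
  destruct (Rle_dec 0 y) as [Hy|Hy].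
  - exists (acos x). rewrite cos_acos, sin_acos by easy. split; [easy|]. rewrite Hs. now apply Rabs_pos_eq.
  - exists (- acos x). rewrite cos_neg, sin_neg, cos_acos, sin_acos by easy. split; [easy|].
    rewrite Hs, Rabs_left by lra. ring.
Qed.

Definition tangent (a : R) (q : C) : Prop := dot q (e a) = 1.

Lemma tangent_is_tangent_line (a : R) : is_tangent_line (tangent a).
Proof.
  assert (E := sin2_cos2 a). unfold Rsqr in E.
  split.
  - exists (e a), (e (a + PI/2)). rewrite e_half. split.
    + unfold origin. intros H. injection H as H1 H2. rewrite H2 in E.
      assert (sin a = 0) by lra. rewrite H in E. lra.
    + intros [x y]. unfold tangent, dot, e; simpl. split.
      * intros H. exists (- x * sin a + y * cos a).
        unfold Cplus, Cmult, RtoC; simpl. f_equal.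
        -- transitivity (cos a * (x * cos a + y * sin a) + (- x * sin a + y * cos a) * - sin a).
           { transitivity (x * (sin a * sin a + cos a * cos a)); [rewrite E|]; ring. }
           rewrite H. ring.
        -- transitivity (sin a * (x * cos a + y * sin a) + (- x * sin a + y * cos a) * cos a).
           { transitivity (y * (sin a * sin a + cos a * cos a)); [rewrite E|]; ring. }
           rewrite H. ring.
      * intros [s H]. unfold Cplus, Cmult, RtoC in H; simpl in H. injection H as -> ->.
        transitivity (sin a * sin a + cos a * cos a); [ring|easy].
  - exists (e a). split.
    + split; [unfold K; apply Cmod_e|]. unfold tangent. rewrite dot_e_e.
      replace (a - a) with 0 by ring. apply cos_0.
    + intros [x y] [H1 H2]. unfold K in H1. unfold tangent, dot, e in H2; simpl in H2.
      assert (H3 := Cmod_sqr (x, y)). rewrite H1 in H3. unfold dot in H3; simpl in H3.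
      assert (H4 : (x - cos a) * (x - cos a) + (y - sin a) * (y - sin a) = 0) by nra.
      destruct (Rplus_sqr_eq_0 (x - cos a) (y - sin a)) as [H5 H6]; [unfold Rsqr; easy|].
      unfold e. f_equal; lra.
Qed.

(** With a unit normal oriented so that the line is [<., e a> = c] with [c >= 0], a
    value [c < 1] would give two common points with the circle and [c > 1] none. *)
Lemma tangent_line_is_tangent (L : C -> Prop) : is_tangent_line L ->
  exists a, forall q, tangent a q -> L q.
Proof.
  intros [(p & v & Hv & HL) [m [[Hm1 Hm2] Hm3]]].
  assert (Hn : 0 < Cmod v).
  { apply Cmod_gt_0. intros E. now apply Hv. }
  set (n := Cmod v) in *.
  assert (Hvv := Cmod_sqr v). fold n in Hvv. unfold dot in Hvv.
  set (w1 := - snd v / n). set (w2 := fst v / n).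
  assert (Hw : w1 * w1 + w2 * w2 = 1).
  { unfold w1, w2. transitivity ((fst v * fst v + snd v * snd v) / (n * n)); [field; lra|].
    rewrite <- Hvv. field. lra. }
  assert (Hor : w1 * fst v + w2 * snd v = 0) by (unfold w1, w2; field; lra).
  (* orient the normal so that the line lies at a nonnegative distance *)
  assert (HW : exists x y, x * x + y * y = 1 /\ x * fst v + y * snd v = 0 /\ 0 <= x * fst p + y * snd p).
  { destruct (Rle_dec 0 (w1 * fst p + w2 * snd p)).
    - now exists w1, w2.
    - exists (- w1), (- w2). repeat split; lra. }
  clear w1 w2 Hw Hor. destruct HW as (x & y & Hu & Ho & Hc).
  destruct (unit_angle x y Hu) as (a & <- & <-). exists a.
  set (c := cos a * fst p + sin a * snd p) in *.
  assert (HL2 : forall q, L q <-> dot q (e a) = c).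
  { intros q. rewrite HL. split.
    - intros [s ->]. transitivity (c + s * (cos a * fst v + sin a * snd v)); [|rewrite Ho; ring].
      unfold dot, e, c. destruct p, v; simpl. ring.
    - intros H. set (q1 := fst q - fst p). set (q2 := snd q - snd p).
      assert (H0 : cos a * q1 + sin a * q2 = 0).
      { transitivity (dot q (e a) - c); [unfold q1, q2, c, dot, e; simpl; ring|lra]. }
      exists ((q1 * fst v + q2 * snd v) / (n * n)).
      assert (E1 : q1 * snd v = q2 * fst v).
      { assert (F1 : cos a * (q1 * snd v - q2 * fst v) = 0).
        { transitivity (snd v * (cos a * q1 + sin a * q2) - q2 * (cos a * fst v + sin a * snd v)); [ring|].
          rewrite H0, Ho. ring. }
        assert (F2 : sin a * (q1 * snd v - q2 * fst v) = 0).
        { transitivity (- fst v * (cos a * q1 + sin a * q2) + q1 * (cos a * fst v + sin a * snd v)); [ring|].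
          rewrite H0, Ho. ring. }
        assert (q1 * snd v - q2 * fst v = 0); [|lra].
        transitivity ((q1 * snd v - q2 * fst v) * (cos a * cos a + sin a * sin a)); [rewrite Hu; ring|].
        transitivity (cos a * (cos a * (q1 * snd v - q2 * fst v)) + sin a * (sin a * (q1 * snd v - q2 * fst v))); [ring|].
        rewrite F1, F2. ring. }
      assert (Hnn : n * n <> 0) by nra.
      destruct q as [qx qy], p as [px py], v as [vx vy].
      unfold Cplus, Cmult, RtoC; simpl in *. f_equal; apply Rmult_eq_reg_l with (n * n); try easy.
      + transitivity (n * n * px + (q1 * vx + q2 * vy) * vx); [|field; lra].
        replace ((q1 * vx + q2 * vy) * vx) with (q1 * (vx * vx) + vy * (q2 * vx)) by ring.
        rewrite <- E1. transitivity (n * n * px + q1 * (vx * vx + vy * vy)); [|ring].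
        rewrite <- Hvv. unfold q1. ring.
      + transitivity (n * n * py + (q1 * vx + q2 * vy) * vy); [|field; lra].
        replace ((q1 * vx + q2 * vy) * vy) with (q2 * (vy * vy) + vx * (q1 * vy)) by ring.
        rewrite E1. transitivity (n * n * py + q2 * (vx * vx + vy * vy)); [|ring].
        rewrite <- Hvv. unfold q2. ring. }
  assert (Ec : c = 1).
  { assert (M1 := proj1 (HL2 m) Hm2).
    assert (M2 := dot_le_Cmod (e a) m (dot_e_unit a)). unfold K in Hm1. rewrite Hm1, M1 in M2.
    destruct (Req_dec c 1) as [|Hne]; [easy|]. exfalso.
    (* for c < 1 the line meets the circle at [c e a + s e (a + PI/2)] for both signs of s *)
    assert (Hs : 0 < 1 - c * c) by nra.
    set (s := sqrt (1 - c * c)).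
    assert (Hss : s * s = 1 - c * c) by (apply sqrt_sqrt; lra).
    assert (Hs0 : 0 < s) by (apply sqrt_lt_R0; lra).
    assert (T : forall s', s' * s' = 1 - c * c -> m = (c * cos a - s' * sin a, c * sin a + s' * cos a)).
    { intros s' Hs'. apply Hm3. split.
      - unfold K, Cmod; simpl. transitivity (sqrt 1); [f_equal|apply sqrt_1].
        transitivity (c * c * (cos a * cos a + sin a * sin a) + s' * s' * (cos a * cos a + sin a * sin a)); [ring|].
        rewrite Hu, Hs'. ring.
      - apply HL2. unfold dot, e; simpl. transitivity (c * (cos a * cos a + sin a * sin a)); [ring|].
        rewrite Hu. ring. }
    assert (T1 := T s Hss). assert (T2 := T (- s) ltac:(lra)).
    rewrite T1 in T2. injection T2 as E1 E2.
    assert (s * sin a = 0) by lra. assert (s * cos a = 0) by lra. nra. }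
  intros q Hq. apply HL2. rewrite Ec. exact Hq.
Qed.

Lemma admissible_hits (g : curve) (a : R) : admissible g -> exists t, lo g <= t <= hi g /\ dot (g t) (e a) = 1.
Proof. intros (_ & _ & H). exact (H _ (tangent_is_tangent_line a)). Qed.

(** * The lower bound for curves *)

Lemma mesh (b d : R) : 0 < d -> forall (N : nat) a, a <= b -> b - a <= INR N * d ->
  exists ts, incr a ts b /\ forall x, a <= x <= b -> exists t, In t ts /\ Rabs (x - t) <= d.
Proof.
  intros Hd. induction N as [|N IH]; intros a Hab HN.
  - simpl in HN. exists [a]. split; [simpl; lra|]. intros x Hx. exists a. split; [now left|].
    rewrite Rabs_pos_eq; lra.
  - rewrite S_INR in HN. destruct (Rle_dec (b - a) d) as [H|H].
    + exists [a]. split; [simpl; lra|]. intros x Hx. exists a. split; [now left|].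
      rewrite Rabs_pos_eq; lra.
    + destruct (IH (a + d)) as (ts & H1 & H2); [lra|lra|].
      exists (a :: ts). split.
      * simpl. split; [lra|]. destruct ts; simpl in *; [lra|]. destruct H1; split; [lra|easy].
      * intros x Hx. destruct (Rle_dec x (a + d)) as [Hxa|Hxa].
        -- exists a. split; [now left|]. rewrite Rabs_pos_eq; lra.
        -- destruct (H2 x) as (t & T1 & T2); [lra|]. exists t. split; [now right|easy].
Qed.

(** By uniform continuity, a fine enough subdivision of an admissible curve still hits
    every direction up to [eps]. *)
Lemma sample (g : curve) (eps : R) : admissible g -> 0 < eps ->
  exists ts, incr (lo g) ts (hi g) /\
    forall a, exists t, In t ts /\ 1 - eps <= dot (g t) (e a).
Proof.
  intros Hg He. assert (Hg' := Hg). destruct Hg' as ((Hlh & Hc & Hr) & Ho & _).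
  destruct (unif_cont _ _ _ Hc eps He) as (del & Hdel & Hu).
  assert (Hd2 : 0 < del / 2) by lra.
  destruct (archimed_cor1 (del / 2 / (1 + (hi g - lo g)))) as (N & HN1 & HN2).
  { apply Rdiv_lt_0_compat; lra. }
  destruct (mesh (hi g) (del/2) Hd2 N (lo g)) as (ts & H1 & H2); [easy| |].
  { assert (HN : 0 < INR N) by (apply lt_0_INR; lia).
    apply Rmult_lt_compat_l with (r := INR N * (1 + (hi g - lo g))) in HN1; [|nra].
    replace (INR N * (1 + (hi g - lo g)) * / INR N) with (1 + (hi g - lo g)) in HN1 by (field; lra).
    replace (INR N * (1 + (hi g - lo g)) * (del / 2 / (1 + (hi g - lo g)))) with (INR N * (del/2)) in HN1 by (field; lra).
    lra. }
  exists ts. split; [easy|]. intros a.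
  destruct (admissible_hits g a Hg) as (x & Hx & Hxa).
  destruct (H2 x Hx) as (t & T1 & T2). exists t. split; [easy|].
  assert (Htr : lo g <= t <= hi g).
  { now apply incr_In with ts. }
  assert (Hclose := Hu t x Htr Hx).
  specialize (Hclose ltac:(lra)).
  generalize (dot_le_edist (e a) (g t) (g x) (dot_e_unit a)). lra.
Qed.

Definition dilate (k : R) (p : C) : C := (k * fst p, k * snd p).

Lemma dot_dilate k p u : dot (dilate k p) u = k * dot p u.
Proof. unfold dot, dilate; simpl; ring. Qed.

Lemma edist_dilate k p q : 0 <= k -> edist (dilate k p) (dilate k q) = k * edist p q.
Proof.
  intros Hk. unfold edist. replace (dilate k q - dilate k p)%C with (RtoC k * (q - p))%C.
  - rewrite Cmod_mult, Cmod_R, Rabs_pos_eq; easy.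
  - destruct p, q; unfold dilate, Cminus, Cplus, Cmult, Copp, RtoC; simpl; f_equal; ring.
Qed.

Lemma plen_dilate k p l : 0 <= k -> plen (dilate k p) (map (dilate k) l) = k * plen p l.
Proof.
  intros Hk. revert p. induction l as [|q l IH]; intros p; simpl; [ring|].
  rewrite edist_dilate, IH by easy. ring.
Qed.

Lemma dilate_origin k : dilate k origin = origin.
Proof. unfold dilate, origin; simpl; f_equal; ring. Qed.

(** A sample at tolerance [eps], dilated by [1 / (1 - eps)], hits all directions
    exactly, and its length is at most that of the curve divided by [1 - eps]. *)
Lemma length_lower_bound (g : curve) : admissible g -> L0 <= path_length g.
Proof.
  intros Hg. apply Rnot_lt_le. intros Hlt.
  assert (HL := L0_lt_9).
  assert (HL0 : 1 < L0). { unfold L0. generalize sqrt3_bound PI_RGT_0. lra. }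
  (* Chosen so that [(1 - eps) L0] still exceeds the length of the curve. *)
  set (eps := (L0 - path_length g) / (2 * L0)).
  assert (Hpl : 0 <= path_length g).
  { assert (Hp := proj1 Hg). assert (Hlh := proj1 Hp).
    generalize (polygon_le_length g [] Hp Hlh). simpl. lra. }
  assert (He : 0 < eps). { unfold eps. apply Rdiv_lt_0_compat; lra. }
  assert (Hee : 2 * L0 * eps = L0 - path_length g) by (unfold eps; field; lra).
  assert (He1 : eps <= 1/2) by nra.
  destruct (sample g eps Hg He) as (ts & H1 & H2).
  assert (Hp := polygon_le_length g ts (proj1 Hg) H1).
  rewrite (proj1 (proj2 Hg)) in Hp.
  assert (X := list_lower_bound (map (dilate (/ (1 - eps))) (map g ts))).
  assert (Hk : 0 < / (1 - eps)) by (apply Rinv_0_lt_compat; lra).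
  rewrite <- (dilate_origin (/ (1 - eps))), plen_dilate in X by lra.
  assert (HX : L0 <= / (1 - eps) * plen origin (map g ts)).
  { apply X. intros a. destruct (H2 a) as (t & T1 & T2).
    exists (dilate (/ (1 - eps)) (g t)). split; [now repeat apply in_map|].
    unfold hit. rewrite dot_dilate.
    apply Rle_trans with (/ (1 - eps) * (1 - eps)); [rewrite Rinv_l; lra|].
    apply Rmult_le_compat_l; lra. }
  apply (Rmult_le_compat_l (1 - eps)) in HX; [|lra].
  rewrite <- Rmult_assoc, Rinv_r, Rmult_1_l in HX by lra. nra.
Qed.

(** * The length of the optimal path *)

Lemma C0_1 t : 0 <= t <= 1 -> C0 t = (2 / sqrt 3 * t, 0).
Proof.
  intros H. unfold C0; simpl. destruct Rle_dec; [|lra].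
  unfold segment, origin, pointB. rewrite cos_PI6. assert (X := sqrt3_bound).
  unfold Cplus, Cmult, RtoC; simpl. f_equal; field; lra.
Qed.

Lemma C0_2 t : 1 <= t <= 2 -> C0 t = (pointC + RtoC ((2 - t) / sqrt 3) * e (PI/6 - PI/2))%C.
Proof.
  intros H. assert (X := sqrt3_bound). assert (X2 := sqrt3_sqr).
  assert (E : segment pointB pointC (t - 1) = (pointC + RtoC ((2 - t) / sqrt 3) * e (PI/6 - PI/2))%C).
  { unfold segment, pointB, pointC, e. rewrite cos_minus, sin_minus, cos_PI2, sin_PI2, cos_PI6, sin_PI6.
    unfold Cplus, Cmult, RtoC; simpl. f_equal; field_simplify_eq; try lra.
    all: try (replace (sqrt 3 ^ 2) with (sqrt 3 * sqrt 3) by ring; rewrite X2; ring). }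
  unfold C0; simpl. destruct Rle_dec.
  - assert (t = 1) as -> by lra. rewrite <- E. unfold segment, origin.
    unfold Cplus, Cmult, RtoC; simpl. f_equal; ring.
  - destruct Rle_dec; [easy|lra].
Qed.

Lemma C0_3 t : 2 <= t <= 3 -> C0 t = e (PI/6 + (t - 2) * (7 * PI / 6)).
Proof.
  intros H. unfold C0; simpl. destruct Rle_dec; [lra|].
  destruct Rle_dec; [|destruct Rle_dec; [|lra]].
  - assert (t = 2) as -> by lra. replace (PI/6 + (2 - 2) * (7 * PI / 6)) with (PI/6) by ring.
    unfold segment, pointC, pointB, e, Cplus, Cmult, RtoC; simpl. f_equal; ring.
  - f_equal. field.
Qed.

Lemma C0_4 t : 3 <= t <= 4 -> C0 t = (e (4 * PI / 3) + RtoC (t - 3) * e (4 * PI / 3 + PI / 2))%C.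
Proof.
  intros H. unfold C0; simpl. destruct Rle_dec; [lra|].
  destruct Rle_dec; [lra|]. destruct Rle_dec.
  - assert (t = 3) as -> by lra. replace (PI/6 + (3 - 2) * (4 * PI / 3 - PI/6)) with (4 * PI / 3) by field.
    unfold Cplus, Cmult, RtoC, e; simpl. f_equal; ring.
  - unfold segment, pointF, pointE. rewrite RtoC_minus. ring.
Qed.

Definition arclen (t : R) : R :=
  2 / sqrt 3 * Rmin t 1 + 1 / sqrt 3 * (clamp 1 2 t - 1)
  + 7 * PI / 6 * (clamp 2 3 t - 2) + (Rmax t 3 - 3).

Lemma edist_ray (p u : C) (s t : R) : Cmod u = 1 -> s <= t ->
  edist (p + RtoC s * u)%C (p + RtoC t * u)%C = t - s.
Proof.
  intros Hu Hst. unfold edist.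
  replace (p + t * u - (p + s * u))%C with (RtoC (t - s) * u)%C by (rewrite RtoC_minus; ring).
  rewrite Cmod_mult, Cmod_R, Hu, Rabs_pos_eq; lra.
Qed.

Lemma edist_e_sqr (a b : R) : edist (e a) (e b) * edist (e a) (e b) = 2 - 2 * cos (b - a).
Proof.
  rewrite edist_sqr. unfold e; simpl. rewrite cos_minus.
  generalize (sin2_cos2 a) (sin2_cos2 b). unfold Rsqr. intros. nra.
Qed.

Lemma edist_e_le (a b : R) : a <= b -> edist (e a) (e b) <= b - a.
Proof.
  intros H. apply Rsqr_incr_0_var; [|lra]. unfold Rsqr. rewrite edist_e_sqr.
  generalize (cos_lower (b - a)). lra.
Qed.

Lemma arclen_1 t : t <= 1 -> arclen t = 2 / sqrt 3 * t.
Proof. intros H. unfold arclen, clamp, Rmin, Rmax. repeat destruct Rle_dec; try lra. Qed.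
Lemma arclen_2 t : 1 <= t <= 2 -> arclen t = 2 / sqrt 3 + 1 / sqrt 3 * (t - 1).
Proof. intros H. unfold arclen, clamp, Rmin, Rmax. repeat destruct Rle_dec; try lra; assert (t = 1) as -> by lra; lra. Qed.
Lemma arclen_3 t : 2 <= t <= 3 -> arclen t = 3 / sqrt 3 + 7 * PI / 6 * (t - 2).
Proof. intros H. unfold arclen, clamp, Rmin, Rmax. repeat destruct Rle_dec; try lra; assert (t = 2) as -> by lra; lra. Qed.
Lemma arclen_4 t : 3 <= t <= 4 -> arclen t = 3 / sqrt 3 + 7 * PI / 6 + (t - 3).
Proof. intros H. unfold arclen, clamp, Rmin, Rmax. repeat destruct Rle_dec; try lra; assert (t = 3) as -> by lra; lra. Qed.

Lemma three_div_sqrt3 : 3 / sqrt 3 = sqrt 3.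
Proof. generalize sqrt3_sqr sqrt3_bound; intros. apply Rmult_eq_reg_l with (sqrt 3); [|lra]. rewrite H. field. lra. Qed.

(** The first inequality bounds inscribed polygons by the arc length, the second one
    gives continuity. *)
Definition lip (a b : R) : Prop := forall s t, a <= s -> s <= t -> t <= b ->
  edist (C0 s) (C0 t) <= arclen t - arclen s <= 4 * (t - s).

Lemma lip_glue a b c : a <= b <= c -> lip a b -> lip b c -> lip a c.
Proof.
  intros Habc H1 H2 s t Hs Hst Ht.
  destruct (Rle_dec t b); [apply H1; lra|]. destruct (Rle_dec b s); [apply H2; lra|].
  generalize (H1 s b) (H2 b t) (edist_tri (C0 s) (C0 b) (C0 t)). intros A B T.
  specialize (A ltac:(lra) ltac:(lra) ltac:(lra)). specialize (B ltac:(lra) ltac:(lra) ltac:(lra)). lra.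
Qed.

Lemma inv_sqrt3 : 0 < 1 / sqrt 3 < 1.
Proof.
  generalize sqrt3_bound; intros. split; [apply Rdiv_lt_0_compat; lra|].
  apply Rmult_lt_reg_l with (sqrt 3); [lra|]. unfold Rdiv. rewrite Rmult_1_l, Rinv_r; lra.
Qed.

Lemma C0_lip : lip 0 4.
Proof.
  assert (Hs := inv_sqrt3). assert (Hpi := PI_RGT_0). assert (Hpi2 := PI_lt_315).
  assert (H2s : 2 / sqrt 3 = 2 * (1 / sqrt 3)) by (unfold Rdiv; ring).
  assert (L1 : lip 0 1).
  { intros s t A B D. rewrite !C0_1, !arclen_1 by lra. split; [|rewrite H2s; generalize dependent (1 / sqrt 3); intros; nra].
    replace (2 / sqrt 3 * s, 0) with (origin + RtoC (2 / sqrt 3 * s) * e 0)%C.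
    replace (2 / sqrt 3 * t, 0) with (origin + RtoC (2 / sqrt 3 * t) * e 0)%C.
    - rewrite edist_ray; [lra|apply Cmod_e|rewrite H2s; nra].
    - unfold origin, e, Cplus, Cmult, RtoC; simpl. rewrite cos_0, sin_0. f_equal; ring.
    - unfold origin, e, Cplus, Cmult, RtoC; simpl. rewrite cos_0, sin_0. f_equal; ring. }
  assert (L2 : lip 1 2).
  { intros s t A B D. rewrite !C0_2, !arclen_2 by lra. split; [|generalize dependent (1 / sqrt 3); intros; nra].
    rewrite edist_sym, edist_ray; [unfold Rdiv; lra|apply Cmod_e|].
    apply Rmult_le_compat_r; [|lra]. unfold Rdiv in Hs. lra. }
  assert (L3 : lip 2 3).
  { intros s t A B D. rewrite !C0_3, !arclen_3 by lra. split.
    2:{ assert (7 * PI / 6 * (t - s) <= 4 * (t - s)) by (apply Rmult_le_compat_r; lra). lra. }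
    assert ((s - 2) * (7 * PI / 6) <= (t - 2) * (7 * PI / 6)) by (apply Rmult_le_compat_r; lra).
    eapply Rle_trans; [apply edist_e_le|]; lra. }
  assert (L4 : lip 3 4).
  { intros s t A B D. rewrite !C0_4, !arclen_4 by lra. split; [|lra].
    rewrite edist_ray; [lra|apply Cmod_e|lra]. }
  apply lip_glue with 3; [lra| |easy]. apply lip_glue with 2; [lra| |easy].
  apply lip_glue with 1; [lra|easy|easy].
Qed.

Lemma C0_continuous : continuous_on (fun t => 0 <= t <= 4) (pt C0).
Proof.
  apply continuous_on_edist. intros x Hx eps He. exists (eps / 4). split; [lra|].
  intros y Hy Hxy. apply Rabs_def2 in Hxy.
  destruct (Rle_dec x y) as [H|H].
  - generalize (C0_lip x y ltac:(lra) ltac:(lra) ltac:(lra)). lra.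
  - rewrite edist_sym. generalize (C0_lip y x ltac:(lra) ltac:(lra) ltac:(lra)). lra.
Qed.

Lemma C0_inscribed s : inscribed_length C0 s -> s <= L0.
Proof.
  intros (n & t & H1 & H2 & H3 & ->). simpl in H1, H2.
  assert (Hmono : forall i j, (i <= j)%nat -> (j <= S n)%nat -> t i <= t j).
  { intros i j Hij. induction Hij as [|j Hij IH]; intros Hj; [lra|].
    apply Rle_trans with (t j); [apply IH; lia|]. apply H3. lia. }
  assert (G : forall m, (m <= n)%nat ->
    sum_f_R0 (fun i => Cmod (C0 (t (S i)) - C0 (t i))%C) m <= arclen (t (S m)) - arclen (t 0%nat)).
  { assert (B : forall i, (i <= S n)%nat -> 0 <= t i <= 4).
    { intros i Hi. rewrite <- H1, <- H2. split; apply Hmono; lia. }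
    induction m as [|m IH]; intros Hm; [|rewrite tech5].
    - apply C0_lip; [apply B; lia|apply H3; lia|apply B; lia].
    - specialize (IH ltac:(lia)).
      assert (X := C0_lip (t (S m)) (t (S (S m)))).
      destruct X as [X _]; [apply B; lia|apply H3; lia|apply B; lia|].
      unfold edist in X. lra. }
  specialize (G n (le_n n)). rewrite H1, H2 in G.
  rewrite arclen_4, arclen_1 in G by lra. rewrite three_div_sqrt3 in G. unfold L0. lra.
Qed.

Lemma C0_length_le : path_length C0 <= L0.
Proof. apply path_length_spec; [simpl; lra|]. apply C0_inscribed. Qed.

(** * Admissibility of the optimal path *)

(** The directions from [-PI/6] to [PI/6] are hit on the first segment, those up to [4
    PI/3] at their own contact points on the arc, and those of the last quarter turn on
    the last segment, at the distance [tan (f / 2) = sin f / (1 + cos f)] from E. *)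
Lemma C0_hits a : exists t, 0 <= t <= 4 /\ tangent a (C0 t).
Proof.
  assert (Hpi := PI_RGT_0). assert (Hs := sqrt3_bound).
  destruct (angle_lift (- PI/6) a) as (b & Hb & Eb). unfold tangent. rewrite <- Eb. clear Eb a.
  destruct (Rle_dec b (PI/6)) as [H1|H1]; [|destruct (Rle_dec b (4 * PI/3)) as [H2|H2]].
  - assert (Hc : sqrt 3 / 2 <= cos b).
    { rewrite <- cos_PI6. destruct (Rle_dec 0 b).
      - apply cos_decr_1; lra.
      - rewrite <- (cos_neg b). apply cos_decr_1; lra. }
    assert (0 < cos b) by lra.
    exists (sqrt 3 / 2 / cos b).
    assert (0 <= sqrt 3 / 2 / cos b <= 1).
    { split.
      - apply Rlt_le, Rdiv_lt_0_compat; lra.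
      - apply Rmult_le_reg_r with (cos b); [easy|]. unfold Rdiv at 1. rewrite Rmult_assoc, Rinv_l; lra. }
    split; [lra|]. rewrite C0_1 by easy. unfold dot, e; simpl. field. lra.
  - set (t := 2 + (b - PI/6) / (7 * PI / 6)). exists t.
    assert (Ht : 2 <= t <= 3).
    { assert (0 <= (b - PI/6) / (7 * PI / 6) <= 1); [|unfold t; lra]. split.
      - apply Rdiv_le_0_compat; lra.
      - apply Rmult_le_reg_r with (7 * PI / 6); [lra|].
        replace ((b - PI / 6) / (7 * PI / 6) * (7 * PI / 6)) with (b - PI/6) by (field; lra). lra. }
    split; [lra|]. rewrite C0_3 by easy. rewrite dot_e_e.
    replace (PI / 6 + (t - 2) * (7 * PI / 6) - b) with 0 by (unfold t; field; lra). apply cos_0.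
  - set (f := b - 4 * PI / 3). assert (Hf : 0 <= f < PI/2) by (unfold f; lra).
    assert (Hc : 0 < cos f) by (apply cos_gt_0; lra).
    assert (Hsn : 0 <= sin f) by (apply sin_ge_0; lra).
    assert (E := sin2_cos2 f). unfold Rsqr in E.
    set (s := sin f / (1 + cos f)). exists (3 + s).
    assert (Hss : 0 <= s <= 1).
    { split; [apply Rdiv_le_0_compat; lra|].
      apply Rmult_le_reg_r with (1 + cos f); [lra|]. unfold s, Rdiv. rewrite Rmult_assoc, Rinv_l by lra.
      generalize (SIN_bound f). lra. }
    split; [lra|]. rewrite C0_4 by lra. replace (3 + s - 3) with s by ring.
    transitivity (dot (e (4 * PI/3)) (e b) + s * dot (e (4 * PI/3 + PI/2)) (e b)).
    { unfold dot, e, Cplus, Cmult, RtoC; simpl. ring. }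
    rewrite !dot_e_e. replace (4 * PI / 3 - b) with (- f) by (unfold f; ring).
    replace (4 * PI / 3 + PI/2 - b) with (PI/2 - f) by (unfold f; ring).
    rewrite cos_neg, cos_shift. unfold s.
    transitivity (cos f + (sin f * sin f) / (1 + cos f)); [field; lra|].
    replace (sin f * sin f) with (1 - cos f * cos f) by lra. field. lra.
Qed.

Lemma C0_admissible : admissible C0.
Proof.
  split; [split; [|split]|split].
  - simpl; lra.
  - exact C0_continuous.
  - exists L0. intros s Hs. now apply C0_inscribed.
  - simpl lo. rewrite C0_1 by lra. unfold origin. f_equal. ring.
  - intros L HL. destruct (tangent_line_is_tangent L HL) as [a Ha].
    destruct (C0_hits a) as (t & Ht & Htt). exists t. split; [exact Ht|]. now apply Ha.
Qed.

Lemma C0_solution : is_solution C0.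
Proof.
  split; [apply C0_admissible|]. intros h Hh.
  generalize C0_length_le (length_lower_bound h Hh). lra.
Qed.

(** * Near equality in the calibration *)

Lemma clamp_low n m t : t <= n <= m -> clamp n m t = n.
Proof. intros H. unfold clamp, Rmin, Rmax. repeat destruct Rle_dec; lra. Qed.
Lemma clamp_high n m t : n <= m <= t -> clamp n m t = m.
Proof. intros H. unfold clamp, Rmin, Rmax. repeat destruct Rle_dec; lra. Qed.

(** The calibration for a chain hit with tolerance [r]: [chain_bound] in the window from
    [k + PI/3] to [m], preceded by the initial bound of [Phi]. *)
Lemma chain_start r k c s m : 0 <= r -> chain r k c s -> c <> [] -> k + PI/3 <= m <= s ->
  sqrt 3 * r + r * (m - k - PI/3) + dot (last c origin) (e (m + PI/2)) <= plen origin c.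
Proof.
  intros Hr Hc Hne Hm. assert (Hpi := PI_RGT_0).
  destruct c as [|b c]; [easy|].
  assert (X := chain_bound r k (b :: c) s Hr Hc (k + PI/3) m b ltac:(lra)).
  rewrite clamp_high, clamp_low in X by lra. simpl plen in X |- *. rewrite edist_refl in X.
  rewrite last_cons in X |- *. rewrite edist_origin.
  assert (Hb : hit r b k) by now inversion Hc. unfold hit in Hb.
  assert (B := dot_le_Cmod (e (k + PI/6)) b (dot_e_unit _)).
  replace (k + PI/3 + PI/2) with (k + (PI - PI/6)) in X by field.
  rewrite (dot_add b k (PI - PI/6)) in X. rewrite dot_add in B.
  rewrite cos_minus, sin_minus, cos_PI, sin_PI in X. rewrite cos_PI6, sin_PI6 in *.
  assert (Hs := sqrt3_bound). nra.
Qed.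

Lemma chain_end r t p c s F m n : 0 <= r -> chain r t (p :: c) s -> t <= n <= m -> m <= s ->
  dot F (e (m + PI/2)) - dot p (e (n + PI/2)) + r * (m - n) <= plen p (c ++ [F]).
Proof.
  intros Hr Hc Hn Hm.
  assert (X := chain_bound r t (p :: c) s Hr Hc n m p ltac:(lra)).
  rewrite clamp_high, clamp_low in X by lra. simpl plen in X. rewrite edist_refl, last_cons in X.
  rewrite plen_snoc.
  assert (B := dot_le_edist (e (m + PI/2)) (last c p) F (dot_e_unit _)). lra.
Qed.

(** In a sweep whose length exceeds [L0] by at most [d / 2], every inequality of the
    calibration is almost an equality. This yields the data from which the positions of
    the points are recovered: the corner [b] by its almost extremal initial bound, and
    for each direction [k + f] a point that loses hardly more than the turning angle and
    is not too far from the last point. *)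
Lemma end_estimates (d r y0 k s : R) (c : list C) (F : C) :
  0 < d <= 1 -> 0 <= r <= 1 -> 0 < y0 <= PI/4 -> 24 * y0 + 7 * (1 - r) <= d / 2 ->
  c <> [] -> chain r k c s -> k + 3 * PI / 2 - y0 <= s -> hit r F k ->
  plen origin (c ++ [F]) <= L0 + d / 2 ->
  (exists b, In b c /\ hit r b k /\ Cmod b <= 11 /\ Cmod b - dot b (e (k + PI/3 + PI/2)) <= sqrt 3 + d) /\
  (forall f, PI/3 <= f <= 3 * PI/2 - y0 -> exists p, In p c /\ hit r p (k + f) /\
    (forall m n, PI/3 <= m <= f -> f <= n <= 3 * PI/2 - y0 ->
       dot p (e (k + m + PI/2)) - dot p (e (k + n + PI/2)) <= n - m + d) /\
    edist p F + dot p (e (k + f + PI/2)) <= 1 + 3 * PI/2 - f + d).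
Proof.
  intros Hd Hr Hy Hdr Hne Hc Hs HF Hlen.
  assert (Hpi := PI_RGT_0). assert (Hpi2 := PI_lt_315). assert (Hs3 := sqrt3_bound).
  assert (HL := L0_lt_9).
  assert (Hpos := plen_pos origin (c ++ [F])).
  set (s1 := k + 3 * PI/2 - y0) in *.
  assert (HFn : Cmod F <= 11).
  { rewrite <- edist_origin. generalize (edist_last_plen origin (c ++ [F])). rewrite last_snoc. lra. }
  assert (HFd : r - 22 * y0 <= dot F (e (s1 + PI/2))).
  { replace (s1 + PI/2) with (k + (- y0) + 2 * PI) by (unfold s1; field).
    rewrite e_2PI, dot_add, cos_neg, sin_neg. unfold hit in HF.
    assert (A1 := dot_le_Cmod (e k) F (dot_e_unit _)).
    assert (A2 := dot_le_Cmod (e (k + PI/2)) F (dot_e_unit _)).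
    assert (A3 := cos_lower y0). assert (A4 := sin_lt_x y0 ltac:(lra)).
    assert (A5 : 0 <= sin y0) by (apply sin_ge_0; lra).
    assert (A6 : cos y0 <= 1) by apply COS_bound.
    assert (1 - cos y0 <= y0) by nra.
    assert ((1 - cos y0) * dot F (e k) <= 11 * y0) by nra.
    assert (sin y0 * dot F (e (k + PI/2)) <= 11 * y0) by nra. nra. }
  assert (Hlen2 : plen origin (c ++ [F]) <= 1 + sqrt 3 + 7 * PI/6 + d / 2) by exact Hlen.
  split.
  - destruct c as [|b c]; [easy|]. exists b.
    assert (Hb : hit r b k) by now inversion Hc.
    split; [now left|]. split; [easy|].
    simpl app in *. simpl plen in *. rewrite edist_origin in *.
    assert (X := chain_end r k b c s F s1 (k + PI/3) ltac:(lra) Hc ltac:(unfold s1; lra) ltac:(easy)).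
    assert (P := plen_pos b (c ++ [F])). split; [lra|].
    assert (G0 : r * (s1 - (k + PI/3)) = (s1 - (k + PI/3)) - (1 - r) * (s1 - (k + PI/3))) by ring.
    assert ((1 - r) * (s1 - (k + PI/3)) <= (1 - r) * 4) by (apply Rmult_le_compat_l; unfold s1; lra).
    unfold s1 in *. lra.
  - intros f Hf.
    destruct (chain_split r k c s (k + f) ltac:(lra) Hc Hne ltac:(unfold s1 in *; lra))
      as (c1 & p & c2 & E & H1 & H2 & H3).
    exists p. split; [rewrite E; apply in_or_app; right; now left|]. split; [easy|].
    assert (Hlen3 : plen origin (c1 ++ [p]) + plen p (c2 ++ [F]) <= 1 + sqrt 3 + 7 * PI/6 + d / 2).
    { assert (EE : c ++ [F] = (c1 ++ [p]) ++ (c2 ++ [F])) by (rewrite E, <- !app_assoc; easy).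
      rewrite EE, plen_app, last_snoc in Hlen2. easy. }
    assert (St : forall m, PI/3 <= m <= f ->
      sqrt 3 - (1 - r) * 2 + (m - PI/3) - (1 - r) * 4 + dot p (e (k + m + PI/2)) <= plen origin (c1 ++ [p])).
    { intros m Hm.
      assert (X := chain_start r k (c1 ++ [p]) (k + f) (k + m) ltac:(lra) H1 (snoc_not_nil _ _) ltac:(lra)).
      rewrite last_snoc in X.
      assert ((1 - r) * sqrt 3 <= (1 - r) * 2) by (apply Rmult_le_compat_l; lra).
      assert (G0 : r * (k + m - k - PI/3) = (m - PI/3) - (1 - r) * (m - PI/3)) by field.
      assert ((1 - r) * (m - PI/3) <= (1 - r) * 4) by (apply Rmult_le_compat_l; lra). lra. }
    split.
    + intros m n Hm Hn. specialize (St m Hm).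
      assert (X := chain_end r (k + f) p c2 s F s1 (k + n) ltac:(lra) H2 ltac:(unfold s1; lra) ltac:(easy)).
      assert (G1 : r * (s1 - (k+n)) = (s1 - (k + n)) - (1 - r) * (3 * PI/2 - y0 - n)) by (unfold s1; field).
      (* the two ranges of angles add up to less than 3.7 *)
      assert (X0 := chain_start r k (c1 ++ [p]) (k + f) (k + m) ltac:(lra) H1 (snoc_not_nil _ _) ltac:(lra)).
      rewrite last_snoc in X0.
      assert (G2 : r * (k + m - k - PI/3) = (m - PI/3) - (1 - r) * (m - PI/3)) by field.
      assert ((1 - r) * sqrt 3 <= (1 - r) * 1.75) by (apply Rmult_le_compat_l; lra).
      assert ((1 - r) * (m - PI/3 + (3 * PI/2 - y0 - n)) <= (1 - r) * 3.7) by (apply Rmult_le_compat_l; lra).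
      unfold s1 in *. lra.
    + specialize (St f ltac:(lra)).
      assert (Y := edist_last_plen p (c2 ++ [F])). rewrite last_snoc in Y. lra.
Qed.

(** * Recognising B, the arc and F *)

(** Pythagoras in the orthonormal frame of the direction [t]. *)
Lemma edist_frame (p q : C) (t : R) :
  edist p q * edist p q = (dot q (e t) - dot p (e t)) * (dot q (e t) - dot p (e t)) +
   (dot q (e (t + PI/2)) - dot p (e (t + PI/2))) * (dot q (e (t + PI/2)) - dot p (e (t + PI/2))).
Proof.
  rewrite edist_sqr, e_half. unfold dot, e; simpl.
  generalize (sin2_cos2 t). unfold Rsqr. intros E.
  transitivity (((fst q - fst p) * (fst q - fst p) + (snd q - snd p) * (snd q - snd p)) * (sin t * sin t + cos t * cos t));
  [rewrite E|]; ring.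
Qed.

Lemma Cmod_frame (p : C) (t : R) :
  Cmod p * Cmod p = dot p (e t) * dot p (e t) + dot p (e (t + PI/2)) * dot p (e (t + PI/2)).
Proof.
  rewrite <- edist_origin, (edist_frame origin p t). unfold dot at 2 4 6 8, origin; simpl. ring.
Qed.

Lemma edist_le_of_frame (p q : C) (t a b : R) : 0 <= a -> 0 <= b ->
  Rabs (dot q (e t) - dot p (e t)) <= a -> Rabs (dot q (e (t + PI/2)) - dot p (e (t + PI/2))) <= b ->
  edist p q <= a + b.
Proof.
  intros Ha Hb H1 H2. apply Rsqr_incr_0_var; [|lra]. unfold Rsqr.
  rewrite (edist_frame p q t).
  assert (A : forall x c, Rabs x <= c -> x * x <= c * c).
  { intros x c0 Hx. assert (Hx' := Rabs_pos x).
    replace (x * x) with (Rabs x * Rabs x). nra. rewrite <- Rabs_mult. apply Rabs_pos_eq. nra. }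
  apply A in H1. apply A in H2. nra.
Qed.

(** The copy of the corner B of the optimal path rotated by [k + PI/6]: the optimal path
    itself has [k = -PI/6], its first tangent direction. *)
Definition Bk (k : R) : C := dilate (2 / sqrt 3) (e (k + PI/6)).
(** The copy of the end point F, with E at the direction [k + 3 PI/2]. *)
Definition Fk (k : R) : C := (e (k + 3 * PI/2) + e k)%C.

(** The hypothesis almost turns both inequalities of the initial bound into equalities:
    [b] has the direction [k + PI/6], and it lies on the tangent at [k]. *)
Lemma near_B (eta d r k : R) (b : C) : 0 < eta <= 1 -> 0 < d -> 2000 * d <= eta * eta -> 1 - d <= r ->
  hit r b k -> Cmod b <= 11 -> Cmod b - dot b (e (k + PI/3 + PI/2)) <= sqrt 3 + d ->
  edist b (Bk k) <= eta.
Proof.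
  intros He Hd Hde Hr Hk Hb H. assert (Hs3 := sqrt3_bound). assert (Hs := sqrt3_sqr).
  unfold hit in Hk.
  set (t := k + PI/6) in *.
  replace (k + PI/3 + PI/2) with (t + 2 * (PI/3)) in H by (unfold t; field).
  replace k with (t + - (PI/6)) in Hk by (unfold t; ring).
  rewrite dot_add in H, Hk. rewrite cos_neg, sin_neg, cos_PI6, sin_PI6 in Hk.
  replace (2 * (PI/3)) with (PI - PI/3) in H by field.
  rewrite cos_minus, sin_minus, cos_PI, sin_PI, cos_PI3, sin_PI3 in H.
  assert (M := Cmod_frame b t).
  assert (N := dot_le_Cmod (e t) b (dot_e_unit _)).
  assert (Q1 : dot (Bk k) (e t) = 2 / sqrt 3).
  { unfold Bk. rewrite dot_dilate. fold t. rewrite dot_e_e. replace (t - t) with 0 by ring. rewrite cos_0. ring. }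
  assert (Q2 : dot (Bk k) (e (t + PI/2)) = 0).
  { unfold Bk. rewrite dot_dilate. fold t. rewrite dot_e_e. replace (t - (t + PI/2)) with (- (PI/2)) by ring.
    rewrite cos_neg, cos_PI2. ring. }
  assert (Hi : sqrt 3 * (2 / sqrt 3) = 2) by (field; lra).
  set (q := 2 / sqrt 3) in *.
  set (n := dot b (e t)) in *. set (w := dot b (e (t + PI/2))) in *.
  assert (E1 : Cmod b - n <= 3 * d) by nra.
  assert (E2 : w * w <= 66 * d) by nra.
  assert (E3 : Rabs w <= eta / 4).
  { apply Rabs_le. split; nra. }
  assert (E4 := Rle_abs w). assert (E5 := Rle_abs (- w)). rewrite Rabs_Ropp in E5.
  replace eta with (eta / 2 + eta / 2) by field.
  apply edist_le_of_frame with t; try lra.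
  - rewrite Q1. fold n. apply Rabs_le. split; nra.
  - rewrite Q2. fold w. replace (0 - w) with (- w) by ring. rewrite Rabs_Ropp. lra.
Qed.

Lemma sin_cube (x : R) : 0 <= x <= 1 -> x - x * x * x / 6 <= sin x.
Proof.
  intros H. destruct (sin_bound x 0) as [H1 _]; [lra|generalize PI2_3_2; lra|].
  unfold sin_approx, sin_term in H1. simpl in H1. lra.
Qed.

Lemma cos_quartic (x : R) : 0 <= x <= 1 -> cos x <= 1 - x * x / 2 + x * x * x * x / 24.
Proof.
  intros H. destruct (cos_bound x 0) as [_ H1]; [generalize PI2_3_2; lra|generalize PI2_3_2; lra|].
  unfold cos_approx, cos_term in H1. simpl in H1. lra.
Qed.

(** With [n] and [w] the coordinates of [p] in the frame at [t], the two hypotheses read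
    [n sin x + w (1 - cos x) <= x + d] and [n sin x - w (1 - cos x) <= x + d]. With [n
    >= 1 - d] their sum bounds [n] above, and each of them bounds [w]. *)
Lemma near_arc (x d r t : R) (p : C) : 0 < x <= 1 -> 0 < d -> 20 * d <= x * x * x -> 1 - d <= r ->
  hit r p t ->
  dot p (e (t + PI/2)) - dot p (e (t + x + PI/2)) <= x + d ->
  dot p (e (t - x + PI/2)) - dot p (e (t + PI/2)) <= x + d ->
  edist p (e t) <= 2 * x.
Proof.
  intros Hx Hd Hdx Hr Hp H1 H2. unfold hit in Hp.
  replace (t + x + PI/2) with ((t + PI/2) + x) in H1 by ring.
  replace (t - x + PI/2) with ((t + PI/2) + - x) in H2 by ring.
  rewrite (dot_add p (t + PI/2) x) in H1. rewrite (dot_add p (t + PI/2) (- x)) in H2.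
  rewrite cos_neg, sin_neg in H2.
  replace (t + PI/2 + PI/2) with (t + PI) in H1, H2 by field.
  rewrite (dot_add p t PI) in H1, H2. rewrite cos_PI, sin_PI in H1, H2.
  assert (S1 := sin_cube x ltac:(lra)). assert (C1 := cos_quartic x ltac:(lra)).
  assert (S2 := sin_lt_x x ltac:(lra)).
  set (n := dot p (e t)) in *. set (w := dot p (e (t + PI/2))) in *.
  assert (Hx2 : 0 < x * x <= x) by nra.
  assert (Hx3 : 0 < x * x * x <= x * x) by nra.
  assert (Hx4 : 0 < x * x * x * x <= x * x * x) by nra.
  assert (Cq : 0.45 * (x * x) <= 1 - cos x) by lra.
  assert (Sq : 0.8 * x <= sin x) by lra.
  assert (Nw : n * sin x <= x + d) by lra.
  assert (Nl : sin x - d <= n * sin x) by nra.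
  assert (W1 : w * (1 - cos x) <= 0.45 * (x * x) * x) by lra.
  assert (W2 : - w * (1 - cos x) <= 0.45 * (x * x) * x) by lra.
  assert (Ww : Rabs w <= x).
  { apply Rabs_le. split.
    - apply Rnot_lt_le. intros Hlt. assert (- w * (0.45 * (x * x)) <= - w * (1 - cos x)) by nra. nra.
    - apply Rnot_lt_le. intros Hlt. assert (w * (0.45 * (x * x)) <= w * (1 - cos x)) by nra. nra. }
  assert (Nn : Rabs (1 - n) <= x).
  { apply Rabs_le. split; [|lra].
    apply Rnot_lt_le. intros Hlt. assert ((1 + x) * sin x <= n * sin x) by nra. nra. }
  replace (2 * x) with (x + x) by ring.
  apply edist_le_of_frame with t; try lra; rewrite dot_e_e.
  - replace (t - t) with 0 by ring. rewrite cos_0. exact Nn.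
  - replace (t - (t + PI/2)) with (- (PI/2)) by ring. rewrite cos_neg, cos_PI2. fold w.
    replace (0 - w) with (- w) by ring. now rewrite Rabs_Ropp.
Qed.

(** The disc of radius [1] around E touches the tangent at [k] only in F. *)
Lemma near_F (eta z r k : R) (F : C) : 0 < eta <= 1 -> 0 < z -> 6 * z <= eta * eta -> 1 - z <= r ->
  hit r F k -> edist (e (k + 3 * PI/2)) F <= 1 + z -> edist F (Fk k) <= eta.
Proof.
  intros He Hz Hze Hr HF H. unfold hit in HF.
  assert (Hsq := edist_frame (e (k + 3 * PI/2)) F k).
  rewrite !dot_e_e in Hsq.
  replace (k + 3 * PI/2 - k) with (3 * (PI/2)) in Hsq by field.
  replace (k + 3 * PI/2 - (k + PI/2)) with PI in Hsq by field.
  rewrite cos_3PI2, cos_PI in Hsq.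
  assert (H0 := edist_pos (e (k + 3 * PI/2)) F).
  apply Rsqr_incr_0_var; [|lra]. unfold Rsqr. rewrite (edist_frame F (Fk k) k).
  assert (Q1 : dot (Fk k) (e k) = 1).
  { transitivity (dot (e (k + 3 * PI/2)) (e k) + dot (e k) (e k)); [unfold dot, Fk, Cplus; simpl; ring|].
    rewrite !dot_e_e. replace (k + 3 * PI/2 - k) with (3 * (PI/2)) by field.
    replace (k - k) with 0 by ring. rewrite cos_3PI2, cos_0. ring. }
  assert (Q2 : dot (Fk k) (e (k + PI/2)) = -1).
  { transitivity (dot (e (k + 3 * PI/2)) (e (k + PI/2)) + dot (e k) (e (k + PI/2))); [unfold dot, Fk, Cplus; simpl; ring|].
    rewrite !dot_e_e. replace (k + 3 * PI/2 - (k + PI/2)) with PI by field.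
    replace (k - (k + PI/2)) with (- (PI/2)) by ring. rewrite cos_neg, cos_PI, cos_PI2. ring. }
  rewrite Q1, Q2.
  set (X := dot F (e k)) in *. set (Y := dot F (e (k + PI/2))) in *.
  assert (Z1 : z <= 1/6) by nra.
  assert (X * X + (Y + 1) * (Y + 1) <= (1 + z) * (1 + z)) by nra.
  nra.
Qed.

Definition near_list (eta k : R) (l : list C) : Prop :=
  (exists p, In p l /\ edist p (Bk k) <= eta) /\
  (exists p, In p l /\ edist p (Fk k) <= eta) /\
  (forall f, PI/3 + eta <= f <= 3 * PI/2 - eta -> exists p, In p l /\ edist p (e (k + f)) <= eta).

(** Combines [end_estimates] with the three recognition lemmas. The tolerances are
    multiples of powers of [eta]. *)
Lemma near_targets (eta : R) : 0 < eta <= 1/10 -> exists r y0 ep, 0 <= r < 1 /\ 0 < y0 <= PI/4 /\ 0 < ep /\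
  forall l, Sweep r y0 l -> plen origin l <= L0 + ep -> exists k, near_list eta k l.
Proof.
  intros He. assert (Hpi := PI_RGT_0). assert (Hpi2 := PI_lt_315). assert (Hpi3 := PI2_3_2).
  set (x := eta * eta / 100).
  assert (Hx : 0 < x) by (unfold x; nra).
  assert (Hx2 : x <= eta / 1000) by (unfold x; nra).
  assert (Hxe : 100 * x = eta * eta) by (unfold x; field).
  clearbody x.
  (* [near_arc] recognises a point at distance [2 x] from a surplus of order [x ^ 3]. *)
  set (d := x * x * x / 20).
  assert (Hxx : x * x <= x / 100) by nra.
  assert (Hxxx : 0 < x * x * x <= x / 10000).
  { split; [repeat apply Rmult_lt_0_compat; easy|].
    apply Rle_trans with (x / 100 * x); [apply Rmult_le_compat_r; lra|lra]. }
  assert (Hd : 0 < d) by (unfold d; lra).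
  assert (Hd1 : 20 * d = x * x * x) by (unfold d; field).
  (* These values satisfy the budget [24 y0 + 7 (1 - r) <= d / 2] of [end_estimates]. *)
  exists (1 - d / 24), (d / 200), (d / 2).
  split; [lra|]. split; [lra|]. split; [lra|].
  intros l (k & c & F & s & H1 & H2 & H3 & H4 & H5 & H6) Hl.
  exists k.
  destruct (end_estimates d (1 - d/24) (d/200) k s c F) as [(b & B1 & B2 & B3 & B4) HA]; try easy; try lra.
  assert (Arc : forall f y, 0 < y <= 1 -> x <= y -> PI/3 + y <= f <= 3 * PI/2 - 2 * y -> exists p, In p c /\ edist p (e (k + f)) <= 2 * y /\
     edist p F + dot p (e (k + f + PI/2)) <= 1 + 3 * PI/2 - f + d).
  { intros f y Hy Hxy Hf. destruct (HA f) as (p & P1 & P2 & P3 & P4); [lra|].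
    exists p. split; [easy|]. split; [|easy].
    assert (x * x * x <= y * y * y). { assert (x * x <= y * y) by nra. nra. }
    apply near_arc with d (1 - d / 24); try easy; try lra.
    - replace (k + f + y) with (k + (f + y)) by ring.
      assert (T := P3 f (f + y) ltac:(lra) ltac:(lra)). lra.
    - replace (k + f - y) with (k + (f - y)) by ring.
      assert (T := P3 (f - y) f ltac:(lra) ltac:(lra)). lra. }
  split; [|split].
  - exists b. split; [apply H5; apply in_or_app; now left|].
    apply near_B with d (1 - d/24); try easy; try lra.
  - exists F. split; [apply H5; apply in_or_app; right; now left|].
    destruct (Arc (3 * PI/2 - 2 * x) x) as (p & P1 & P2 & P3); try lra.
    set (f := 3 * PI/2 - 2 * x) in *.
    apply near_F with (12 * x) (1 - d/24); try easy; try lra.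
    assert (T1 := dot_le_edist (e (k + f + PI/2)) p (e (k + f)) (dot_e_unit _)).
    rewrite dot_e_e in T1. replace (k + f - (k + f + PI/2)) with (- (PI/2)) in T1 by ring.
    rewrite cos_neg, cos_PI2 in T1.
    assert (T2 := edist_tri (e (k + 3 * PI/2)) p F).
    assert (T3 := edist_tri (e (k + 3 * PI/2)) (e (k + f)) p).
    assert (T4 := edist_e_le (k + f) (k + 3 * PI/2) ltac:(unfold f; lra)).
    rewrite (edist_sym (e (k + f)) p), (edist_sym (e (k + 3 * PI/2)) (e (k + f))) in T3.
    unfold f in *. lra.
  - intros f Hf. destruct (Arc f (eta / 2)) as (p & P1 & P2 & _); try lra.
    exists p. split; [apply H5; apply in_or_app; now left|]. lra.
Qed.

(** * A copy of B, of the arc and of F in every solution *)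

Definition near_curve (eta k a b : R) (h : R -> C) : Prop :=
  (exists t, a <= t <= b /\ edist (h t) (Bk k) <= eta) /\
  (exists t, a <= t <= b /\ edist (h t) (Fk k) <= eta) /\
  (forall f, PI/3 + eta <= f <= 3 * PI/2 - eta -> exists t, a <= t <= b /\ edist (h t) (e (k + f)) <= eta).

(** The sense of rotation of a solution is not known in advance. *)
Definition mirror (cj : bool) (p : C) : C := if cj then Cconj p else p.

Lemma edist_mirror cj p q : edist (mirror cj p) (mirror cj q) = edist p q.
Proof. destruct cj; [apply edist_conj|easy]. Qed.

(** The lower bound for lists is applied to a dilated sample of the curve. Its length is
    almost [L0], so the surplus alternative is excluded and a sweep remains. *)
Lemma approximate_targets (g : curve) (eta : R) : admissible g -> path_length g <= L0 ->
  0 < eta <= 1/10 -> exists cj k, near_curve (2 * eta) k (lo g) (hi g) (fun t => mirror cj (g t)).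
Proof.
  intros Hg Hlen He.
  destruct (near_targets eta He) as (r & y0 & ep & Hr & Hy & Hep & HN).
  destruct (tuned_exists r y0 Hr Hy) as [d Hd].
  assert (Hd0 : 0 < d) by (unfold tuned in Hd; lra).
  assert (Hd1 : d <= 1/10) by (unfold tuned in Hd; lra).
  set (m := Rmin ep (d / 2)).
  assert (Hm : 0 < m) by (apply Rmin_glb_lt; lra).
  assert (Hm1 : m <= ep) by apply Rmin_l. assert (Hm2 : m <= d / 2) by apply Rmin_r.
  (* Points and lengths are at most [10], so the dilation by [1 / (1 - eps)] moves
     points by at most [eta] and lengthens the sample by less than [m]. *)
  set (eps := Rmin (m / 40) (eta / 40)).
  assert (Heps : 0 < eps) by (apply Rmin_glb_lt; lra).
  assert (He1 : eps <= m / 40) by apply Rmin_l. assert (He2 : eps <= eta / 40) by apply Rmin_r.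
  assert (HL := L0_lt_9).
  destruct (sample g eps Hg Heps) as (ts & T1 & T2).
  assert (Hp := polygon_le_length g ts (proj1 Hg) T1).
  rewrite (proj1 (proj2 Hg)) in Hp.
  set (q := / (1 - eps)).
  assert (Hq : q * (1 - eps) = 1) by (unfold q; field; lra).
  assert (Hq0 : 0 < q) by (apply Rinv_0_lt_compat; lra).
  clearbody q.
  assert (Hq3 : q = 1 + q * eps) by lra.
  assert (Hq4 : q * eps <= q * (1/2)) by (apply Rmult_le_compat_l; lra).
  assert (Hq5 : 0 <= q * eps) by (apply Rmult_le_pos; lra).
  assert (Hq6 : q * eps <= 2 * eps) by (apply Rmult_le_compat_r; lra).
  assert (Hq1 : 1 <= q <= 1 + 2 * eps) by lra.
  set (S := map (dilate q) (map g ts)).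
  assert (HS : hits_all S).
  { intros a. destruct (T2 a) as (t & U1 & U2).
    exists (dilate q (g t)). split; [now repeat apply in_map|].
    unfold hit. rewrite dot_dilate. apply Rle_trans with (q * (1 - eps)); [lra|].
    apply Rmult_le_compat_l; lra. }
  assert (HSl : plen origin S <= L0 + m).
  { unfold S. rewrite <- (dilate_origin q), plen_dilate by lra.
    assert (P := plen_pos origin (map g ts)). nra. }
  destruct (short_list_sweeps d r y0 S Hd HS ltac:(lra)) as (l & L1 & L2 & _ & L3).
  destruct L3 as [L3|L3]; [lra|].
  assert (Hpt : forall p, In p S -> exists t, lo g <= t <= hi g /\ edist (g t) p <= eta).
  { intros p Hpin. unfold S in Hpin. apply in_map_iff in Hpin. destruct Hpin as (x & <- & Hx).
    apply in_map_iff in Hx. destruct Hx as (t & <- & Ht).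
    assert (Htr := incr_In _ _ _ _ T1 Ht). exists t. split; [easy|].
    assert (Hgt : Cmod (g t) <= 10).
    { assert (X := polygon_le_length g [t] (proj1 Hg)). simpl in X.
      rewrite (proj1 (proj2 Hg)), edist_origin in X. specialize (X ltac:(lra)). lra. }
    unfold edist. replace (dilate q (g t) - g t)%C with (RtoC (q - 1) * g t)%C.
    - rewrite Cmod_mult, Cmod_R, Rabs_pos_eq by lra. assert (Y := Cmod_ge_0 (g t)). nra.
    - destruct (g t); unfold dilate, Cminus, Cmult, Cplus, Copp, RtoC; simpl; f_equal; ring. }
  assert (Main : forall cj k, near_list eta k (map (mirror cj) l) ->
     near_curve (2 * eta) k (lo g) (hi g) (fun t => mirror cj (g t))).
  { intros cj k (N1 & N2 & N3).
    assert (Tr : forall X, (exists p, In p (map (mirror cj) l) /\ edist p X <= eta) ->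
       exists t, lo g <= t <= hi g /\ edist (mirror cj (g t)) X <= 2 * eta).
    { intros X (p & P1 & P2). apply in_map_iff in P1. destruct P1 as (p' & <- & P1).
      destruct (Hpt p' (L1 _ P1)) as (t & Q1 & Q2). exists t. split; [easy|].
      rewrite <- (edist_mirror cj) in Q2. generalize (edist_tri (mirror cj (g t)) (mirror cj p') X). lra. }
    split; [now apply Tr|]. split; [now apply Tr|]. intros f Hf. apply Tr, N3. lra. }
  destruct L3 as [L3|L3].
  - destruct (HN l L3 ltac:(lra)) as [k Hk]. exists false, k. apply Main.
    replace (map (mirror false) l) with l; [easy|]. symmetry. apply map_id.
  - assert (X := HN _ L3). rewrite plen_conj in X. destruct (X ltac:(lra)) as [k Hk].
    exists true, k. now apply Main.
Qed.

Lemma near_curve_weaken eta eta' k a b h : eta <= eta' -> near_curve eta k a b h -> near_curve eta' k a b h.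
Proof.
  intros H ((t1 & A1 & A2) & (t2 & B1 & B2) & N3). split; [|split].
  - exists t1. split; [easy|lra].
  - exists t2. split; [easy|lra].
  - intros f Hf. destruct (N3 f ltac:(lra)) as (t & C1 & C2). exists t. split; [easy|lra].
Qed.

Lemma e_add_eq a b c : e a = e b -> e (a + c) = e (b + c).
Proof.
  unfold e. intros H. injection H as H1 H2. rewrite !cos_plus, !sin_plus, H1, H2. easy.
Qed.

Lemma near_curve_shift eta k k' a b h : e k = e k' -> near_curve eta k a b h -> near_curve eta k' a b h.
Proof.
  intros H (N1 & N2 & N3). unfold near_curve, Bk, Fk in *.
  rewrite <- (e_add_eq _ _ (PI/6) H), <- (e_add_eq _ _ (3 * PI/2) H), <- H. split; [easy|split; [easy|]].
  intros f Hf. rewrite <- (e_add_eq _ _ f H). now apply N3.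
Qed.

Lemma edist_e_abs (a b : R) : edist (e a) (e b) <= Rabs (b - a).
Proof.
  unfold Rabs. destruct Rcase_abs.
  - rewrite edist_sym. generalize (edist_e_le b a). lra.
  - apply edist_e_le. lra.
Qed.

Lemma edist_plus (p p' q q' : C) : edist (p + q)%C (p' + q')%C <= edist p p' + edist q q'.
Proof.
  unfold edist. replace (p' + q' - (p + q))%C with ((p' - p) + (q' - q))%C by ring. apply Cmod_triangle.
Qed.

(** The rotation angles for smaller and smaller [eta] have a cluster point [k], and the
    image of the curve is closed. *)
Lemma cluster_targets (a b : R) (h : R -> C) : continuous_on (fun t => a <= t <= b) h ->
  (forall eta, 0 < eta -> exists k, near_curve eta k a b h) ->
  exists k, (exists t, a <= t <= b /\ h t = Bk k) /\ (exists t, a <= t <= b /\ h t = Fk k) /\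
    (forall f, PI/3 <= f <= 3 * PI/2 -> exists t, a <= t <= b /\ h t = e (k + f)).
Proof.
  intros Hc H. assert (Hpi := PI_RGT_0).
  assert (E : forall n : nat, exists k, 0 <= k <= 2 * PI /\ near_curve (/ (INR n + 1)) k a b h).
  { intros n. destruct (H (/ (INR n + 1))) as [k Hk].
    - apply Rinv_0_lt_compat. generalize (pos_INR n). lra.
    - destruct (angle_lift 0 k) as (k' & K1 & K2). exists k'. split; [lra|].
      now apply near_curve_shift with k. }
  apply fun_choice in E. destruct E as [kn Hkn].
  destruct (Bolzano_Weierstrass kn (fun c => 0 <= c <= 2 * PI) (compact_P3 0 (2 * PI))) as [k Hk].
  { intros n. apply Hkn. }
  exists k.
  assert (Cl : forall z, 0 < z -> exists k' eta, Rabs (k' - k) < z /\ 0 < eta < z /\ near_curve eta k' a b h).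
  { intros z Hz. destruct (archimed_cor1 z Hz) as (N & N1 & N2).
    destruct (Hk (fun x => Rabs (x - k) < z) N) as (p & P1 & P2).
    { exists (mkposreal z Hz). intros x Hx. exact Hx. }
    exists (kn p), (/ (INR p + 1)). split; [easy|]. split; [|apply Hkn].
    assert (0 < INR N) by (apply lt_0_INR; lia).
    apply le_INR in P1. split; [apply Rinv_0_lt_compat; lra|].
    apply Rle_lt_trans with (/ INR N); [|easy]. apply Rinv_le_contravar; lra. }
  assert (Clo : forall X, (forall z, 0 < z -> exists t, a <= t <= b /\ edist (h t) X < z) ->
     exists t, a <= t <= b /\ h t = X).
  { intros X HX. apply NNPP. intros HN.
    destruct (closed_image a b h X Hc) as (z & Z1 & Z2).
    - intros t Ht E. apply HN. now exists t.
    - destruct (HX z Z1) as (t & T1 & T2). specialize (Z2 t T1). lra. }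
  assert (Hs := inv_sqrt3).
  split; [|split].
  - apply Clo. intros z Hz. destruct (Cl (z / 4) ltac:(lra)) as (k' & eta & K1 & K2 & (N1 & _ & _)).
    destruct N1 as (t & T1 & T2). exists t. split; [easy|].
    assert (edist (Bk k') (Bk k) <= 2 * Rabs (k' - k)).
    { unfold Bk. rewrite edist_dilate by (unfold Rdiv in *; lra).
      assert (X := edist_e_abs (k' + PI/6) (k + PI/6)).
      replace (k + PI/6 - (k' + PI/6)) with (- (k' - k)) in X by ring. rewrite Rabs_Ropp in X.
      assert (2 / sqrt 3 <= 2) by (unfold Rdiv in *; lra).
      generalize (edist_pos (e (k' + PI/6)) (e (k + PI/6))). nra. }
    generalize (edist_tri (h t) (Bk k') (Bk k)). lra.
  - apply Clo. intros z Hz. destruct (Cl (z / 4) ltac:(lra)) as (k' & eta & K1 & K2 & (_ & N1 & _)).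
    destruct N1 as (t & T1 & T2). exists t. split; [easy|].
    assert (edist (Fk k') (Fk k) <= 2 * Rabs (k' - k)).
    { unfold Fk. assert (X := edist_e_abs (k' + 3 * PI/2) (k + 3 * PI/2)).
      replace (k + 3 * PI/2 - (k' + 3 * PI/2)) with (- (k' - k)) in X by ring. rewrite Rabs_Ropp in X.
      assert (Y := edist_e_abs k' k). rewrite Rabs_minus_sym in Y.
      generalize (edist_plus (e (k' + 3 * PI / 2)) (e (k + 3 * PI/2)) (e k') (e k)). lra. }
    generalize (edist_tri (h t) (Fk k') (Fk k)). lra.
  - intros f Hf. apply Clo. intros z Hz.
    set (w := Rmin (z / 4) (PI / 12)).
    assert (Hw : 0 < w) by (apply Rmin_glb_lt; lra).
    assert (Hw1 : w <= z / 4) by apply Rmin_l. assert (Hw2 : w <= PI / 12) by apply Rmin_r.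
    destruct (Cl w Hw) as (k' & eta & K1 & K2 & (_ & _ & N3)).
    (* The extreme directions of the arc are only approached from inside. *)
    set (f' := clamp (PI/3 + eta) (3 * PI/2 - eta) f).
    assert (Hf' : PI/3 + eta <= f' <= 3 * PI/2 - eta /\ Rabs (f' - f) <= eta).
    { unfold f', clamp, Rmin, Rmax. repeat destruct Rle_dec; split; try lra; apply Rabs_le; lra. }
    destruct Hf' as [F1 F2].
    destruct (N3 f' F1) as (t & T1 & T2). exists t. split; [easy|].
    assert (X := edist_e_abs (k' + f') (k + f)).
    replace (k + f - (k' + f')) with (- ((k' - k) + (f' - f))) in X by ring. rewrite Rabs_Ropp in X.
    generalize (Rabs_triang (k' - k) (f' - f)) (edist_tri (h t) (e (k' + f')) (e (k + f))). lra.
Qed.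

Lemma continuous_mirror (cj : bool) (a b : R) (h : R -> C) : continuous_on (fun t => a <= t <= b) h ->
  continuous_on (fun t => a <= t <= b) (fun t => mirror cj (h t)).
Proof.
  rewrite !continuous_on_edist. intros H x Hx eps He. destruct (H x Hx eps He) as (del & H1 & H2).
  exists del. split; [easy|]. intros y Hy Hxy. rewrite edist_mirror. now apply H2.
Qed.

(** One of the two orientations occurs for arbitrarily small [eta]. *)
Lemma solution_targets (g : curve) : admissible g -> path_length g <= L0 ->
  exists cj k, (exists t, lo g <= t <= hi g /\ mirror cj (g t) = Bk k) /\
    (exists t, lo g <= t <= hi g /\ mirror cj (g t) = Fk k) /\
    (forall f, PI/3 <= f <= 3 * PI/2 -> exists t, lo g <= t <= hi g /\ mirror cj (g t) = e (k + f)).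
Proof.
  intros Hg Hlen. assert (Hc := proj1 (proj2 (proj1 Hg))).
  assert (A : forall eta, 0 < eta -> exists cj k, near_curve eta k (lo g) (hi g) (fun t => mirror cj (g t))).
  { intros eta He. set (e1 := Rmin (eta / 2) (1/10)).
    assert (0 < e1) by (apply Rmin_glb_lt; lra). assert (e1 <= eta / 2) by apply Rmin_l.
    assert (e1 <= 1/10) by apply Rmin_r.
    destruct (approximate_targets g e1 Hg Hlen ltac:(lra)) as (cj & k & Hk).
    exists cj, k. apply near_curve_weaken with (2 * e1); [lra|easy]. }
  assert (B : exists cj, forall eta, 0 < eta -> exists k, near_curve eta k (lo g) (hi g) (fun t => mirror cj (g t))).
  { destruct (classic (forall eta, 0 < eta -> exists k, near_curve eta k (lo g) (hi g) (fun t => mirror true (g t)))) as [HT|HT].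
    - now exists true.
    - exists false. apply not_all_ex_not in HT. destruct HT as [eta0 HT].
      apply imply_to_and in HT. destruct HT as [HT1 HT2].
      intros eta He. set (e1 := Rmin eta eta0).
      assert (0 < e1) by (apply Rmin_glb_lt; lra). assert (e1 <= eta) by apply Rmin_l.
      assert (e1 <= eta0) by apply Rmin_r.
      destruct (A e1) as ([|] & k & Hk); [easy| |].
      + exfalso. apply HT2. exists k. now apply near_curve_weaken with e1.
      + exists k. now apply near_curve_weaken with e1. }
  destruct B as [cj B]. exists cj. apply cluster_targets; [|easy]. now apply continuous_mirror.
Qed.

(** * The optimal path is simple *)

Lemma dot_self_ray (a s : R) (p : C) : p = (e a + RtoC s * e (a + PI/2))%C -> dot p p = 1 + s * s.
Proof.
  intros ->. rewrite e_half. unfold dot, e, Cplus, Cmult, RtoC; simpl.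
  generalize (sin2_cos2 a). unfold Rsqr. intros E.
  transitivity ((sin a * sin a + cos a * cos a) * (1 + s * s)); [ring|rewrite E; ring].
Qed.

Lemma dot_e_self a : dot (e a) (e a) = 1.
Proof. rewrite dot_e_e. replace (a - a) with 0 by ring. apply cos_0. Qed.

Lemma C0_2_norm t : 1 <= t <= 2 -> dot (C0 t) (C0 t) = 1 + (2 - t) / sqrt 3 * ((2 - t) / sqrt 3).
Proof.
  intros H. replace ((2 - t) / sqrt 3 * ((2 - t) / sqrt 3)) with
    (- ((2 - t) / sqrt 3) * - ((2 - t) / sqrt 3)) by ring.
  apply dot_self_ray with (PI/6). rewrite C0_2 by easy. unfold pointC. f_equal.
  replace (e (PI/6 + PI/2)) with (RtoC (-1) * e (PI/6 - PI/2))%C.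
  - rewrite RtoC_opp. ring.
  - rewrite e_half. unfold e. rewrite cos_minus, sin_minus, cos_PI2, sin_PI2.
    unfold Cmult, RtoC; simpl. f_equal; ring.
Qed.

Lemma C0_4_norm t : 3 <= t <= 4 -> dot (C0 t) (C0 t) = 1 + (t - 3) * (t - 3).
Proof. intros H. apply dot_self_ray with (4 * PI/3). now rewrite C0_4. Qed.

Lemma C0_2_snd t : 1 <= t <= 2 -> snd (C0 t) = (t - 1) / 2.
Proof.
  intros H. assert (Hs := sqrt3_bound). rewrite C0_2 by easy.
  unfold pointC, e, Cplus, Cmult, RtoC; simpl.
  rewrite sin_minus, cos_PI2, sin_PI2, cos_PI6, sin_PI6. field. lra.
Qed.

Lemma C0_4_snd t : 3 <= t <= 4 -> snd (C0 t) < 0.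
Proof.
  intros H. rewrite C0_4 by easy. rewrite e_half. unfold e, Cplus, Cmult, RtoC; simpl.
  replace (4 * PI/3) with (PI/3 + PI) by field. rewrite neg_sin, neg_cos, cos_PI3, sin_PI3.
  generalize sqrt3_bound. lra.
Qed.

(** Different pieces are told apart by the distance from the origin and by the signs of
    the coordinates. *)
Lemma C0_inj s t : 0 <= s <= 4 -> 0 <= t <= 4 -> C0 s = C0 t -> s = t.
Proof.
  assert (W : forall s t, 0 <= s <= t -> t <= 4 -> C0 s = C0 t -> s = t).
  2:{ intros Hs Ht E. destruct (Rle_dec s t); [apply W; try easy; lra|symmetry; apply W; try easy; lra]. }
  clear s t. intros s t Hs Ht E.
  assert (Hs3 := sqrt3_bound). assert (Hi := inv_sqrt3). assert (Hpi := PI_RGT_0).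
  assert (W33 : forall s t, 2 <= s <= t -> t <= 3 -> C0 s = C0 t -> s = t).
  { clear. intros s t Hs Ht E. rewrite !C0_3 in E by lra. assert (Hpi := PI_RGT_0).
    destruct (Req_dec s t) as [|Hne]; [easy|]. exfalso.
    assert (X := edist_e_sqr (PI / 6 + (s - 2) * (7 * PI / 6)) (PI / 6 + (t - 2) * (7 * PI / 6))).
    rewrite E, edist_refl in X.
    replace (PI / 6 + (t - 2) * (7 * PI / 6) - (PI / 6 + (s - 2) * (7 * PI / 6))) with ((t - s) * (7 * PI / 6)) in X by ring.
    assert (Hr : 0 < (t - s) * (7 * PI/6) <= 7 * PI / 6).
    { split; [apply Rmult_lt_0_compat; lra|]. rewrite <- (Rmult_1_l (7 * PI/6)) at 2.
      apply Rmult_le_compat_r; lra. }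
    assert (cos ((t - s) * (7 * PI/6)) < 1); [|lra].
    destruct (Rle_dec ((t - s) * (7 * PI/6)) PI).
    - rewrite <- cos_0. apply cos_decreasing_1; lra.
    - apply Rle_lt_trans with 0; [|lra]. apply cos_le_0; lra. }
  assert (W11 : forall s t, 0 <= s <= 1 -> 0 <= t <= 1 -> C0 s = C0 t -> s = t).
  { clear - Hs3. intros s t Hs Ht E. rewrite !C0_1 in E by lra. injection E as E.
    apply Rmult_eq_reg_l with (2 / sqrt 3); [easy|]. apply Rgt_not_eq. apply Rdiv_lt_0_compat; lra. }
  destruct (Rle_dec s 1) as [S1|S1]; [destruct (Rle_dec t 1) as [T1|T1]; [|destruct (Rle_dec t 2) as [T2|T2];
     [|destruct (Rle_dec t 3) as [T3|T3]]]|].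
  - apply W11; try easy; lra.
  - assert (X := C0_2_snd t ltac:(lra)). rewrite <- E, C0_1 in X by lra. simpl in X. lra.
  - exfalso. rewrite C0_1, C0_3 in E by lra. unfold e in E. injection E as E1 E2.
    set (th := PI/6 + (t - 2) * (7 * PI/6)) in *.
    assert (Hth : PI/6 <= th <= 4 * PI/3).
    { assert (0 <= (t - 2) * (7 * PI/6) <= 7 * PI/6); [|unfold th; lra].
      split; [apply Rmult_le_pos; lra|]. rewrite <- (Rmult_1_l (7 * PI/6)) at 2.
      apply Rmult_le_compat_r; lra. }
    destruct (Rtotal_order th PI) as [Hl|[Hq|Hg]].
    + assert (0 < sin th) by (apply sin_gt_0; lra). lra.
    + rewrite Hq, cos_PI in E1. assert (0 <= 2 / sqrt 3 * s); [|lra].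
      apply Rmult_le_pos; [|lra]. apply Rlt_le, Rdiv_lt_0_compat; lra.
    + assert (sin th < 0) by (apply sin_lt_0; lra). lra.
  - exfalso. assert (X := C0_4_snd t ltac:(lra)). rewrite <- E, C0_1 in X by lra. simpl in X. lra.
  - destruct (Rle_dec s 2) as [S2|S2]; [|destruct (Rle_dec s 3) as [S3|S3]].
    + assert (N := C0_2_norm s ltac:(lra)).
      assert (Hp : forall x, 0 <= x -> 0 <= x / sqrt 3) by (intros x Hx; apply Rdiv_le_0_compat; lra).
      assert (Hz : forall x, x / sqrt 3 = 0 -> x = 0).
      { intros x Hx. apply Rmult_eq_reg_r with (/ sqrt 3); [|apply Rinv_neq_0_compat; lra].
        rewrite Rmult_0_l. exact Hx. }
      destruct (Rle_dec t 2) as [T2|T2]; [|destruct (Rle_dec t 3) as [T3|T3]].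
      * assert (N2 := C0_2_norm t ltac:(lra)). rewrite E in N.
        assert (P1 := Hp (2 - s) ltac:(lra)). assert (P2 := Hp (2 - t) ltac:(lra)).
        assert ((2 - s) / sqrt 3 - (2 - t) / sqrt 3 = 0).
        { assert (F : ((2 - s) / sqrt 3 - (2 - t) / sqrt 3) * ((2 - s) / sqrt 3 + (2 - t) / sqrt 3) = 0) by lra.
          apply Rmult_integral in F. destruct F; [easy|lra]. }
        assert (F : (2 - s - (2 - t)) / sqrt 3 = 0) by (unfold Rdiv in *; lra). apply Hz in F. lra.
      * rewrite E, C0_3, dot_e_self in N by lra.
        assert (F : (2 - s) / sqrt 3 * ((2 - s) / sqrt 3) = 0) by lra.
        apply Rmult_integral in F. assert (s = 2) by (destruct F as [F|F]; apply Hz in F; lra).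
        apply W33; try easy; lra.
      * exfalso. assert (X := C0_4_snd t ltac:(lra)). rewrite <- E, C0_2_snd in X by lra. lra.
    + destruct (Rle_dec t 3) as [T3|T3]; [apply W33; try easy; lra|].
      assert (N := C0_4_norm t ltac:(lra)). rewrite <- E, C0_3, dot_e_self in N by lra.
      assert (F : (t - 3) * (t - 3) = 0) by lra. apply Rmult_integral in F. lra.
    + assert (N := C0_4_norm t ltac:(lra)). rewrite <- E, C0_4_norm in N by lra. nra.
Qed.

(** * Distances between the two tangent segments and the arc *)

(** The point at signed distance [x] from the contact point on the tangent at [a]. *)
Lemma tangent_point_far (a x w : R) :
  edist (e a + RtoC x * e (a + PI/2))%C (e (a + w)) * edist (e a + RtoC x * e (a + PI/2))%C (e (a + w))
   = x * x + 2 * (1 - cos w - x * sin w).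
Proof.
  rewrite (edist_frame _ _ a).
  assert (E1 : dot (e a + RtoC x * e (a + PI/2))%C (e a) = 1).
  { transitivity (dot (e a) (e a) + x * dot (e (a + PI/2)) (e a)); [unfold dot, Cplus, Cmult, RtoC; simpl; ring|].
    rewrite !dot_e_e. replace (a - a) with 0 by ring. replace (a + PI/2 - a) with (PI/2) by ring.
    rewrite cos_0, cos_PI2. ring. }
  assert (E2 : dot (e a + RtoC x * e (a + PI/2))%C (e (a + PI/2)) = x).
  { transitivity (dot (e a) (e (a + PI/2)) + x * dot (e (a + PI/2)) (e (a + PI/2))); [unfold dot, Cplus, Cmult, RtoC; simpl; ring|].
    rewrite !dot_e_e. replace (a - (a + PI/2)) with (- (PI/2)) by ring. replace (a + PI/2 - (a + PI/2)) with 0 by ring.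
    rewrite cos_neg, cos_0, cos_PI2. ring. }
  rewrite E1, E2, !dot_e_e. replace (a + w - a) with w by ring.
  replace (a + w - (a + PI/2)) with (- (PI/2 - w)) by ring. rewrite cos_neg, cos_shift.
  generalize (sin2_cos2 w). unfold Rsqr. nra.
Qed.

(** Beyond a half turn the term [x sin v] is negative, but up to [7 PI/6] it stays
    dominated by [1 - cos v]. *)
Lemma half_turn_bound (x v : R) : 0 <= x <= 1 -> 0 <= v <= 7 * PI/6 ->
  sin (v/2) * sin (v/2) <= 1 - cos v + x * sin v.
Proof.
  intros Hx Hv. assert (Hpi := PI_RGT_0). assert (Hpi2 := PI_lt_315).
  replace (1 - cos v + x * sin v) with (2 * sin (v/2) * (sin (v/2) + x * cos (v/2))).
  2:{ set (u := v/2). replace v with (2 * u) by (unfold u; field). rewrite cos_2a_sin, sin_2a. ring. }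
  assert (S0 : 0 <= sin (v/2)) by (apply sin_ge_0; lra).
  assert (H : sin (v/2) / 2 <= sin (v/2) + x * cos (v/2)); [|nra].
  destruct (Rle_dec 0 (cos (v/2))) as [Hc|Hc]; [nra|].
  assert (V : PI/2 < v/2).
  { apply Rnot_le_lt. intros Hle. apply Hc. apply cos_ge_0; lra. }
  assert (C1 : - (PI/12) <= cos (v/2)).
  { replace (v/2) with (PI/2 - (PI/2 - v/2)) by ring. rewrite cos_shift.
    replace (PI/2 - v/2) with (- (v/2 - PI/2)) by ring. rewrite sin_neg.
    assert (X := sin_lt_x (v/2 - PI/2) ltac:(lra)). lra. }
  assert (S1 : sqrt 3 / 2 <= sin (v/2)).
  { rewrite <- sin_2PI3. apply sin_decr_1; lra. }
  assert (Hs3 := sqrt3_bound). nra.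
Qed.

Lemma edist_e_half (a v : R) : edist (e a) (e (a + v)) * edist (e a) (e (a + v)) = 4 * (sin (v/2) * sin (v/2)).
Proof.
  rewrite edist_e_sqr. replace (a + v - a) with (2 * (v/2)) by field. rewrite cos_2a_sin. ring.
Qed.

(** Quantitative form of the fact that C is the point of the arc closest to any point of
    the segment BC. *)
Lemma far_BC (t th : R) : 1 <= t <= 2 -> PI/6 <= th <= 4 * PI/3 ->
  (2 - t) / sqrt 3 * ((2 - t) / sqrt 3) + edist (C0 2) (e th) * edist (C0 2) (e th) / 2
   <= edist (C0 t) (e th) * edist (C0 t) (e th).
Proof.
  intros Ht Hth. assert (Hs3 := sqrt3_bound). assert (Hi := inv_sqrt3).
  set (x := (2 - t) / sqrt 3).
  assert (Hx : 0 <= x <= 1).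
  { unfold x. split; [apply Rdiv_le_0_compat; lra|]. unfold Rdiv in *. nra. }
  assert (E : C0 t = (e (PI/6) + RtoC (- x) * e (PI/6 + PI/2))%C).
  { rewrite C0_2 by easy. unfold pointC. fold x. f_equal.
    rewrite e_half. unfold e. rewrite cos_minus, sin_minus, cos_PI2, sin_PI2.
    unfold Cmult, RtoC; simpl. f_equal; ring. }
  assert (E2 : C0 2 = e (PI/6)).
  { rewrite C0_3 by lra. f_equal. ring. }
  rewrite E, E2. replace th with (PI/6 + (th - PI/6)) by ring.
  rewrite tangent_point_far, edist_e_half.
  generalize (half_turn_bound x (th - PI/6) Hx ltac:(lra)). lra.
Qed.

(** The same for E and the segment EF. *)
Lemma far_EF (t th : R) : 3 <= t <= 4 -> PI/6 <= th <= 4 * PI/3 ->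
  (t - 3) * (t - 3) + edist (C0 3) (e th) * edist (C0 3) (e th) / 2
   <= edist (C0 t) (e th) * edist (C0 t) (e th).
Proof.
  intros Ht Hth.
  assert (E2 : C0 3 = e (4 * PI/3)).
  { rewrite C0_3 by lra. f_equal. field. }
  rewrite E2, C0_4 by easy. replace th with (4 * PI/3 + - (4 * PI/3 - th)) by ring.
  rewrite tangent_point_far, edist_e_half.
  replace (- (4 * PI / 3 - th) / 2) with (- ((4 * PI / 3 - th) / 2)) by field.
  rewrite sin_neg, cos_neg, sin_neg.
  generalize (half_turn_bound (t - 3) (4 * PI/3 - th) ltac:(lra) ltac:(lra)). lra.
Qed.

Lemma le_of_sqr (x y : R) : 0 <= y -> x * x <= y * y -> x <= y.
Proof. intros Hy H. apply Rsqr_incr_0_var; easy. Qed.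

Lemma dist_BC_arc (t th : R) : 1 <= t <= 2 -> PI/6 <= th <= 4 * PI/3 ->
  (2 - t) / sqrt 3 <= edist (C0 t) (e th).
Proof.
  intros Ht Hth. apply le_of_sqr; [apply edist_pos|].
  generalize (far_BC t th Ht Hth) (edist_pos (C0 2) (e th)). nra.
Qed.

Lemma dist_EF_arc (t th : R) : 3 <= t <= 4 -> PI/6 <= th <= 4 * PI/3 ->
  t - 3 <= edist (C0 t) (e th).
Proof.
  intros Ht Hth. apply le_of_sqr; [apply edist_pos|].
  generalize (far_EF t th Ht Hth) (edist_pos (C0 3) (e th)). nra.
Qed.

(** * Visiting a fine grid of points of the arc *)

Definition on_arc (th : R) : Prop := PI/6 <= th <= 4 * PI/3.

(** Directions [an 0], ..., [an N] on the arc whose contact points are at mutual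
    distance at least [w], with [N w] close to the length of the arc: a path through all
    these points, in whatever order, is almost as long as the arc. *)
Definition gridded (ep : R) (N : nat) (w : R) (an : nat -> R) : Prop :=
  0 < w <= ep /\ 7 * PI/6 - ep <= w * INR N /\ an 0%nat = PI/6 /\
  (forall i, (i <= N)%nat -> on_arc (an i)) /\
  (forall i j, (i <= N)%nat -> (j <= N)%nat -> i <> j -> w <= edist (e (an i)) (e (an j))).

(** Equally spaced directions, with [w] the chord of the spacing. *)
Lemma grid (ep : R) : 0 < ep <= 1/10 -> exists N w an, gridded ep N w an.
Proof.
  intros He. assert (Hpi := PI_RGT_0). assert (Hpi2 := PI_lt_315).
  destruct (archimed_cor1 (ep / 4)) as (N & N1 & N2); [lra|].
  assert (HN : 0 < INR N) by (apply lt_0_INR; lia).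
  set (dl := 7 * PI/6 / INR N).
  assert (Hdl : 0 < dl <= ep).
  { split; [apply Rdiv_lt_0_compat; lra|].
    assert (7 * PI / 6 * / INR N <= 4 * / INR N); [|unfold dl, Rdiv in *; lra].
    apply Rmult_le_compat_r; [|lra]. apply Rlt_le, Rinv_0_lt_compat; easy. }
  assert (HdN : dl * INR N = 7 * PI/6) by (unfold dl; field; lra).
  clearbody dl.
  exists N, (2 * sin (dl/2)), (fun i => PI/6 + INR i * dl). unfold gridded, on_arc.
  assert (S1 := sin_cube (dl/2) ltac:(lra)). assert (S2 := sin_lt_x (dl/2) ltac:(lra)).
  assert (D2 : 0 < dl * dl <= dl / 10) by (split; nra).
  assert (D3 : 0 < dl * dl * dl <= dl / 10).
  { split; [apply Rmult_lt_0_compat; lra|]. apply Rle_trans with (dl / 10 * dl); [apply Rmult_le_compat_r|]; lra. }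
  split; [lra|]. split; [|split; [|split]].
  - assert (dl - dl * dl * dl / 24 <= 2 * sin (dl/2)) by lra.
    assert ((dl - dl * dl * dl / 24) * INR N <= 2 * sin (dl/2) * INR N) by (apply Rmult_le_compat_r; lra).
    replace ((dl - dl * dl * dl / 24) * INR N) with ((dl * INR N) * (1 - dl * dl / 24)) in H0 by field.
    rewrite HdN in H0. assert (7 * PI/6 * (dl * dl) <= 4 * (dl * dl)) by (apply Rmult_le_compat_r; lra). lra.
  - simpl. ring.
  - intros i Hi. apply le_INR in Hi. assert (0 <= INR i) by apply pos_INR.
    assert (INR i * dl <= INR N * dl) by (apply Rmult_le_compat_r; lra).
    assert (0 <= INR i * dl) by (apply Rmult_le_pos; lra). lra.
  - assert (W : forall i j, (i < j)%nat -> (j <= N)%nat ->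
      2 * sin (dl/2) <= edist (e (PI/6 + INR i * dl)) (e (PI/6 + INR j * dl))).
    { intros i j Hij Hj. apply le_of_sqr; [apply edist_pos|]. rewrite edist_e_sqr.
      replace (2 * sin (dl / 2) * (2 * sin (dl / 2))) with (2 - 2 * cos dl).
      2:{ replace dl with (2 * (dl/2)) at 1 by field. rewrite cos_2a_sin. ring. }
      assert (HJ : INR i + 1 <= INR j) by (rewrite <- S_INR; apply le_INR; lia).
      apply le_INR in Hj. assert (0 <= INR i) by apply pos_INR.
      replace (PI / 6 + INR j * dl - (PI / 6 + INR i * dl)) with ((INR j - INR i) * dl) by ring.
      assert (X1 : 1 * dl <= (INR j - INR i) * dl) by (apply Rmult_le_compat_r; lra).
      assert (X2 : (INR j - INR i) * dl <= INR N * dl) by (apply Rmult_le_compat_r; lra).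
      set (y := (INR j - INR i) * dl) in *.
      assert (cos y <= cos dl); [|lra].
      destruct (Rle_dec y PI).
      - apply cos_decr_1; lra.
      - generalize PI2_3_2; intros; apply Rle_trans with 0; [apply cos_le_0; lra|apply cos_ge_0; lra]. }
    intros i j Hi Hj Hij. destruct (Nat.lt_ge_cases i j).
    + now apply W.
    + rewrite edist_sym. apply W; lia.
Qed.

Lemma incr_app a t1 x t2 b : incr a t1 x -> incr x t2 b -> incr a (t1 ++ x :: t2) b.
Proof.
  revert a. induction t1 as [|t t1 IH]; intros a H1 H2; simpl in *; [easy|].
  split; [easy|]. now apply IH.
Qed.

Lemma insert_time (Tm : nat -> R) (x : nat) (J : list nat) v : forall u,
  incr u (map Tm J) v -> u <= Tm x <= v ->
  exists J', Permutation (x :: J) J' /\ incr u (map Tm J') v.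
Proof.
  induction J as [|j J IH]; intros u H Hx.
  - exists [x]. split; [apply Permutation_refl|]. simpl. lra.
  - destruct H as [H1 H2]. destruct (Rle_dec (Tm x) (Tm j)) as [Hj|Hj].
    + exists (x :: j :: J). split; [apply Permutation_refl|]. simpl. tauto.
    + destruct (IH (Tm j) H2) as (J' & K1 & K2); [lra|].
      exists (j :: J'). split.
      * apply perm_trans with (j :: x :: J); [apply perm_swap|now apply perm_skip].
      * simpl. tauto.
Qed.

Lemma sort_times (Tm : nat -> R) (I : list nat) u v : u <= v ->
  (forall i, In i I -> u <= Tm i <= v) -> exists J, Permutation I J /\ incr u (map Tm J) v.
Proof.
  intros Huv. induction I as [|x I IH]; intros H.
  - exists []. split; [apply Permutation_refl|easy].
  - destruct IH as (J & J1 & J2). { intros i Hi. apply H. now right. }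
    destruct (insert_time Tm x J v u J2) as (J' & K1 & K2). { apply H. now left. }
    exists J'. split; [|easy]. apply perm_trans with (x :: J); [now apply perm_skip|easy].
Qed.

Lemma separated_walk (P : nat -> C) (w : R) (N : nat) :
  (forall i j, (i <= N)%nat -> (j <= N)%nat -> i <> j -> w <= edist (P i) (P j)) ->
  forall J i p, NoDup (i :: J) -> (forall j, In j (i :: J) -> (j <= N)%nat) ->
  edist p (P i) + w * INR (length J) <= plen p (map P (i :: J)).
Proof.
  intros HP. induction J as [|j J IH]; intros i p Hn Hb.
  - simpl. lra.
  - inversion Hn as [|? ? Hni Hnj]; subst.
    assert (X := IH j (P i) Hnj ltac:(intros; apply Hb; now right)).
    assert (Y : w <= edist (P i) (P j)).
    { apply HP; try (apply Hb; simpl; tauto). intros ->. apply Hni. now left. }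
    change (plen p (map P (i :: j :: J))) with (edist p (P i) + plen (P i) (map P (j :: J))).
    replace (INR (length (j :: J))) with (INR (length J) + 1) by (simpl length; now rewrite S_INR).
    lra.
Qed.

(** The visits of the points [P i], [i] in [I], are sorted by time. The first and the
    last visited point are returned, so that the cost of reaching and leaving the block
    can be added. *)
Lemma visit_block (h : R -> C) (Tm : nat -> R) (P : nat -> C) (w : R) (N : nat) (I : list nat) (u v : R) :
  (forall i j, (i <= N)%nat -> (j <= N)%nat -> i <> j -> w <= edist (P i) (P j)) ->
  u <= v -> NoDup I -> (forall i, In i I -> (i <= N)%nat /\ u <= Tm i <= v /\ h (Tm i) = P i) ->
  exists ts, incr u ts v /\ (I = [] -> ts = []) /\
   (I <> [] -> exists i j, In i I /\ In j I /\ (forall p, last (map h ts) p = P j) /\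
     forall p, edist p (P i) + w * INR (length I) - w <= plen p (map h ts)).
Proof.
  intros HP Huv Hn HI.
  destruct (sort_times Tm I u v Huv) as (J & J1 & J2). { intros i Hi. now apply HI. }
  exists (map Tm J). split; [easy|]. split.
  - intros ->. apply Permutation_nil in J1. now subst.
  - intros Hne. destruct J as [|i J].
    { apply Permutation_sym, Permutation_nil in J1. easy. }
    assert (Hin : forall j, In j (i :: J) -> In j I).
    { intros j Hj. apply Permutation_in with (i :: J); [now apply Permutation_sym|easy]. }
    assert (E : map h (map Tm (i :: J)) = map P (i :: J)).
    { rewrite map_map. apply map_ext_in. intros j Hj. apply HI. now apply Hin. }
    exists i, (last J i). rewrite E. split; [apply Hin; now left|]. split; [|split].
    + apply Hin. clear. revert i. induction J as [|j J IH]; intros i; [now left|].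
      rewrite last_cons. right. apply IH.
    + intros p. simpl map. rewrite last_cons. clear. revert i.
      induction J as [|j J IH]; intros i; [easy|]. simpl map. rewrite !last_cons. apply IH.
    + intros p.
      assert (X := separated_walk P w N HP J i p (Permutation_NoDup J1 Hn)
        ltac:(intros j Hj; apply HI; now apply Hin)).
      apply Permutation_length in J1. rewrite J1.
      replace (INR (length (i :: J))) with (INR (length J) + 1) by (simpl length; now rewrite S_INR).
      lra.
Qed.

(** * Curves through B, the arc and F with no length to spare *)

(** A curve with no room left: no inscribed polygon is longer than the optimal path, and
    B, F are on the curve. Solutions have this form after an isometry. *)
Definition tight (h : R -> C) (a b tB tF : R) : Prop :=
  continuous_on (fun t => a <= t <= b) h /\ h a = origin /\
  (forall ts, incr a ts b -> plen origin (map h ts) <= L0) /\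
  a <= tB <= b /\ h tB = C0 1 /\ a <= tF <= b /\ h tF = C0 4.

Definition visits (h : R -> C) (a b : R) (T : R -> R) : Prop :=
  forall th, on_arc th -> a <= T th <= b /\ h (T th) = e th.

(** The length of the tangent segment BC, that is [tan (PI/6)]. *)
Definition len_BC : R := 1 / sqrt 3.

Lemma len_BC_bound : 0.57 < len_BC < 0.59.
Proof.
  generalize sqrt3_bound; intros H. unfold len_BC.
  split; apply Rmult_lt_reg_r with (sqrt 3); try lra; unfold Rdiv; rewrite Rmult_assoc, Rinv_l; lra.
Qed.

Lemma L0_len_BC : L0 = 1 + 3 * len_BC + 7 * PI/6.
Proof. unfold L0, len_BC. generalize three_div_sqrt3. unfold Rdiv. lra. Qed.

Lemma edist_O_e th : edist origin (e th) = 1.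
Proof. rewrite edist_origin. apply Cmod_e. Qed.

Lemma C0_0 : C0 0 = origin.
Proof. rewrite C0_1 by lra. unfold origin. f_equal. ring. Qed.

Lemma edist_C0_same (s t : R) : (0 <= s <= 1 /\ 0 <= t <= 1) \/ (1 <= s <= 2 /\ 1 <= t <= 2) \/
  (3 <= s <= 4 /\ 3 <= t <= 4) -> s <= t -> edist (C0 s) (C0 t) = arclen t - arclen s.
Proof.
  assert (Hi := inv_sqrt3). intros H Hst. destruct H as [[Hs Ht]|[[Hs Ht]|[Hs Ht]]].
  - assert (E : forall x, 0 <= x <= 1 -> C0 x = (origin + RtoC (2 / sqrt 3 * x) * e 0)%C).
    { intros x Hx. rewrite C0_1 by easy. unfold origin, e, Cplus, Cmult, RtoC; simpl.
      rewrite cos_0, sin_0. f_equal; ring. }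
    rewrite !E by lra. rewrite edist_ray; [rewrite !arclen_1 by lra; ring|apply Cmod_e|].
    apply Rmult_le_compat_l; [unfold Rdiv in *; lra|easy].
  - rewrite !C0_2 by lra. rewrite edist_sym, edist_ray; [rewrite !arclen_2 by lra; unfold Rdiv; ring|apply Cmod_e|].
    apply Rmult_le_compat_r; [unfold Rdiv in *; lra|lra].
  - rewrite !C0_4 by lra. rewrite edist_ray; [rewrite !arclen_4 by lra; ring|apply Cmod_e|lra].
Qed.

Lemma edist_OB s t : 0 <= s <= t -> t <= 1 -> edist (C0 s) (C0 t) = 2 * len_BC * (t - s).
Proof. intros. rewrite edist_C0_same, !arclen_1 by lra. unfold len_BC, Rdiv. ring. Qed.

Lemma edist_BC s t : 1 <= s <= t -> t <= 2 -> edist (C0 s) (C0 t) = len_BC * (t - s).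
Proof. intros. rewrite edist_C0_same, !arclen_2 by lra. unfold len_BC, Rdiv. ring. Qed.

Lemma edist_EF s t : 3 <= s <= t -> t <= 4 -> edist (C0 s) (C0 t) = t - s.
Proof. intros. rewrite edist_C0_same, !arclen_4 by lra. ring. Qed.

Lemma dist_B_arc th : on_arc th -> len_BC <= edist (C0 1) (e th).
Proof. intros H. generalize (dist_BC_arc 1 th ltac:(lra) H). unfold len_BC. replace (2 - 1) with 1 by ring. easy. Qed.

Lemma dist_arc_F th : on_arc th -> 1 <= edist (e th) (C0 4).
Proof. intros H. rewrite edist_sym. generalize (dist_EF_arc 4 th ltac:(lra) H). lra. Qed.

Lemma arc_param u : 2 <= u <= 3 -> on_arc (PI/6 + (u - 2) * (7 * PI / 6)).
Proof.
  intros H. assert (Hpi := PI_RGT_0). unfold on_arc.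
  assert (0 <= (u - 2) * (7 * PI/6) <= 1 * (7 * PI/6)); [|lra].
  split; [apply Rmult_le_pos; lra|apply Rmult_le_compat_r; lra].
Qed.

Lemma param_arc th : on_arc th -> 2 <= 2 + (th - PI/6) / (7 * PI/6) <= 3 /\
  C0 (2 + (th - PI/6) / (7 * PI/6)) = e th.
Proof.
  intros H. assert (Hpi := PI_RGT_0). unfold on_arc in H.
  assert (B : 0 <= (th - PI/6) / (7 * PI / 6) <= 1).
  { split.
    - apply Rdiv_le_0_compat; lra.
    - apply Rmult_le_reg_r with (7 * PI / 6); [lra|].
      replace ((th - PI / 6) / (7 * PI / 6) * (7 * PI / 6)) with (th - PI/6) by (field; lra). lra. }
  split; [lra|]. rewrite C0_3 by lra. f_equal. field. lra.
Qed.

Lemma dot_C0_dir t x : 1 <= t <= 2 -> (2 - t) / sqrt 3 = x ->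
  dot (C0 t) (e (4 * PI/3)) = - (sqrt 3 / 2) + x / 2.
Proof.
  intros Ht <-. rewrite C0_2 by easy. set (x := (2 - t) / sqrt 3).
  transitivity (dot (e (PI/6)) (e (4 * PI/3)) + x * dot (e (PI/6 - PI/2)) (e (4 * PI/3))).
  { unfold pointC, dot, Cplus, Cmult, RtoC; simpl. ring. }
  rewrite !dot_e_e. replace (PI/6 - 4 * PI/3) with (- (PI/6 + PI)) by field.
  replace (PI/6 - PI/2 - 4 * PI/3) with (PI/3 - 2 * PI) by field.
  rewrite cos_neg, neg_cos, cos_minus, cos_2PI, sin_2PI, cos_PI6, cos_PI3. field.
Qed.

Lemma dot_F_dir : dot (C0 4) (e (4 * PI/3)) = 1.
Proof.
  rewrite C0_4 by lra. replace (4 - 3) with 1 by ring.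
  transitivity (dot (e (4 * PI/3)) (e (4 * PI/3)) + dot (e (4 * PI/3 + PI/2)) (e (4 * PI/3))).
  { unfold dot, Cplus, Cmult, RtoC; simpl. ring. }
  rewrite !dot_e_e. replace (4 * PI / 3 + PI / 2 - 4 * PI / 3) with (PI/2) by ring.
  replace (4 * PI / 3 - 4 * PI / 3) with 0 by ring. rewrite cos_0, cos_PI2. ring.
Qed.

(** In the direction of E, the point F has the coordinate [1] and B the coordinate [-
    tan (PI/6)]. *)
Lemma dist_B_F : 1 + len_BC <= edist (C0 1) (C0 4).
Proof.
  assert (H := dot_le_edist (e (4 * PI/3)) (C0 1) (C0 4) (dot_e_unit _)).
  rewrite dot_F_dir, (dot_C0_dir 1 len_BC) in H; [|lra|unfold len_BC, Rdiv; ring].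
  assert (S := three_div_sqrt3). unfold len_BC, Rdiv in *. lra.
Qed.

(** On the segment BC by projection on the direction of E, on the arc by [dist_arc_F]. *)
Lemma dist_mid_F u : 1 <= u <= 3 -> 1 <= edist (C0 u) (C0 4).
Proof.
  intros Hu. destruct (Rle_dec u 2) as [H|H].
  - assert (X := dot_le_edist (e (4 * PI/3)) (C0 u) (C0 4) (dot_e_unit _)).
    rewrite dot_F_dir, (dot_C0_dir u ((2 - u) / sqrt 3)) in X; try lra.
    assert (Hi := inv_sqrt3). assert (Hs := sqrt3_bound).
    assert ((2 - u) / sqrt 3 <= 1). { unfold Rdiv in *. nra. } lra.
  - rewrite (C0_3 u) by lra. apply dist_arc_F. apply arc_param. lra.
Qed.

Lemma dist_O_F : 1.4 <= edist origin (C0 4).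
Proof.
  rewrite edist_origin. apply le_of_sqr; [apply Cmod_ge_0|].
  rewrite Cmod_sqr, C0_4_norm; lra.
Qed.

(** An empty block costs the direct way, at least [ga]. Otherwise the first and the last
    visited points depend on the visiting order, hence the uniform bounds [al] and [be]. *)
Lemma visit_block_between (h : R -> C) (Tm : nat -> R) (P : nat -> C) (w : R) (N : nat) (I : list nat) (u v : R)
  (p q : C) (al be ga : R) :
  (forall i j, (i <= N)%nat -> (j <= N)%nat -> i <> j -> w <= edist (P i) (P j)) ->
  u <= v -> NoDup I -> (forall i, In i I -> (i <= N)%nat /\ u <= Tm i <= v /\ h (Tm i) = P i) ->
  (forall i, In i I -> al <= edist p (P i)) -> (forall i, In i I -> be <= edist (P i) q) ->
  ga <= edist p q ->
  exists ts, incr u ts v /\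
    ((I = [] /\ ga <= plen p (map h ts) + edist (last (map h ts) p) q) \/
     (I <> [] /\ al + be + w * INR (length I) - w <= plen p (map h ts) + edist (last (map h ts) p) q)).
Proof.
  intros HP Huv Hn HI Ha Hb Hg.
  destruct (visit_block h Tm P w N I u v HP Huv Hn HI) as (ts & T1 & T2 & T3).
  exists ts. split; [easy|]. destruct (classic (I = [])) as [E|E].
  - left. split; [easy|]. rewrite (T2 E). simpl. lra.
  - right. split; [easy|]. destruct (T3 E) as (i & j & I1 & J1 & L & W).
    specialize (W p). rewrite L. specialize (Ha i I1). specialize (Hb j J1). lra.
Qed.

Lemma visit_block_from (h : R -> C) (Tm : nat -> R) (P : nat -> C) (w : R) (N : nat) (I : list nat) (u v : R)
  (p : C) (al : R) :
  (forall i j, (i <= N)%nat -> (j <= N)%nat -> i <> j -> w <= edist (P i) (P j)) ->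
  u <= v -> NoDup I -> (forall i, In i I -> (i <= N)%nat /\ u <= Tm i <= v /\ h (Tm i) = P i) ->
  (forall i, In i I -> al <= edist p (P i)) ->
  exists ts, incr u ts v /\
    ((I = [] /\ 0 <= plen p (map h ts)) \/
     (I <> [] /\ al + w * INR (length I) - w <= plen p (map h ts))).
Proof.
  intros HP Huv Hn HI Ha.
  destruct (visit_block h Tm P w N I u v HP Huv Hn HI) as (ts & T1 & T2 & T3).
  exists ts. split; [easy|]. destruct (classic (I = [])) as [E|E].
  - left. split; [easy|]. apply plen_pos.
  - right. split; [easy|]. destruct (T3 E) as (i & j & I1 & J1 & L & W).
    specialize (W p). specialize (Ha i I1). lra.
Qed.

Lemma split_times (f : nat -> R) (x : R) (I : list nat) : NoDup I -> exists I1 I2,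
  NoDup I1 /\ NoDup I2 /\ (forall i, In i I1 <-> In i I /\ f i <= x) /\
  (forall i, In i I2 <-> In i I /\ x < f i) /\
  INR (length I1) + INR (length I2) = INR (length I).
Proof.
  intros Hn. set (g := fun i => if Rle_dec (f i) x then true else false).
  exists (filter g I), (filter (fun i => negb (g i)) I).
  split; [now apply NoDup_filter|]. split; [now apply NoDup_filter|]. split; [|split].
  - intros i. rewrite filter_In. unfold g. destruct Rle_dec; split; try tauto; intros [? ?]; easy.
  - intros i. rewrite filter_In. unfold g. destruct Rle_dec; simpl; split; intros [? ?]; split; try easy; lra.
  - rewrite <- plus_INR. f_equal. apply filter_length.
Qed.

Lemma plen_visit (h : R -> C) (p : C) ts1 x ts2 :
  plen p (map h (ts1 ++ x :: ts2)) =
  plen p (map h ts1) + edist (last (map h ts1) p) (h x) + plen (h x) (map h ts2).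
Proof. rewrite map_app, plen_app. simpl. ring. Qed.

Lemma INR_length_nil : INR (length (@nil nat)) = 0.
Proof. easy. Qed.

Definition indices (N : nat) : list nat := seq 0 (N + 1).
Lemma indices_NoDup N : NoDup (indices N). Proof. apply seq_NoDup. Qed.
Lemma indices_In N i : In i (indices N) <-> (i <= N)%nat. Proof. unfold indices. rewrite in_seq. lia. Qed.
Lemma indices_length N : INR (length (indices N)) = INR N + 1.
Proof. unfold indices. rewrite length_seq, plus_INR. easy. Qed.

(** In the order O, F, B the legs from O to F and from F to B cost at least [1.4 + 1 +
    tan (PI/6)] besides the arc, which is more than [L0] allows. *)
Lemma B_before_F h a b tB tF T : tight h a b tB tF -> visits h a b T -> tB < tF.
Proof.
  intros (Hc & Ha & Hp & HB & EB & HF & EF) HT. apply Rnot_le_lt. intros Hle.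
  destruct (grid (1/100) ltac:(lra)) as (N & w & an & G1 & G2 & G3 & G4 & G5).
  set (Tm := fun i => T (an i)). set (P := fun i => e (an i)).
  destruct (split_times Tm tF (indices N) (indices_NoDup N)) as (I1 & J & N1 & NJ & S1 & SJ & L1).
  destruct (split_times Tm tB J NJ) as (I2 & I3 & N2 & N3 & S2 & S3 & L2).
  assert (V : forall i, (i <= N)%nat -> a <= Tm i <= b /\ h (Tm i) = P i).
  { intros i Hi. apply HT. now apply G4. }
  assert (Q := len_BC_bound).
  destruct (visit_block_between h Tm P w N I1 a tF origin (C0 4) 1 1 1.4) as (t1 & T1 & X1); try easy; try lra.
  { intros i Hi. apply S1 in Hi. rewrite indices_In in Hi. destruct (V i ltac:(tauto)). repeat split; try tauto; lra. }
  { intros i Hi. unfold P. rewrite edist_O_e. lra. }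
  { intros i Hi. apply dist_arc_F, G4. apply S1 in Hi. rewrite indices_In in Hi. tauto. }
  { apply dist_O_F. }
  destruct (visit_block_between h Tm P w N I2 tF tB (C0 4) (C0 1) 1 len_BC (1 + len_BC)) as (t2 & T2 & X2); try easy.
  { intros i Hi. apply S2 in Hi. rewrite SJ, indices_In in Hi. destruct (V i ltac:(tauto)). repeat split; try tauto; lra. }
  { intros i Hi. unfold P. rewrite edist_sym. apply dist_arc_F, G4. apply S2 in Hi. rewrite SJ, indices_In in Hi. tauto. }
  { intros i Hi. unfold P. rewrite edist_sym. apply dist_B_arc, G4. apply S2 in Hi. rewrite SJ, indices_In in Hi. tauto. }
  { rewrite edist_sym. apply dist_B_F. }
  destruct (visit_block_from h Tm P w N I3 tB b (C0 1) 0) as (t3 & T3 & X3); try easy; try lra.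
  { intros i Hi. apply S3 in Hi. rewrite SJ, indices_In in Hi. destruct (V i ltac:(tauto)). repeat split; try tauto; lra. }
  { intros i Hi. apply edist_pos. }
  assert (X := Hp (t1 ++ tF :: t2 ++ tB :: t3)).
  rewrite !plen_visit, EB, EF in X.
  specialize (X (incr_app _ _ _ _ _ T1 (incr_app _ _ _ _ _ T2 T3))).
  rewrite indices_length in L1. rewrite L0_len_BC in X.
  assert (Len : w * INR (length I1) + w * INR (length I2) + w * INR (length I3) = w * INR N + w).
  { replace (w * INR N + w) with (w * (INR N + 1)) by ring. rewrite <- L1, <- L2. ring. }
  assert (Z1 : 0 <= w * INR (length I1)) by (apply Rmult_le_pos; [lra|apply pos_INR]).
  assert (Y1 : 1.4 + w * INR (length I1) - w <= plen origin (map h t1) + edist (last (map h t1) origin) (C0 4)).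
  { destruct X1 as [[E X1]|[E X1]]; [rewrite E, INR_length_nil; lra|lra]. }
  assert (Y2 : 1 + len_BC + w * INR (length I2) - w <= plen (C0 4) (map h t2) + edist (last (map h t2) (C0 4)) (C0 1)).
  { destruct X2 as [[E X2]|[E X2]]; [rewrite E, INR_length_nil; lra|lra]. }
  assert (Y3 : w * INR (length I3) - w <= plen (C0 1) (map h t3)).
  { destruct X3 as [[E X3]|[E X3]]; [rewrite E, INR_length_nil; lra|lra]. }
  lra.
Qed.

(** A point of the arc visited before B makes the way from O to B a detour of length at
    least [1 + tan (PI/6)] in place of [2 tan (PI/6)]; one visited after F costs an
    additional [1]. Neither fits into [L0]. *)
Lemma arc_between_B_and_F h a b tB tF T ep N w an : tight h a b tB tF -> visits h a b T ->
  gridded ep N w an -> ep <= 1/100 -> forall i, (i <= N)%nat -> tB <= T (an i) <= tF.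
Proof.
  intros Ht HT (G1 & G2 & G3 & G4 & G5) He.
  assert (Hlt := B_before_F h a b tB tF T Ht HT).
  destruct Ht as (Hc & Ha & Hp & HB & EB & HF & EF).
  set (Tm := fun i => T (an i)). set (P := fun i => e (an i)).
  destruct (split_times Tm tB (indices N) (indices_NoDup N)) as (I1 & J & N1 & NJ & S1 & SJ & L1).
  destruct (split_times Tm tF J NJ) as (I2 & I3 & N2 & N3 & S2 & S3 & L2).
  assert (V : forall i, (i <= N)%nat -> a <= Tm i <= b /\ h (Tm i) = P i).
  { intros i Hi. apply HT. now apply G4. }
  assert (Q := len_BC_bound).
  destruct (visit_block_between h Tm P w N I1 a tB origin (C0 1) 1 len_BC (2 * len_BC)) as (t1 & T1 & X1); try easy; try lra.
  { intros i Hi. apply S1 in Hi. rewrite indices_In in Hi. destruct (V i ltac:(tauto)). repeat split; try tauto; lra. }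
  { intros i Hi. unfold P. rewrite edist_O_e. lra. }
  { intros i Hi. unfold P. rewrite edist_sym. apply dist_B_arc, G4. apply S1 in Hi. rewrite indices_In in Hi. tauto. }
  { rewrite <- C0_0, edist_OB; lra. }
  destruct (visit_block_between h Tm P w N I2 tB tF (C0 1) (C0 4) len_BC 1 (1 + len_BC)) as (t2 & T2 & X2); try easy; try lra.
  { intros i Hi. apply S2 in Hi. rewrite SJ, indices_In in Hi. destruct (V i ltac:(tauto)). repeat split; try tauto; lra. }
  { intros i Hi. unfold P. apply dist_B_arc, G4. apply S2 in Hi. rewrite SJ, indices_In in Hi. tauto. }
  { intros i Hi. unfold P. apply dist_arc_F, G4. apply S2 in Hi. rewrite SJ, indices_In in Hi. tauto. }
  { apply dist_B_F. }
  destruct (visit_block_from h Tm P w N I3 tF b (C0 4) 1) as (t3 & T3 & X3); try easy; try lra.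
  { intros i Hi. apply S3 in Hi. rewrite SJ, indices_In in Hi. destruct (V i ltac:(tauto)). repeat split; try tauto; lra. }
  { intros i Hi. unfold P. rewrite edist_sym. apply dist_arc_F, G4. apply S3 in Hi. rewrite SJ, indices_In in Hi. tauto. }
  assert (X := Hp (t1 ++ tB :: t2 ++ tF :: t3)).
  rewrite !plen_visit, EB, EF in X.
  specialize (X (incr_app _ _ _ _ _ T1 (incr_app _ _ _ _ _ T2 T3))).
  rewrite indices_length in L1. rewrite L0_len_BC in X.
  assert (Len : w * INR (length I1) + w * INR (length I2) + w * INR (length I3) = w * INR N + w).
  { replace (w * INR N + w) with (w * (INR N + 1)) by ring. rewrite <- L1, <- L2. ring. }
  assert (Y2 : 1 + len_BC + w * INR (length I2) - w <= plen (C0 1) (map h t2) + edist (last (map h t2) (C0 1)) (C0 4)).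
  { destruct X2 as [[E X2]|[E X2]]; [rewrite E, INR_length_nil; lra|lra]. }
  assert (Y3 : w * INR (length I3) - w <= plen (C0 4) (map h t3)).
  { destruct X3 as [[E X3]|[E X3]]; [rewrite E, INR_length_nil; lra|lra]. }
  destruct X1 as [[E1 X1]|[E1 X1]]; [|lra].
  destruct X3 as [[E3 X3]|[E3 X3]]; [|rewrite E1, INR_length_nil in *; lra].
  intros i Hi. change (T (an i)) with (Tm i).
  split; apply Rnot_lt_le; intros Hl.
  - assert (F : In i I1) by (apply S1; rewrite indices_In; split; [easy|lra]). rewrite E1 in F. easy.
  - assert (F : In i I3). { apply S3. split; [|easy]. apply SJ. rewrite indices_In. split; [easy|lra]. }
    rewrite E3 in F. easy.
Qed.

(** * The image of a solution *)

Lemma visit_all_between h u v T ep N w an p q al be ga : gridded ep N w an -> u <= v ->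
  (forall i, (i <= N)%nat -> u <= T (an i) <= v /\ h (T (an i)) = e (an i)) ->
  (forall th, on_arc th -> al <= edist p (e th)) -> (forall th, on_arc th -> be <= edist (e th) q) ->
  ga <= edist p q ->
  exists ts, incr u ts v /\ al + be + 7 * PI/6 - ep <= plen p (map h ts) + edist (last (map h ts) p) q.
Proof.
  intros (G1 & G2 & G3 & G4 & G5) Huv HT Ha Hb Hg.
  destruct (visit_block_between h (fun i => T (an i)) (fun i => e (an i)) w N (indices N) u v p q al be ga)
    as (ts & T1 & X); try easy.
  - apply indices_NoDup.
  - intros i Hi. apply indices_In in Hi. split; [easy|]. now apply HT.
  - intros i Hi. apply indices_In in Hi. now apply Ha, G4.
  - intros i Hi. apply indices_In in Hi. now apply Hb, G4.
  - exists ts. split; [easy|]. destruct X as [[E _]|[_ X]].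
    + exfalso. assert (Y := indices_length N). rewrite E, INR_length_nil in Y. generalize (pos_INR N). lra.
    + rewrite indices_length in X. lra.
Qed.

Lemma plen_cons (h : R -> C) p x ts : plen p (map h (x :: ts)) = edist p (h x) + plen (h x) (map h ts).
Proof. easy. Qed.

Lemma plen_nil (h : R -> C) p : plen p (map h []) = 0.
Proof. easy. Qed.

Lemma last_nil (h : R -> C) p : last (map h []) p = p.
Proof. easy. Qed.

(** A time [t] inserted into the polygon through O, B, the grid and F can only lengthen
    it by [ep]. For [t] before B or after F this confines [h t] to a thin ellipse with
    foci O and B, or to a small disc around F. In between, [h t] comes before, after or
    among the grid points, and lies in a thin ellipse with foci B and a point of the
    arc, in one with foci a point of the arc and F, or close to the arc. *)
Lemma near_pieces h a b tB tF T ep N w an t : tight h a b tB tF -> visits h a b T ->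
  gridded ep N w an -> ep <= 1/100 -> a <= t <= b ->
  (t <= tB -> edist origin (h t) + edist (h t) (C0 1) <= 2 * len_BC + ep) /\
  (tF <= t -> edist (C0 4) (h t) <= ep) /\
  (tB <= t <= tF ->
     (exists th, on_arc th /\ edist (C0 1) (h t) + edist (h t) (e th) <= len_BC + ep) \/
     (exists th, on_arc th /\ edist (e th) (h t) + edist (h t) (C0 4) <= 1 + ep) \/
     (exists th, on_arc th /\ edist (e th) (h t) <= 2 * ep)).
Proof.
  intros Ht HT HG He Htab.
  assert (Hlt := B_before_F h a b tB tF T Ht HT).
  assert (Hin := arc_between_B_and_F h a b tB tF T ep N w an Ht HT HG He).
  destruct Ht as (Hc & Ha & Hp & HB & EB & HF & EF).
  assert (V : forall i, (i <= N)%nat -> tB <= T (an i) <= tF /\ h (T (an i)) = e (an i)).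
  { intros i Hi. split; [now apply Hin|]. apply HT. now apply HG. }
  assert (Q := len_BC_bound). rewrite L0_len_BC in Hp.
  assert (OB : edist origin (C0 1) = 2 * len_BC) by (rewrite <- C0_0, edist_OB; lra).
  destruct (visit_all_between h tB tF T ep N w an (C0 1) (C0 4) len_BC 1 0 HG ltac:(lra) V dist_B_arc dist_arc_F (edist_pos _ _))
    as (ts & T1 & X1).
  split; [|split].
  - intros Hle. assert (X := Hp (t :: tB :: ts ++ tF :: [])).
    rewrite ?plen_cons, ?plen_visit, ?plen_cons, plen_nil, EB, EF in X.
    specialize (X ltac:(simpl; split; [lra|split; [lra|]]; apply incr_app; [easy|simpl; lra])). lra.
  - intros Hle. assert (X := Hp (tB :: ts ++ tF :: t :: [])).
    rewrite ?plen_cons, ?plen_visit, ?plen_cons, plen_nil, EB, EF in X.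
    specialize (X ltac:(simpl; split; [lra|]; apply incr_app; [easy|simpl; lra])). lra.
  - intros Hmid.
    assert (HG' := HG). destruct HG' as (G1 & G2 & G3 & G4 & G5).
    set (Tm := fun i => T (an i)). set (P := fun i => e (an i)).
    destruct (split_times Tm t (indices N) (indices_NoDup N)) as (I1 & I2 & N1 & N2 & S1 & S2 & L1).
    rewrite indices_length in L1.
    assert (Len : w * INR (length I1) + w * INR (length I2) = w * INR N + w).
    { replace (w * INR N + w) with (w * (INR N + 1)) by ring. rewrite <- L1. ring. }
    destruct (visit_block h Tm P w N I1 tB t G5 ltac:(lra) N1) as (t1 & T2 & E1 & B1).
    { intros i Hi. apply S1 in Hi. rewrite indices_In in Hi. destruct (V i ltac:(tauto)).
      repeat split; try tauto; lra. }
    destruct (visit_block h Tm P w N I2 t tF G5 ltac:(lra) N2) as (t2 & T3 & E2 & B2).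
    { intros i Hi. apply S2 in Hi. rewrite indices_In in Hi. destruct (V i ltac:(tauto)).
      repeat split; try tauto; unfold Tm in *; lra. }
    assert (A1 : forall i, In i I1 -> on_arc (an i)).
    { intros i Hi. apply G4. apply S1 in Hi. rewrite indices_In in Hi. tauto. }
    assert (A2 : forall i, In i I2 -> on_arc (an i)).
    { intros i Hi. apply G4. apply S2 in Hi. rewrite indices_In in Hi. tauto. }
    assert (X := Hp (tB :: t1 ++ t :: t2 ++ tF :: [])).
    rewrite ?plen_cons, ?plen_visit, ?plen_cons, plen_nil, EB, EF in X.
    specialize (X ltac:(simpl; split; [lra|]; apply incr_app; [easy|]; apply incr_app; [easy|simpl; lra])).
    destruct (classic (I1 = [])) as [F1|F1]; [|destruct (classic (I2 = [])) as [F2|F2]].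
    + left. rewrite (E1 F1) in X. rewrite F1, INR_length_nil in *. rewrite last_nil, plen_nil in X.
      destruct (classic (I2 = [])) as [F2|F2].
      { exfalso. rewrite F2, INR_length_nil in L1. generalize (pos_INR N). lra. }
      destruct (B2 F2) as (i & j & J1 & J2 & J3 & J4). exists (an i). split; [now apply A2|].
      specialize (J4 (h t)). rewrite J3 in X. assert (Y := dist_arc_F (an j) (A2 j J2)).
      change (e (an j)) with (P j) in Y. change (e (an i)) with (P i). lra.
    + right. left. rewrite (E2 F2) in X. rewrite F2, INR_length_nil in *. rewrite last_nil, plen_nil in X.
      destruct (B1 F1) as (i & j & J1 & J2 & J3 & J4). exists (an j). split; [now apply A1|].
      specialize (J4 (C0 1)). rewrite J3 in X. assert (Y := dist_B_arc (an i) (A1 i J1)).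
      change (e (an i)) with (P i) in Y. change (e (an j)) with (P j). lra.
    + right. right.
      destruct (B1 F1) as (i & j & J1 & J2 & J3 & J4). destruct (B2 F2) as (i' & j' & K1 & K2 & K3 & K4).
      exists (an j). split; [now apply A1|].
      specialize (J4 (C0 1)). specialize (K4 (h t)). rewrite J3, K3 in X.
      assert (Y := dist_B_arc (an i) (A1 i J1)). assert (Z := dist_arc_F (an j') (A2 j' K2)).
      change (e (an i)) with (P i) in Y. change (e (an j')) with (P j') in Z. change (e (an j)) with (P j).
      generalize (edist_pos (h t) (P i')). lra.
Qed.

(** A thin ellipse stays close to the segment between its foci. *)
Lemma seg_near (P Q X : C) (ep : R) : 0 < edist P Q <= 2 -> 0 < ep <= 1 ->
  edist P X + edist X Q <= edist P Q + ep ->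
  exists s, 0 <= s <= 1 /\ edist (P + RtoC s * (Q - P))%C X * edist (P + RtoC s * (Q - P))%C X <= 5 * ep.
Proof.
  intros Hl He H. set (l := edist P Q) in *. set (d := edist P X) in *. set (f := edist X Q) in *.
  assert (Hd := edist_pos P X). assert (Hf := edist_pos X Q). fold d in Hd. fold f in Hf.
  destruct (Rle_dec d l) as [Hdl|Hdl].
  - exists (d / l). assert (Hdl1 : 0 <= d / l <= 1).
    { split; [apply Rdiv_le_0_compat; lra|]. apply Rmult_le_reg_r with l; [lra|].
      unfold Rdiv. rewrite Rmult_assoc, Rinv_l; lra. }
    split; [easy|]. set (s := d / l) in *.
    assert (Hs : s * l = d) by (unfold s; field; lra).
    assert (L2 := edist_sqr P Q). assert (D2 := edist_sqr P X). assert (F2 := edist_sqr X Q).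
    fold l in L2. fold d in D2. fold f in F2.
    set (c := (fst X - fst P) * (fst Q - fst P) + (snd X - snd P) * (snd Q - snd P)).
    assert (EF2 : f * f = d * d - 2 * c + l * l) by (rewrite F2, D2, L2; unfold c; ring).
    assert (E : edist (P + RtoC s * (Q - P))%C X * edist (P + RtoC s * (Q - P))%C X = d * d - 2 * s * c + s * s * (l * l)).
    { rewrite edist_sqr, D2, L2. unfold c. destruct P, Q, X; simpl. ring. }
    rewrite E. replace (s * s * (l * l)) with (d * d) by (rewrite <- Hs; ring).
    assert (Hff : f * f <= (l + ep - d) * (l + ep - d)) by (apply Rmult_le_compat; lra).
    assert (Hc : - 2 * c <= 2 * l * (ep - d) + ep * ep - 2 * ep * d) by nra.
    assert (Hsc : s * (- 2 * c) <= s * (2 * l * (ep - d) + ep * ep - 2 * ep * d)) by (apply Rmult_le_compat_l; lra).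
    replace (s * (2 * l * (ep - d) + ep * ep - 2 * ep * d)) with (2 * (s * l) * (ep - d) + s * (ep * ep - 2 * ep * d)) in Hsc by ring.
    rewrite Hs in Hsc.
    assert (s * (ep * ep - 2 * ep * d) <= ep * ep) by nra. nra.
  - exists 1. split; [lra|]. replace (P + 1 * (Q - P))%C with Q by ring.
    rewrite edist_sym. fold f. nra.
Qed.

Lemma C0_seg1 s : 0 <= s <= 1 -> (C0 0 + RtoC s * (C0 1 - C0 0))%C = C0 s.
Proof.
  intros H. rewrite !C0_1 by lra. unfold Cplus, Cminus, Cmult, Copp, RtoC; simpl. f_equal; ring.
Qed.

Lemma C0_seg2 s : 0 <= s <= 1 -> (C0 1 + RtoC s * (C0 2 - C0 1))%C = C0 (1 + s).
Proof.
  intros H. rewrite !C0_2 by lra. replace ((2 - 2) / sqrt 3) with 0 by (unfold Rdiv; ring).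
  replace ((2 - (1 + s)) / sqrt 3) with ((2 - 1) / sqrt 3 * (1 - s)) by (unfold Rdiv; ring).
  rewrite RtoC_mult, RtoC_minus. ring.
Qed.

Lemma C0_seg3 s : 0 <= s <= 1 -> (C0 3 + RtoC s * (C0 4 - C0 3))%C = C0 (3 + s).
Proof.
  intros H. rewrite !C0_4 by lra. replace (3 - 3) with 0 by ring. replace (4 - 3) with 1 by ring.
  replace (3 + s - 3) with s by ring. ring.
Qed.

Lemma C0_cont_sub x y : 0 <= x -> y <= 4 -> continuous_on (fun t => x <= t <= y) (pt C0).
Proof.
  intros Hx Hy. apply (continuous_on_subset (fun t => 0 <= t <= 4)); [|apply C0_continuous].
  intros t Ht. lra.
Qed.

Lemma on_C0_closed x y X : 0 <= x -> y <= 4 ->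
  (forall eta, 0 < eta <= 1 -> exists u, x <= u <= y /\ edist (C0 u) X <= eta) ->
  exists u, x <= u <= y /\ C0 u = X.
Proof.
  intros Hx Hy H. apply NNPP. intros HN.
  destruct (closed_image x y C0 X (C0_cont_sub x y Hx Hy)) as (z & Z1 & Z2).
  - intros t Ht E. apply HN. now exists t.
  - destruct (H (Rmin (z / 2) 1)) as (u & U1 & U2).
    + split; [apply Rmin_glb_lt; lra|apply Rmin_r].
    + specialize (Z2 u U1). generalize (Rmin_l (z/2) 1). lra.
Qed.

(** Letting the mesh of the grid tend to zero in [near_pieces]. An ellipse with foci B
    and a point of the arc is thin only if that point is close to C, by [far_BC], and
    symmetrically at the other end by [far_EF]. *)
Lemma image_in_C0 h a b tB tF T t : tight h a b tB tF -> visits h a b T -> a <= t <= b ->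
  exists u, 0 <= u <= 4 /\ h t = C0 u /\ (t <= tB -> u <= 1) /\ (tB <= t -> 1 <= u) /\ (tF <= t -> u = 4).
Proof.
  intros Ht HT Htab.
  assert (Hlt := B_before_F h a b tB tF T Ht HT).
  assert (Near := fun ep N w an => near_pieces h a b tB tF T ep N w an t Ht HT).
  assert (EB : h tB = C0 1) by apply Ht.
  assert (Q := len_BC_bound).
  destruct (Rle_dec tF t) as [HF|HF]; [|destruct (Rlt_dec tB t) as [HB|HB]].
  - exists 4. split; [lra|]. split; [|repeat split; lra]. symmetry. apply edist_eq0.
    apply Rnot_lt_le. intros Hpos.
    set (ep := Rmin (1/100) (edist (C0 4) (h t) / 2)).
    assert (Hep : 0 < ep) by (apply Rmin_glb_lt; lra).
    assert (H1 : ep <= 1/100) by apply Rmin_l. assert (H2 : ep <= edist (C0 4) (h t) / 2) by apply Rmin_r.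
    destruct (grid ep ltac:(lra)) as (N & w & an & G).
    destruct (Near ep N w an G H1 Htab) as (_ & X & _). specialize (X HF). lra.
  - destruct (on_C0_closed 1 4 (h t)) as (u & U1 & U2); try lra.
    2:{ exists u. split; [lra|]. split; [easy|]. repeat split; lra. }
    intros eta Heta.
    set (g := eta * eta).
    assert (Hg : 0 < g <= 1) by (unfold g; split; nra).
    (* The grid point is within a distance of order [sqrt ep] of C or E, and the
       ellipse then has width of order [sqrt (sqrt ep)]; hence the fourth power of
       [eta]. *)
    set (ep := g * g / 10000).
    assert (Hep : 0 < ep <= g / 10000).
    { unfold ep. assert (0 < g * g) by nra. assert (g * g <= g) by nra. lra. }
    destruct (grid ep ltac:(lra)) as (N & w & an & G).
    assert (Small : forall k, 0 <= k -> k * k <= 5 * ep -> k <= g / 40).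
    { intros k Hk Hk2. apply le_of_sqr; [lra|]. unfold ep in Hk2. nra. }
    assert (Fin : forall d, 0 <= d -> d * d <= 5 * (ep + g / 40) -> d <= eta).
    { intros d Hd Hd2. apply le_of_sqr; [lra|]. fold g. lra. }
    destruct (Near ep N w an G ltac:(lra) Htab) as (_ & _ & X).
    destruct (X ltac:(lra)) as [(th & A1 & A2)|[(th & A1 & A2)|(th & A1 & A2)]].
    + assert (F := far_BC 1 th ltac:(lra) A1). replace ((2 - 1) / sqrt 3) with len_BC in F by (unfold len_BC, Rdiv; ring).
      set (k := edist (C0 2) (e th)) in *.
      assert (Hk0 : 0 <= k) by apply edist_pos.
      assert (T1 := edist_tri (C0 1) (h t) (e th)).
      assert (T0 := edist_pos (C0 1) (e th)).
      assert (Hk : k <= g / 40).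
      { apply Small; [easy|]. assert (edist (C0 1) (e th) * edist (C0 1) (e th) <= (len_BC + ep) * (len_BC + ep)) by (apply Rmult_le_compat; lra).
        nra. }
      assert (T2 := edist_tri (h t) (e th) (C0 2)). rewrite (edist_sym (e th) (C0 2)) in T2. fold k in T2.
      assert (EBC : edist (C0 1) (C0 2) = len_BC) by (rewrite edist_BC; lra).
      destruct (seg_near (C0 1) (C0 2) (h t) (ep + g / 40)) as (s & S1 & S2); try lra.
      rewrite C0_seg2 in S2 by easy. exists (1 + s). split; [lra|]. apply Fin; [apply edist_pos|easy].
    + assert (F := far_EF 4 th ltac:(lra) A1).
      set (k := edist (C0 3) (e th)) in *.
      assert (Hk0 : 0 <= k) by apply edist_pos.
      assert (T1 := edist_tri (e th) (h t) (C0 4)). rewrite (edist_sym (e th) (C0 4)) in T1.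
      assert (T0 := edist_pos (C0 4) (e th)).
      assert (Hk : k <= g / 40).
      { apply Small; [easy|]. assert (edist (C0 4) (e th) * edist (C0 4) (e th) <= (1 + ep) * (1 + ep)) by (apply Rmult_le_compat; lra).
        nra. }
      assert (T2 := edist_tri (C0 3) (e th) (h t)). fold k in T2.
      assert (EEF : edist (C0 3) (C0 4) = 1) by (rewrite edist_EF; lra).
      destruct (seg_near (C0 3) (C0 4) (h t) (ep + g / 40)) as (s & S1 & S2); try lra.
      rewrite C0_seg3 in S2 by easy. exists (3 + s). split; [lra|]. apply Fin; [apply edist_pos|easy].
    + destruct (param_arc th A1) as [P1 P2]. exists (2 + (th - PI/6) / (7 * PI/6)). split; [lra|].
      rewrite P2. assert (g <= eta) by (unfold g; nra). lra.
  - destruct (on_C0_closed 0 1 (h t)) as (u & U1 & U2); try lra.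
    2:{ exists u. split; [lra|]. split; [easy|]. repeat split; try lra. intros Hb.
        assert (t = tB) as -> by lra. rewrite EB in U2. apply C0_inj in U2; lra. }
    intros eta Heta.
    set (g := eta * eta).
    assert (Hg : 0 < g <= 1) by (unfold g; split; nra).
    set (ep := g / 200). assert (Hep : ep = g / 200) by easy.
    destruct (grid ep ltac:(lra)) as (N & w & an & G).
    destruct (Near ep N w an G ltac:(lra) Htab) as (X & _ & _). specialize (X ltac:(lra)).
    assert (OB : edist (C0 0) (C0 1) = 2 * len_BC) by (rewrite edist_OB; lra).
    rewrite <- C0_0 in X.
    destruct (seg_near (C0 0) (C0 1) (h t) ep) as (s & S1 & S2); try lra.
    rewrite C0_seg1 in S2 by easy. exists s. split; [easy|].
    apply le_of_sqr; [lra|]. fold g. lra.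
Qed.

(** * The parameter along the optimal path *)

(** The parameter of [h t] along the optimal path, unique by injectivity of that path. *)
Definition param (h : R -> C) (a b tB tF : R) (U : R -> R) : Prop :=
  forall t, a <= t <= b -> 0 <= U t <= 4 /\ h t = C0 (U t) /\
    (t <= tB -> U t <= 1) /\ (tB <= t -> 1 <= U t) /\ (tF <= t -> U t = 4).

Definition cont_on (a b : R) (U : R -> R) : Prop :=
  forall x, a <= x <= b -> forall ep, 0 < ep -> exists del, 0 < del /\
    forall y, a <= y <= b -> Rabs (y - x) < del -> Rabs (U y - U x) < ep.

Lemma param_exists h a b tB tF T : tight h a b tB tF -> visits h a b T ->
  exists U, param h a b tB tF U.
Proof.
  intros Ht HT.
  assert (E : forall t, exists u, a <= t <= b -> 0 <= u <= 4 /\ h t = C0 u /\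
    (t <= tB -> u <= 1) /\ (tB <= t -> 1 <= u) /\ (tF <= t -> u = 4)).
  { intros t. destruct (classic (a <= t <= b)) as [H|H].
    - destruct (image_in_C0 h a b tB tF T t Ht HT H) as [u Hu]. now exists u.
    - exists 0. easy. }
  apply fun_choice in E. exact E.
Qed.

(** The optimal path is injective on a compact interval, so its inverse is continuous. *)
Lemma param_continuous h a b tB tF U : tight h a b tB tF -> param h a b tB tF U -> cont_on a b U.
Proof.
  intros (Hc & _) HU x Hx ep Hep.
  destruct (HU x Hx) as (U1 & U2 & _).
  destruct (closed_image 0 (U x - ep) C0 (h x) (C0_cont_sub 0 (U x - ep) ltac:(lra) ltac:(lra))) as (z1 & Z1 & Z2).
  { intros t Ht E. rewrite U2 in E. apply C0_inj in E; lra. }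
  destruct (closed_image (U x + ep) 4 C0 (h x) (C0_cont_sub (U x + ep) 4 ltac:(lra) ltac:(lra))) as (z2 & Z3 & Z4).
  { intros t Ht E. rewrite U2 in E. apply C0_inj in E; lra. }
  rewrite continuous_on_edist in Hc.
  destruct (Hc x Hx (Rmin z1 z2)) as (del & D1 & D2); [now apply Rmin_glb_lt|].
  exists del. split; [easy|]. intros y Hy Hxy. specialize (D2 y Hy Hxy).
  destruct (HU y Hy) as (V1 & V2 & _). rewrite V2, edist_sym in D2.
  generalize (Rmin_l z1 z2) (Rmin_r z1 z2). intros M1 M2.
  apply Rabs_def1.
  - apply Rnot_le_lt. intros H. specialize (Z4 (U y) ltac:(lra)). lra.
  - apply Rnot_le_lt. intros H. specialize (Z2 (U y) ltac:(lra)). lra.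
Qed.

Lemma clamp_in p q x : p <= q -> p <= clamp p q x <= q.
Proof. intros H. unfold clamp, Rmin, Rmax. repeat destruct Rle_dec; lra. Qed.

Lemma clamp_contract p q x y : Rabs (clamp p q x - clamp p q y) <= Rabs (x - y).
Proof. unfold clamp, Rmin, Rmax, Rabs. repeat destruct Rle_dec; repeat destruct Rcase_abs; lra. Qed.

Lemma cont_on_IVT a b U p q v : cont_on a b U -> a <= p <= q -> q <= b -> U p <= v <= U q ->
  exists s, p <= s <= q /\ U s = v.
Proof.
  intros Hc Hp Hq Hv.
  destruct (IVT_gen (fun x => U (clamp p q x)) p q v) as (x & X1 & X2).
  - intros x eps Heps.
    assert (Hx := clamp_in p q x ltac:(lra)).
    destruct (Hc (clamp p q x) ltac:(lra) eps Heps) as (del & D1 & D2).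
    exists del. split; [easy|]. intros y [_ Hy]. simpl in *. unfold Rdist in *.
    assert (Hy' := clamp_in p q y ltac:(lra)).
    apply D2; [lra|]. generalize (clamp_contract p q y x). lra.
  - rewrite (clamp_low p q p), (clamp_high p q q) by lra.
    rewrite Rmin_left, Rmax_right; lra.
  - exists (clamp p q x). split; [apply clamp_in; lra|easy].
Qed.

(** By the intermediate value theorem, the contact points whose parameters lie between
    those of [h p] and [h q] are visited between the times [p] and [q]. *)
Lemma visits_within h a b tB tF U p q : param h a b tB tF U -> cont_on a b U ->
  a <= p <= q -> q <= b -> forall th, on_arc th ->
  U p <= 2 + (th - PI/6) / (7 * PI/6) <= U q -> exists s, p <= s <= q /\ h s = e th.
Proof.
  intros HU Hc Hp Hq th Hth Hv.
  destruct (cont_on_IVT a b U p q _ Hc Hp Hq Hv) as (s & S1 & S2).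
  exists s. split; [easy|]. destruct (HU s ltac:(lra)) as (_ & E & _). rewrite E, S2.
  now apply param_arc.
Qed.

Lemma choose_visits (h : R -> C) (p q : R) : (forall th, on_arc th -> exists s, p <= s <= q /\ h s = e th) ->
  exists T, forall th, on_arc th -> p <= T th <= q /\ h (T th) = e th.
Proof.
  intros H.
  assert (E : forall th, exists s, on_arc th -> p <= s <= q /\ h s = e th).
  { intros th. destruct (classic (on_arc th)) as [Hth|Hth].
    - destruct (H th Hth) as [s Hs]. now exists s.
    - exists 0. easy. }
  apply fun_choice in E. exact E.
Qed.

Lemma small_ep D : 0 < D -> exists ep, 0 < ep <= 1/100 /\ 4 * ep <= D.
Proof.
  intros HD. exists (Rmin (1/100) (D / 4)).
  generalize (Rmin_l (1/100) (D/4)) (Rmin_r (1/100) (D/4)).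
  assert (0 < Rmin (1/100) (D/4)) by (apply Rmin_glb_lt; lra). intros. lra.
Qed.

(** Suppose that the parameter decreases from [t] to [t']. Inserting both times into a
    polygon through O, B, the grid and F makes it run forth, back and forth again
    between [h t] and [h t'], which costs at least the fixed positive distance of these
    points, while the grid can be chosen so fine that the polygon is within a fraction
    of it from [L0]. The visiting times of the grid points are chosen on the side of
    [t], [t'] prescribed by their parameters. *)
Lemma param_monotone h a b tB tF T U : tight h a b tB tF -> visits h a b T -> param h a b tB tF U ->
  forall t t', a <= t <= t' -> t' <= b -> U t <= U t'.
Proof.
  intros Ht HT HU t t' Htt Hb'.
  assert (Hc := param_continuous h a b tB tF U Ht HU).
  assert (Hlt := B_before_F h a b tB tF T Ht HT).
  assert (Ht' := Ht). destruct Ht' as (_ & Ha & Hp & HB & EB & HF & EF).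
  assert (Q := len_BC_bound). rewrite L0_len_BC in Hp. assert (Hpi := PI_RGT_0).
  assert (OB : edist origin (C0 1) = 2 * len_BC) by (rewrite <- C0_0, edist_OB; lra).
  destruct (HU t ltac:(lra)) as (R1 & X1 & A1 & A2 & A3).
  destruct (HU t' ltac:(lra)) as (R1' & X1' & A1' & A2' & A3').
  apply Rnot_lt_le. intros Hu.
  assert (HD : 0 < edist (C0 (U t)) (C0 (U t'))).
  { apply Rnot_le_lt. intros Hle. apply edist_eq0 in Hle. apply C0_inj in Hle; lra. }
  destruct (small_ep _ HD) as (ep & Hep & Hep4).
  destruct (grid ep ltac:(lra)) as (N & w & an & G).
  assert (G' := G). destruct G' as (G1 & G2 & G3 & G4 & G5).
  destruct (Rle_dec tF t') as [Hf|Hf]. { specialize (A3' Hf). lra. }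
  assert (UB : U tB = 1). { destruct (HU tB HB) as (_ & _ & B1 & B2 & _). lra. }
  assert (UF : U tF = 4). { destruct (HU tF HF) as (_ & _ & _ & _ & B3). lra. }
  destruct (Rle_dec t' tB) as [Htb|Htb].
  { (* along the first segment *)
    assert (Hin := arc_between_B_and_F h a b tB tF T ep N w an Ht HT G ltac:(lra)).
    assert (V : forall i, (i <= N)%nat -> tB <= T (an i) <= tF /\ h (T (an i)) = e (an i)).
    { intros i Hi. split; [now apply Hin|]. apply HT. now apply G4. }
    destruct (visit_all_between h tB tF T ep N w an (C0 1) (C0 4) len_BC 1 0 G ltac:(lra) V dist_B_arc dist_arc_F (edist_pos _ _))
      as (ts & T1 & Y).
    assert (X := Hp (t :: t' :: tB :: ts ++ tF :: [])).
    rewrite ?plen_cons, ?plen_visit, ?plen_cons, plen_nil, EB, EF in X.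
    specialize (X ltac:(simpl; split; [lra|split; [lra|split; [lra|]]]; apply incr_app; [easy|simpl; lra])).
    rewrite X1, X1' in X. rewrite <- C0_0, edist_OB in X by lra.
    rewrite (edist_sym (C0 (U t)) (C0 (U t'))), edist_OB in X, HD, Hep4 by lra.
    rewrite edist_OB in X by lra. lra. }
  destruct (Rle_dec t tB) as [Hta|Hta]. { specialize (A1 Hta). specialize (A2' ltac:(lra)). lra. }
  specialize (A2 ltac:(lra)). specialize (A2' ltac:(lra)).
  destruct (Rle_dec (U t) 2) as [Hu2|Hu2]; [|destruct (Rle_dec 3 (U t)) as [Hu3|Hu3]].
  - (* along the first tangent *)
    destruct (choose_visits h t' tF) as [T' HT'].
    { intros th Hth. apply (visits_within h a b tB tF U); try easy; try lra.
      destruct (param_arc th Hth). lra. }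
    assert (dA : forall th, on_arc th -> len_BC * (2 - U t') <= edist (h t') (e th)).
    { intros th Hth. rewrite X1'. generalize (dist_BC_arc (U t') th ltac:(lra) Hth). unfold len_BC, Rdiv. lra. }
    destruct (visit_all_between h t' tF T' ep N w an (h t') (C0 4) (len_BC * (2 - U t')) 1 0 G ltac:(lra)
      ltac:(intros i Hi; apply HT'; now apply G4) dA dist_arc_F (edist_pos _ _)) as (ts & T1 & Y).
    assert (X := Hp (tB :: t :: t' :: ts ++ tF :: [])).
    rewrite ?plen_cons, ?plen_visit, ?plen_cons, plen_nil, EB, EF in X.
    specialize (X ltac:(simpl; split; [lra|split; [lra|split; [lra|]]]; apply incr_app; [easy|simpl; lra])).
    rewrite X1, X1' in *. rewrite OB in X. rewrite (edist_BC 1 (U t)) in X by lra.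
    rewrite (edist_sym (C0 (U t)) (C0 (U t'))), edist_BC in X, HD, Hep4 by lra. lra.
  - (* along the last tangent *)
    destruct (choose_visits h tB t) as [T' HT'].
    { intros th Hth. apply (visits_within h a b tB tF U); try easy; try lra.
      destruct (param_arc th Hth). lra. }
    assert (dA : forall th, on_arc th -> U t - 3 <= edist (e th) (h t)).
    { intros th Hth. rewrite X1, edist_sym. apply dist_EF_arc; [lra|easy]. }
    destruct (visit_all_between h tB t T' ep N w an (C0 1) (h t) len_BC (U t - 3) 0 G ltac:(lra)
      ltac:(intros i Hi; apply HT'; now apply G4) dist_B_arc dA (edist_pos _ _)) as (ts & T1 & Y).
    assert (X := Hp (tB :: ts ++ t :: t' :: tF :: [])).
    rewrite ?plen_cons, ?plen_visit, ?plen_cons, plen_nil, EB, EF in X.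
    specialize (X ltac:(simpl; split; [lra|]; apply incr_app; [easy|simpl; lra])).
    rewrite X1, X1' in *. rewrite OB in X.
    destruct (Rle_dec 3 (U t')) as [Hu3'|Hu3'].
    + rewrite (edist_sym (C0 (U t)) (C0 (U t'))), edist_EF in X, HD, Hep4 by lra.
      rewrite edist_EF in X by lra. lra.
    + assert (Z := dist_mid_F (U t') ltac:(lra)). lra.
  - (* along the arc *)
    destruct (choose_visits h tB tF) as [T' HT'].
    { intros th Hth. apply (visits_within h a b tB tF U); try easy; try lra.
      destruct (param_arc th Hth). lra. }
    assert (E : forall th, exists s, on_arc th -> (h s = e th) /\
       (2 + (th - PI/6) / (7 * PI/6) <= U t -> tB <= s <= t) /\
       (U t < 2 + (th - PI/6) / (7 * PI/6) -> t' <= s <= tF)).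
    { intros th. destruct (classic (on_arc th)) as [Hth|Hth]; [|now exists 0].
      destruct (param_arc th Hth) as [Q1 _].
      destruct (Rle_dec (2 + (th - PI/6) / (7 * PI/6)) (U t)) as [Hle|Hle].
      - destruct (visits_within h a b tB tF U tB t HU Hc ltac:(lra) ltac:(lra) th Hth ltac:(lra)) as (s & S1 & S2).
        exists s. intros _. repeat split; try easy; try lra.
      - destruct (visits_within h a b tB tF U t' tF HU Hc ltac:(lra) ltac:(lra) th Hth ltac:(lra)) as (s & S1 & S2).
        exists s. intros _. repeat split; try easy; try lra. }
    apply fun_choice in E. destruct E as [S HS].
    set (f := fun i => 2 + (an i - PI/6) / (7 * PI/6)). set (P := fun i => e (an i)).
    destruct (split_times f (U t) (indices N) (indices_NoDup N)) as (I1 & I2 & N1 & N2 & S1 & S2 & L1).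
    rewrite indices_length in L1.
    assert (Len : w * INR (length I1) + w * INR (length I2) = w * INR N + w).
    { replace (w * INR N + w) with (w * (INR N + 1)) by ring. rewrite <- L1. ring. }
    assert (J1 : forall i, In i I1 -> (i <= N)%nat /\ f i <= U t).
    { intros i Hi. apply S1 in Hi. rewrite indices_In in Hi. easy. }
    assert (J2 : forall i, In i I2 -> (i <= N)%nat /\ U t < f i).
    { intros i Hi. apply S2 in Hi. rewrite indices_In in Hi. easy. }
    destruct (visit_block_between h (fun i => S (an i)) P w N I1 tB t (C0 1) (h t) len_BC 0 0) as (t1 & T1 & Y1); try easy; try lra.
    { intros i Hi. destruct (J1 i Hi) as [K1 K2]. destruct (HS (an i) (G4 i K1)) as (M1 & M2 & _).
      split; [easy|]. split; [now apply M2|easy]. }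
    { intros i Hi. apply dist_B_arc, G4. now apply J1. }
    { intros i Hi. apply edist_pos. } { apply edist_pos. }
    destruct (visit_block_between h (fun i => S (an i)) P w N I2 t' tF (h t') (C0 4) 0 1 1) as (t2 & T2 & Y2); try easy; try lra.
    { intros i Hi. destruct (J2 i Hi) as [K1 K2]. destruct (HS (an i) (G4 i K1)) as (M1 & _ & M2).
      split; [easy|]. split; [now apply M2|easy]. }
    { intros i Hi. apply edist_pos. }
    { intros i Hi. apply dist_arc_F, G4. now apply J2. }
    { rewrite X1'. apply dist_mid_F. lra. }
    assert (X := Hp (tB :: t1 ++ t :: t' :: t2 ++ tF :: [])).
    rewrite ?plen_cons, ?plen_visit, ?plen_cons, ?plen_visit, plen_nil, EB, EF in X.
    specialize (X ltac:(simpl; split; [lra|]; apply incr_app; [easy|]; simpl; split; [lra|]; apply incr_app; [easy|simpl; lra])).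
    rewrite X1, X1' in *. rewrite OB in X.
    (* The first grid point is C, which is visited before [t]. *)
    assert (F1 : I1 <> []).
    { intros E. assert (F : In 0%nat I1); [|now rewrite E in F].
      apply S1. rewrite indices_In. split; [lia|]. unfold f. rewrite G3.
      replace ((PI/6 - PI/6) / (7 * PI/6)) with 0 by (unfold Rdiv; ring). lra. }
    destruct Y1 as [[F _]|[_ Y1]]; [easy|].
    destruct Y2 as [[F2 Y2]|[F2 Y2]]; [rewrite F2, INR_length_nil in *|]; lra.
Qed.

(** * Solutions are isometric copies of the optimal path *)

Lemma e_mult a b : (e a * e b)%C = e (a + b).
Proof. unfold e, Cmult; simpl. rewrite cos_plus, sin_plus. f_equal; ring. Qed.

Lemma e_inv a p : (e (- a) * (e a * p))%C = p.
Proof.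
  rewrite Cmult_assoc, e_mult. replace (- a + a) with 0 by ring.
  unfold e. rewrite cos_0, sin_0. apply Cmult_1_l.
Qed.

Lemma edist_rot a p q : edist (e a * p)%C (e a * q)%C = edist p q.
Proof.
  unfold edist. replace (e a * q - e a * p)%C with (e a * (q - p))%C by ring.
  rewrite Cmod_mult, Cmod_e. ring.
Qed.

Lemma mirror_mirror cj p : mirror cj (mirror cj p) = p.
Proof. destruct cj; [apply conj_conj|easy]. Qed.

Lemma Cmod_mirror cj p : Cmod (mirror cj p) = Cmod p.
Proof. destruct cj; [apply Cmod_conj|easy]. Qed.

(** The isometry found by [solution_targets] turns the solution into a tight curve, to
    which the description by a parameter applies. *)
Lemma solution_is_C0 (g : curve) : is_solution g -> exists cj k U,
  (forall t, lo g <= t <= hi g -> g t = mirror cj (e k * C0 (U t))%C) /\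
  cont_on (lo g) (hi g) U /\ U (lo g) = 0 /\ U (hi g) = 4 /\
  (forall t t', lo g <= t <= t' -> t' <= hi g -> U t <= U t').
Proof.
  intros [Hg Hmin]. assert (Hs3 := sqrt3_bound). assert (Hpi := PI_RGT_0).
  assert (Hlen : path_length g <= L0).
  { apply Rle_trans with (path_length C0); [apply Hmin, C0_admissible|apply C0_length_le]. }
  destruct (solution_targets g Hg Hlen) as (cj & k & (tB & B1 & B2) & (tF & F1 & F2) & HA).
  assert (Hg' := Hg). destruct Hg' as (Hpath & Ho & _). assert (Hlh := proj1 Hpath).
  (* The copy found by [solution_targets] starts at the tangent direction [k], the
     optimal path at [-PI/6]. *)
  set (K := k + PI/6).
  set (h := fun t => (e (- K) * mirror cj (g t))%C).
  assert (Hh : forall t, g t = mirror cj (e K * h t)%C).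
  { intros t. unfold h. replace K with (- - K) at 1 by ring. rewrite e_inv. now rewrite mirror_mirror. }
  assert (Hdist : forall x y, edist (h x) (h y) = edist (g x) (g y)).
  { intros x y. unfold h. now rewrite edist_rot, edist_mirror. }
  assert (H0 : h (lo g) = origin).
  { unfold h. rewrite Ho. destruct cj; simpl; rewrite ?conj_origin; unfold Cmult, origin; simpl; f_equal; ring. }
  assert (Ht : tight h (lo g) (hi g) tB tF).
  { split; [|split; [easy|split; [|split; [easy|split; [|split; [easy|]]]]]].
    - destruct Hpath as (_ & Hc & _). rewrite continuous_on_edist in *. intros x Hx ep Hep.
      destruct (Hc x Hx ep Hep) as (del & D1 & D2). exists del. split; [easy|].
      intros y Hy Hxy. rewrite Hdist. now apply D2.
    - intros ts Hts. apply Rle_trans with (path_length g); [|easy].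
      rewrite <- H0. replace (plen (h (lo g)) (map h ts)) with (plen (g (lo g)) (map g ts)).
      + now apply polygon_le_length.
      + generalize (lo g). clear - Hdist. induction ts as [|t ts IH]; intros x; [easy|].
        simpl. rewrite Hdist. now rewrite IH.
    - unfold h. rewrite B2. unfold Bk. fold K. rewrite C0_1 by lra.
      replace (dilate (2 / sqrt 3) (e K)) with (RtoC (2 / sqrt 3) * e K)%C.
      + replace (e (- K) * (RtoC (2 / sqrt 3) * e K))%C with (RtoC (2 / sqrt 3) * (e (-K) * e K))%C by ring.
        rewrite e_mult. replace (- K + K) with 0 by ring. unfold e. rewrite cos_0, sin_0.
        unfold Cmult, RtoC; simpl. f_equal; ring.
      + unfold dilate, Cmult, RtoC; simpl. f_equal; ring.
    - unfold h. rewrite F2. unfold Fk. rewrite C0_4 by lra.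
      replace (e (- K) * (e (k + 3 * PI / 2) + e k))%C with (e (-K) * e (k + 3 * PI/2) + e (-K) * e k)%C by ring.
      rewrite !e_mult. replace (- K + (k + 3 * PI/2)) with (4 * PI/3) by (unfold K; field).
      rewrite <- (e_2PI (- K + k)). replace (- K + k + 2 * PI) with (4 * PI/3 + PI/2) by (unfold K; field).
      replace (4 - 3) with 1 by ring. ring. }
  assert (HV : exists T, visits h (lo g) (hi g) T).
  { destruct (choose_visits h (lo g) (hi g)) as [T HT]; [|now exists T].
    intros th Hth. unfold on_arc in Hth. destruct (HA (th + PI/6) ltac:(lra)) as (t & T1 & T2).
    exists t. split; [easy|]. unfold h. rewrite T2, e_mult. f_equal. unfold K. ring. }
  destruct HV as [T HT].
  destruct (param_exists h (lo g) (hi g) tB tF T Ht HT) as [U HU].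
  exists cj, K, U. split; [|split; [|split; [|split]]].
  - intros t Htt. rewrite Hh. destruct (HU t Htt) as (_ & E & _). now rewrite E.
  - now apply param_continuous with h tB tF.
  - destruct (HU (lo g) ltac:(lra)) as (R1 & E & _). rewrite H0, <- C0_0 in E. symmetry. apply C0_inj; [lra|easy|easy].
  - destruct (HU (hi g) ltac:(lra)) as (_ & _ & _ & _ & E). apply E. lra.
  - now apply (param_monotone h (lo g) (hi g) tB tF T U).
Qed.

Lemma cont_on_continuous U : cont_on 0 1 U -> continuous_on (fun s => 0 <= s <= 1) U.
Proof.
  intros H x Hx. rewrite filterlim_locally. intros eps.
  destruct (H x Hx eps (cond_pos eps)) as (del & H1 & H2).
  exists (mkposreal _ H1). intros y Hy HDy. apply H2; [easy|exact Hy].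
Qed.

Theorem theorem1 :
  is_solution C0 /\
  forall g : curve, is_solution g ->
    exists f : C -> C,
      (is_rotation f \/ is_reflection f) /\
      maps_K_to_itself f /\
      same_path g (image f C0).
Proof.
  split; [apply C0_solution|].
  intros g Hg. destruct (solution_is_C0 g Hg) as (cj & k & U & H1 & H2 & H3 & H4 & H5).
  assert (Hlh : lo g <= hi g) by apply Hg.
  exists (fun p => mirror cj (e k * p)%C). split; [|split].
  - destruct cj.
    + right. exists 0%C, (- k / 2). intros p. simpl. rewrite Cmult_conj.
      replace (2 * (- k / 2)) with (- k) by field.
      replace (Cconj (e k)) with (e (- k)).
      * replace (p - 0)%C with p by ring. ring.
      * unfold e, Cconj; simpl. rewrite cos_neg, sin_neg. easy.
    + left. exists 0%C, k. intros p. simpl. ring.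
  - intros q. unfold K. split.
    + intros Hq. exists (e (- k) * mirror cj q)%C. split.
      * now rewrite Cmod_mult, Cmod_e, Cmod_mirror, Hq, Rmult_1_l.
      * replace k with (- - k) at 1 by ring. rewrite e_inv. apply mirror_mirror.
    + intros (p & P1 & <-). now rewrite Cmod_mirror, Cmod_mult, Cmod_e, P1, Rmult_1_l.
  - set (phi := fun s => lo g + s * (hi g - lo g)).
    assert (Hphi : forall s, 0 <= s <= 1 -> lo g <= phi s <= hi g) by (intros s Hs; unfold phi; split; nra).
    exists phi, (fun s => U (phi s)). split; [|split].
    + split; [|split; [|split]].
      * apply cont_on_continuous. intros x Hx ep Hep.
        exists (ep / (1 + (hi g - lo g))). split; [apply Rdiv_lt_0_compat; lra|].
        intros y Hy Hxy. unfold phi.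
        replace (lo g + y * (hi g - lo g) - (lo g + x * (hi g - lo g))) with ((y - x) * (hi g - lo g)) by ring.
        rewrite Rabs_mult, (Rabs_pos_eq (hi g - lo g)) by lra.
        apply (Rmult_lt_compat_r (1 + (hi g - lo g))) in Hxy; [|lra].
        unfold Rdiv in Hxy. rewrite Rmult_assoc, Rinv_l, Rmult_1_r in Hxy by lra.
        generalize (Rabs_pos (y - x)). nra.
      * intros s s' Hs Hss Hs'. unfold phi. nra.
      * unfold phi. ring.
      * unfold phi. ring.
    + split; [|split; [|split]].
      * apply cont_on_continuous. intros x Hx ep Hep.
        destruct (H2 (phi x) (Hphi x Hx) ep Hep) as (del & D1 & D2).
        exists (del / (1 + (hi g - lo g))). split; [apply Rdiv_lt_0_compat; lra|].
        intros y Hy Hxy. apply D2; [now apply Hphi|]. unfold phi.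
        replace (lo g + y * (hi g - lo g) - (lo g + x * (hi g - lo g))) with ((y - x) * (hi g - lo g)) by ring.
        rewrite Rabs_mult, (Rabs_pos_eq (hi g - lo g)) by lra.
        apply (Rmult_lt_compat_r (1 + (hi g - lo g))) in Hxy; [|lra].
        unfold Rdiv in Hxy. rewrite Rmult_assoc, Rinv_l, Rmult_1_r in Hxy by lra.
        generalize (Rabs_pos (y - x)). nra.
      * intros s s' Hs Hss Hs'. apply H5; [split; [apply Hphi; lra|unfold phi; nra]|apply Hphi; lra].
      * unfold phi. rewrite Rmult_0_l, Rplus_0_r. exact H3.
      * unfold phi. replace (lo g + 1 * (hi g - lo g)) with (hi g) by ring. exact H4.
    + intros s Hs. apply H1. now apply Hphi.
Qed.
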